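(* Let $(\mathcal M,\mathcal N,\mathcal D)$ be a (not necessarily full) Cartan triple, let $\mathcal B\subseteq\mathcal M$ be a weak-$*$ closed $\mathcal N$-bimodule, and set $$\mathcal B_0=\overline{\operatorname{span}}^{\,w*}(\mathcal{GN}(\mathcal M,\mathcal D)\cap\mathcal B)\quad\text{and}\quad\mathcal B_1=\overline{\operatorname{span}}^{\,\mathrm{Bures}}(\mathcal{GN}(\mathcal M,\mathcal D)\cap\mathcal B).$$ Then $\mathcal B_0$ and $\mathcal B_1$ are weak-$*$ closed $\mathcal N$-bimodules satisfying $\mathcal B_0\subseteq\mathcal B_1$ and $$\mathcal{GN}(\mathcal M,\mathcal D)\cap\mathcal B_0=\mathcal{GN}(\mathcal M,\mathcal D)\cap\mathcal B=\mathcal{GN}(\mathcal M,\mathcal D)\cap\mathcal B_1.$$ Furthermore, when $(\mathcal M,\mathcal N,\mathcal D)$ is a full Cartan triple, $$\mathcal B_0\subseteq\mathcal B\subseteq\mathcal B_1=\overline{\mathcal B}^{\,\mathrm{Bures}}.$$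
   Context: Von Neumann subalgebras are understood to contain the unit of the ambient algebra. For a von Neumann algebra $\mathcal M$ and a von Neumann subalgebra $\mathcal L\subseteq\mathcal M$, put $\mathcal{GN}(\mathcal M,\mathcal L)=\{v\in\mathcal M: v\text{ is a partial isometry and } v^*\mathcal Lv\cup v\mathcal Lv^*\subseteq\mathcal L\}$; $\mathcal L$ is regular in $\mathcal M$ if the linear span of $\mathcal{GN}(\mathcal M,\mathcal L)$ is weak-$*$ dense in $\mathcal M$. A Cartan triple $(\mathcal M,\mathcal N,\mathcal D)$ consists of von Neumann algebras such that (1) $\mathcal D$ is an abelian and regular von Neumann subalgebra of $\mathcal M$; (2) $\mathcal N$ is the relative commutant of $\mathcal D$ in $\mathcal M$; (3) there exists a faithful normal conditional expectation $E:\mathcal M\to\mathcal N$. It is full if $\mathcal D=\mathcal Z(\mathcal N)$. The ($E$-)Bures topology on $\mathcal M$ is the locally convex topology determined by the seminorms $x\mapsto\rho(E(x^*x))^{1/2}$, $\rho\in\mathcal N_*^+$. An $\mathcal N$-bimodule in $\mathcal M$ is a linear subspace $\mathcal B\subseteq\mathcal M$ with $\mathcal N\mathcal B\mathcal N\subseteq\mathcal B$. $\overline{\operatorname{span}}^{\,w*}$ and $\overline{\operatorname{span}}^{\,\mathrm{Bures}}$ denote closed linear span in the weak-$*$ and Bures topologies. *)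

(* Defs.v *)
From HB Require Import structures.
From mathcomp Require Import all_boot all_order all_algebra.
From mathcomp Require Import complex.
From mathcomp Require Import all_classical all_reals all_analysis.

Set Implicit Arguments.
Unset Strict Implicit.
Unset Printing Implicit Defensive.

Import Order.TTheory GRing.Theory Num.Theory numFieldNormedType.Exports.

Local Open Scope classical_set_scope.
Local Open Scope ring_scope.

(* Complex numbers over [R], typed as a [numClosedFieldType] so that the
   topology that the library puts on every [numFieldType] is inferred. *)
Definition cplx (R : realType) : numClosedFieldType := complex R.

(* The inner product is linear in the first variable and conjugate-linear in
   the second one. *)
HB.mixin Record isHilbert (R : realType) H
    of CompleteNormedModule (cplx R) H := {
  inner : {dot H for (@Num.conj (cplx R))} ;
  inner_norm : forall x : H, inner x x = `|x| ^+ 2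
}.

#[short(type="hilbertType")]
HB.structure Definition Hilbert (R : realType) :=
  {H of isHilbert R H & CompleteNormedModule (cplx R) H}.

Section LocallyConvex.
Context {R : realType} {V : lmodType (cplx R)}.
Local Notation C := (cplx R).
Implicit Types (S A M : set V) (P : set (V -> C)).

Definition subspace S :=
  S 0 /\ forall (a : C) x y, S x -> S y -> S (a *: x + y).

Definition lin_span A : set V := [set x | exists n (c : 'I_n -> C) (v : 'I_n -> V),
  (forall i, A (v i)) /\ x = \sum_(i < n) c i *: v i].

(* Closure of [A] in the space [M] for the locally convex topology on [M]
   determined by the family [P] of seminorms on [M]: the sets
   [y | p_1 (y - x) < e, ..., p_n (y - x) < e] form a neighbourhood base of
   [x].  The values of the seminorms are the nonnegative reals of [C]. *)
Definition lc_closure M P A : set V := [set x | M x /\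
  forall n (p : 'I_n -> V -> C) (e : C), (forall i, P (p i)) -> 0 < e ->
    exists2 y, (A `&` M) y & forall i, p i (y - x) < e].

End LocallyConvex.

Section VonNeumannAlgebras.
Context {R : realType} {H : hilbertType R}.
Local Notation C := (cplx R).
Local Notation op := (H -> H).
Implicit Types (T x y v p : op) (A L M N D B : set op).

Definition bounded_op : set op := [set T | linear T /\ continuous T].

(* Only meaningful on bounded operators, where the adjoint exists and is
   unique. *)
Definition adjoint T : op :=
  get [set S : op | forall a b, inner (S a) b = inner a (T b)].

Definition positive_op T := forall a, 0 <= inner (T a) a.

Definition commutant A : set op :=
  [set T | bounded_op T /\ forall S, A S -> T \o S = S \o T].

Record von_neumann_algebra M : Prop := VonNeumannAlgebra {
  vna_bounded : M `<=` bounded_op ;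
  vna_subspace : subspace M ;
  vna_id : M idfun ;
  vna_comp : forall x y, M x -> M y -> M (x \o y) ;
  vna_adjoint : forall x, M x -> M (adjoint x) ;
  vna_bicommutant : commutant (commutant M) = M
}.

Definition von_neumann_subalgebra M L := von_neumann_algebra L /\ L `<=` M.

Definition relative_commutant M L := M `&` commutant L.

Definition center N := relative_commutant N N.

Definition abelian_alg L := forall x y, L x -> L y -> x \o y = y \o x.

(* The predual of [M], as the set of restrictions to [M] of the normal
   functionals T |-> \sum_n <T xi_n, eta_n>, with xi and eta square summable.
   The values of [phi] outside of [M] are irrelevant. *)
Definition predual M : set (op -> C) := [set phi |
  exists xi eta : nat -> H,
    [/\ cvgn (series (fun n => `|xi n| ^+ 2 : C)),
        cvgn (series (fun n => `|eta n| ^+ 2 : C)) &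
        forall x, M x ->
          series (fun n => inner (x (xi n)) (eta n) : C) @ \oo --> phi x]].

Definition predual_pos M : set (op -> C) := [set rho |
  predual M rho /\ forall x, M x -> 0 <= rho (adjoint x \o x)].

Definition weak_star_seminorms M : set (op -> C) :=
  [set q | exists2 phi, predual M phi & q = (fun x => `|phi x|)].

Definition weak_star_closure M A := lc_closure M (weak_star_seminorms M) A.

Definition weak_star_closed M A := weak_star_closure M A = A.

Definition weak_star_dense M A := weak_star_closure M A = M.

Definition projection p := p \o p = p /\ adjoint p = p.

Definition partial_isometry v := projection (adjoint v \o v).

Definition GN M L : set op := [set v | [/\ M v, partial_isometry v &
  forall l, L l -> L (adjoint v \o l \o v) /\ L (v \o l \o adjoint v)]].

Definition regular_subalgebra M L := weak_star_dense M (lin_span (GN M L)).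

Record conditional_expectation M N (E : op -> op) : Prop :=
  ConditionalExpectation {
  ce_range : forall x, M x -> N (E x) ;
  ce_linear : forall (a : C) x y, M x -> M y -> E (a *: x + y) = a *: E x + E y ;
  ce_id : forall x, N x -> E x = x ;
  ce_positive : forall x, M x -> positive_op (E (adjoint x \o x)) ;
  ce_bimodule : forall m n x, N m -> N n -> M x ->
    E (m \o x \o n) = m \o E x \o n
}.

Definition faithful_map M (E : op -> op) :=
  forall x, M x -> E (adjoint x \o x) = 0 -> x = 0.

(* Normality, i.e. weak-* continuity. *)
Definition normal_map M N (E : op -> op) :=
  forall phi, predual N phi -> predual M (phi \o E).

Definition faithful_normal_ce M N (E : op -> op) :=
  [/\ conditional_expectation M N E, faithful_map M E & normal_map M N E].

Record cartan_triple M N D : Prop := CartanTriple {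
  ct_vnaM : von_neumann_algebra M ;
  ct_vnaN : von_neumann_subalgebra M N ;
  ct_vnaD : von_neumann_subalgebra M D ;
  ct_abelian : abelian_alg D ;
  ct_regular : regular_subalgebra M D ;
  ct_commutant : N = relative_commutant M D ;
  ct_expectation : exists E, faithful_normal_ce M N E
}.

Definition full_cartan_triple M N D := cartan_triple M N D /\ D = center N.

Definition bures_seminorms N (E : op -> op) : set (op -> C) :=
  [set q | exists2 rho, predual_pos N rho &
    q = (fun x => sqrtC (rho (E (adjoint x \o x))))].

Definition bures_closure M N (E : op -> op) A :=
  lc_closure M (bures_seminorms N E) A.

Record bimodule M N B : Prop := Bimodule {
  bimod_sub : B `<=` M ;
  bimod_subspace : subspace B ;
  bimod_act : forall m n b, N m -> N n -> B b -> B (m \o b \o n)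
}.

Definition weak_star_closed_bimodule M N B :=
  bimodule M N B /\ weak_star_closed M B.

End VonNeumannAlgebras.

(* Main.v *)
From HB Require Import structures.
From mathcomp Require Import all_boot all_order all_algebra.
From mathcomp Require Import complex.
From mathcomp Require Import all_classical all_reals all_analysis.
From mathcomp Require Import ring lra.

Require Import Defs.

(** Why the theorem holds.

    A normal functional has the form [x |-> <x f, g>] for square summable
    sequences [f], [g] of vectors, on which operators act entrywise.  By
    finite-dimensional separation, a point of [M] is in the weak-* closure of a
    subspace [S] if and only if every normal functional that vanishes on [S]
    vanishes at it ([weak_star_closureP]).  Together with orthogonal projection
    in the Hilbert space of square summable sequences, this shows that [x f] is
    in the norm closure of [S f] whenever [x] is in the weak-* closure of [S]
    ([mazur]).  The Bures seminorms are dominated by norms [x |-> |x f|]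
    ([wip_dominated]), so the Bures closure of a subspace contains its weak-*
    closure and is itself weak-* closed.  The span of [GN M D `&` B] is stable
    under multiplication by unitaries of [N], and these span [N]
    ([vna_unitary_span]); hence both closures are bimodules.

    The link between [B] and its normalizers is that [v E (v^* b)] is in [B] for
    [v] in [GN M D] and [b] in [B] ([mean_in_bimodule]).  Indeed, for
    [y = v^* b], the operator [E y] is a weak-* limit of averages of [u y u^*]
    over unitaries [u] of [D], and [v u y u^* = (v u v^* ) b u^*] is in [B].  If
    [v] in [GN M D] is a Bures limit of elements [b] of the span of
    [GN M D `&` B], then [v E (v^* b)] tends to [v E (v^* v) = v] in the weak-*
    topology, so [v] is in [B] ([GN_B1_sub_B]).

    Let the triple be full.  For [v] in [GN M D], the [n] in [N] with [v n] in
    [B] form a two-sided ideal whose central support [q] is in [D] and satisfies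
    [v q] in [B]; so [v n = (v q) n] is in the bimodule generated by
    [GN M D `&` B] ([GN_N_in_B0]).  In particular [v E (v^* b)] is in [B0] for
    every [b] in [B].  Given [x] in [B] and a positive normal functional [rho] of
    [N], subtract from [x] a nearly closest element of [B0] for the form
    [<a, b> = rho (E (b^* a))].  The difference [b] is nearly orthogonal to [B0],
    in particular to [v E (v^* b)]; the product of these two is
    [rho (n^* n)] with [n = E (v^* b)], which bounds [|<b, v>|^2] up to a constant.
    So [b] is nearly orthogonal to all normalizers, and by regularity to [M],
    which forces [b] to be small ([B_sub_B1]). *)

Set Implicit Arguments.
Unset Strict Implicit.
Unset Printing Implicit Defensive.

Import Order.TTheory GRing.Theory Num.Theory numFieldNormedType.Exports.

Local Open Scope classical_set_scope.
Local Open Scope ring_scope.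

(** * Complex scalars and real quantities *)

Section ComplexScalars.
Context {R : realType}.
Local Notation C := (cplx R).
Implicit Types (z w : C) (r s : R).

(** Norms and positive forms take their values in the nonnegative reals of
    [C], whose order is only partial.  Estimates are made in [R] instead, by
    means of the embedding [rc] and the real part [re]. *)
Definition rc r : C := (r%:C)%C.
Definition re z : R := complex.Re z.
Definition cabs z : R := re `|z|.
Arguments rc : simpl never.
Arguments re : simpl never.
Arguments cabs : simpl never.

Lemma re_is_additive : additive re.
Proof. by move=> [a b] [c d]. Qed.
HB.instance Definition _ := GRing.isAdditive.Build C R re re_is_additive.

Lemma rc_is_additive : additive rc.
Proof. by move=> r s; rewrite /rc rmorphB. Qed.
Lemma rc_is_multiplicative : multiplicative rc.
Proof. by split; [move=> r s; rewrite /rc rmorphM | rewrite /rc rmorph1]. Qed.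
HB.instance Definition _ := GRing.isAdditive.Build R C rc rc_is_additive.
HB.instance Definition _ := GRing.isMultiplicative.Build R C rc rc_is_multiplicative.

Lemma re_rc r : re (rc r) = r. Proof. by []. Qed.
Lemma re_rcM r z : re (rc r * z) = r * re z.
Proof. by case: z => a b; rewrite /re /rc /= mul0r subr0. Qed.
Lemma re_conj z : re z^* = re z.
Proof. by case: z. Qed.
Lemma conj_rc r : (rc r)^* = rc r.
Proof. by rewrite /rc; apply/eqP; rewrite eq_complex /= oppr0 !eqxx. Qed.
Lemma rc_ge0 r : (0 <= rc r) = (0 <= r).
Proof. by rewrite /rc lecE /= eqxx. Qed.
Lemma ler_rc r s : (rc r <= rc s) = (r <= s).
Proof. by rewrite -subr_ge0 -rmorphB rc_ge0 subr_ge0. Qed.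
Lemma ltr_rc r s : (rc r < rc s) = (r < s).
Proof. by rewrite /rc ltcE /= eqxx. Qed.
Lemma ge0_rc z : 0 <= z -> z = rc (re z).
Proof. by case: z => a b; rewrite /rc lecE /= => /andP[/eqP->]. Qed.
Lemma re_ge0 z : 0 <= z -> 0 <= re z.
Proof. by case: z => a b; rewrite lecE /= => /andP[]. Qed.
Lemma normE z : `|z| = rc (cabs z).
Proof. exact: ge0_rc. Qed.
Lemma cabs_ge0 z : 0 <= cabs z.
Proof. exact: re_ge0. Qed.
Lemma cabsM z w : cabs (z * w) = cabs z * cabs w.
Proof. by rewrite {1}/cabs normrM !normE -rmorphM re_rc. Qed.
Lemma cabsD z w : cabs (z + w) <= cabs z + cabs w.
Proof. by rewrite -ler_rc rmorphD /= -!normE ler_normD. Qed.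
Lemma cabs0 : cabs 0 = 0. Proof. by rewrite /cabs normr0. Qed.
Lemma cabs_eq0 z : cabs z = 0 -> z = 0.
Proof. by move=> h; apply/eqP; rewrite -normr_eq0 normE h. Qed.
Lemma cabs_rc r : cabs (rc r) = `|r|.
Proof. by rewrite /cabs normc_def /re /= /re expr0n addr0 sqrtr_sqr. Qed.
Lemma cabsN z : cabs (- z) = cabs z.
Proof. by rewrite /cabs normrN. Qed.
Lemma cabsC z : cabs z^* = cabs z.
Proof. by rewrite /cabs norm_conjC. Qed.
Lemma cabs_re z : `|re z| <= cabs z.
Proof. by rewrite -ler_rc -normE; exact: normc_ge_Re. Qed.
Lemma re_le_cabs z : re z <= cabs z.
Proof. exact: le_trans (ler_norm _) (cabs_re _). Qed.
Lemma cabs_sq z : rc (cabs z ^+ 2) = z * z^*.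
Proof. by rewrite rmorphXn /= -normE normCK. Qed.
Lemma re_mulC z : re (z * z^*) = cabs z ^+ 2.
Proof. by rewrite -cabs_sq re_rc. Qed.

Lemma half_rc : (2^-1 : C) = rc 2^-1.
Proof. by rewrite fmorphV rmorph_nat. Qed.
Lemma cabs_half : cabs 2^-1 = 2^-1 :> R.
Proof. by rewrite half_rc cabs_rc ger0_norm // invr_ge0. Qed.

Definition ic : C := (0 +i* 1)%C.

Lemma ic2 : ic * ic = -1.
Proof.
by apply/eqP; rewrite eq_complex /= !(mul0r, mul1r, mulr0, add0r, addr0, sub0r, oppr0) !eqxx.
Qed.
Lemma conj_ic : ic^* = - ic.
Proof. by apply/eqP; rewrite eq_complex /= oppr0 !eqxx. Qed.
Lemma cabs_ic : cabs ic = 1.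
Proof. by rewrite /cabs normc_def /re /= expr0n expr1n add0r sqrtr1. Qed.
Lemma reim z : z = rc (re z) - ic * rc (re (ic * z)).
Proof.
apply/eqP; case: z => a b; rewrite eq_complex /= /re /=.
by rewrite !(mul0r, mul1r, mulr0, add0r, addr0, subr0, oppr0, opprK, sub0r) !eqxx.
Qed.

End ComplexScalars.

Arguments rc : simpl never.
Arguments re : simpl never.
Arguments cabs : simpl never.

(** * Semi-inner products and orthogonal projection *)

Section SemiInner.
Context {R : realType} {V : lmodType (cplx R)}.
Local Notation C := (cplx R).

(** The form is only meaningful on the subspace [L]: this covers with a single
    theory the Hilbert space, the square summable sequences inside all
    sequences, and an operator algebra with the form given by a positive
    functional. *)
Record semi_inner (L : set V) (ip : V -> V -> C) : Prop := SemiInner {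
  si_sub : subspace L ;
  si_lin : forall a x y z, L x -> L y -> L z ->
    ip (a *: x + y) z = a * ip x z + ip y z ;
  si_conj : forall x y, L x -> L y -> ip y x = (ip x y)^* ;
  si_ge0 : forall x, L x -> 0 <= ip x x
}.

Section SubspaceTheory.
Variable L : set V.
Hypothesis hL : subspace L.
Lemma sub0 : L 0. Proof. exact: hL.1. Qed.
Lemma subD x y : L x -> L y -> L (x + y).
Proof. by move=> hx hy; rewrite -[x]scale1r; apply: hL.2. Qed.
Lemma subZ a x : L x -> L (a *: x).
Proof. by move=> hx; rewrite -[a *: x]addr0; apply: hL.2 => //; apply: sub0. Qed.
Lemma subN x : L x -> L (- x).
Proof. by move=> hx; rewrite -scaleN1r; apply: subZ. Qed.
Lemma subB x y : L x -> L y -> L (x - y).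
Proof. by move=> hx hy; apply: subD => //; apply: subN. Qed.
Lemma sub_sum I (r : seq I) (P : pred I) (F : I -> V) :
  (forall i, P i -> L (F i)) -> L (\sum_(i <- r | P i) F i).
Proof. by move=> hF; elim/big_ind : _ => //; [apply: sub0 | apply: subD]. Qed.
End SubspaceTheory.

(** Over the complex numbers a sesquilinear form with nonnegative diagonal is
    automatically Hermitian: the values at [a *: x + y] with [a = 1] and
    [a = ic] being real, both [ip x y + ip y x] and [ic * (ip x y - ip y x)]
    are real. *)
Lemma semi_inner_of_positive (L : set V) (ip : V -> V -> C) : subspace L ->
  (forall a x y z, L x -> L y -> L z ->
    ip (a *: x + y) z = a * ip x z + ip y z) ->
  (forall a x y z, L x -> L y -> L z ->
    ip z (a *: x + y) = a^* * ip z x + ip z y) ->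
  (forall x, L x -> 0 <= ip x x) ->
  semi_inner L ip.
Proof.
move=> hL ipl ipr ip_ge0; split=> // x y hx hy.
have key (a : C) :
    a * ip x y + a^* * ip y x = rc (re (a * ip x y + a^* * ip y x)).
  have hxy : L (a *: x + y) by apply: hL.2.
  have := ge0_rc (ip_ge0 _ hxy); rewrite !ipl // !ipr //.
  rewrite (ge0_rc (ip_ge0 _ hx)) (ge0_rc (ip_ge0 _ hy)).
  set p := re (ip x x); set q := re (ip y y) => e.
  have -> : a * ip x y + a^* * ip y x =
    (a * (a^* * rc p + ip x y) + (a^* * ip y x + rc q)) - rc (cabs a ^+ 2 * p + q).
    by rewrite rmorphD rmorphM /= cabs_sq; ring.
  by rewrite e -rmorphB re_rc.
have k1 := key 1; have k2 := key ic.
rewrite rmorph1 !mul1r in k1; rewrite conj_ic in k2.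
move: (ip x y) (ip y x) k1 k2 => s t k1 k2.
have c1 : s + t = s^* + t^* by rewrite -rmorphD /= k1 conj_rc.
have c2 : ic * s - ic * t = - ic * s^* + ic * t^*.
  have e : (ic * s + - ic * t)^* = ic * s + - ic * t by rewrite k2 conj_rc.
  rewrite -mulNr -e rmorphD !rmorphM /= rmorphN /= conj_ic; ring.
have c3 : s - t = t^* - s^*.
  have ic0 : ic != 0 :> C.
    apply/eqP => i0; have := @ic2 R.
    by rewrite i0 mul0r => /eqP; rewrite eq_sym oppr_eq0 oner_eq0.
  by apply: (mulfI ic0); rewrite mulrBr c2; ring.
have two : (2 : C) != 0 by rewrite pnatr_eq0.
apply: (mulfI two).
have -> : 2 * t = (s + t) - (s - t) by ring.
by rewrite c1 c3; ring.
Qed.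

Section Theory.
Variables (L : set V) (ip : V -> V -> C).
Hypothesis h : semi_inner L ip.
Implicit Types x y z : V.

Definition nsq x : R := re (ip x x).
Definition nm x : R := Num.sqrt (nsq x).

Let hL := si_sub h.
Hint Resolve hL : core.

Lemma ipDl x y z : L x -> L y -> L z -> ip (x + y) z = ip x z + ip y z.
Proof. by move=> hx hy hz; rewrite -{1}[x]scale1r (si_lin h) // mul1r. Qed.
Lemma ip0l z : L z -> ip 0 z = 0.
Proof.
move=> hz; have L0 := sub0 hL; have := ipDl L0 L0 hz.
by rewrite addr0 => /eqP; rewrite -subr_eq0 opprD addNKr oppr_eq0 => /eqP.
Qed.
Lemma ipZl a x z : L x -> L z -> ip (a *: x) z = a * ip x z.
Proof.
move=> hx hz; rewrite -[a *: x]addr0 (si_lin h) // ?ip0l ?addr0 //; exact: sub0.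
Qed.
Lemma ipNl x z : L x -> L z -> ip (- x) z = - ip x z.
Proof. by move=> hx hz; rewrite -scaleN1r ipZl // mulN1r. Qed.
Lemma ipBl x y z : L x -> L y -> L z -> ip (x - y) z = ip x z - ip y z.
Proof. by move=> hx hy hz; rewrite ipDl // ?ipNl //; apply: subN. Qed.
Lemma ipDr x y z : L x -> L y -> L z -> ip z (x + y) = ip z x + ip z y.
Proof.
move=> hx hy hz; have hxy := subD hL hx hy.
by rewrite (si_conj h hxy) // ipDl // rmorphD /= -!(si_conj h).
Qed.
Lemma ipZr a x z : L x -> L z -> ip z (a *: x) = a^* * ip z x.
Proof.
move=> hx hz; have hax := subZ hL a hx.
by rewrite (si_conj h hax) // ipZl // rmorphM /= -!(si_conj h).
Qed.
Lemma ip0r z : L z -> ip z 0 = 0.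
Proof. by move=> hz; rewrite (si_conj h) ?ip0l ?rmorph0 //; apply: sub0. Qed.
Lemma ipNr x z : L x -> L z -> ip z (- x) = - ip z x.
Proof. by move=> hx hz; rewrite -scaleN1r ipZr // rmorphN1 mulN1r. Qed.
Lemma ipBr x y z : L x -> L y -> L z -> ip z (x - y) = ip z x - ip z y.
Proof. by move=> hx hy hz; rewrite ipDr // ?ipNr //; apply: subN. Qed.

Lemma nsq_ge0 x : L x -> 0 <= nsq x.
Proof. by move=> hx; apply: re_ge0; apply: (si_ge0 h). Qed.
Lemma ip_nsq x : L x -> ip x x = rc (nsq x).
Proof. by move=> hx; apply: ge0_rc; apply: (si_ge0 h). Qed.
Lemma nsqD x y : L x -> L y -> nsq (x + y) = nsq x + 2 * re (ip x y) + nsq y.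
Proof.
move=> hx hy; have hxy := subD hL hx hy.
rewrite /nsq ipDl // !ipDr // !raddfD /= [in ip y x](si_conj h hx hy) re_conj; lra.
Qed.
Lemma nsqZ a x : L x -> nsq (a *: x) = cabs a ^+ 2 * nsq x.
Proof.
move=> hx; have hax := subZ hL a hx.
by rewrite /nsq ipZl // ipZr // mulrA -cabs_sq re_rcM.
Qed.
Lemma nsqN x : L x -> nsq (- x) = nsq x.
Proof. by move=> hx; rewrite -scaleN1r nsqZ // cabsN (cabs_rc 1) normr1 expr1n mul1r. Qed.
Lemma nsqB x y : L x -> L y -> nsq (x - y) = nsq x - 2 * re (ip x y) + nsq y.
Proof.
move=> hx hy; rewrite nsqD //; last by apply: subN.
by rewrite nsqN // ipNr // raddfN /= mulrN.
Qed.
Lemma parallelogram x y : L x -> L y ->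
  nsq (x + y) + nsq (x - y) = 2 * nsq x + 2 * nsq y.
Proof. by move=> hx hy; rewrite nsqD // nsqB //; lra. Qed.
Lemma nsqD_le x y : L x -> L y -> nsq (x + y) <= 2 * nsq x + 2 * nsq y.
Proof.
move=> hx hy; rewrite -parallelogram // lerDl; apply: nsq_ge0; exact: subB.
Qed.

(** A vector [b] that nearly minimizes the distance to a subspace is nearly
    orthogonal to it.  With [d = 0] this is the Cauchy-Schwarz inequality; for
    minimizing sequences it gives orthogonal projections, and it replaces a
    projection where completeness is not available. *)
Lemma near_min (d e : R) b s : L b -> L s ->
  (forall c : C, d <= nsq (b - c *: s)) -> nsq b <= d + e ->
  cabs (ip b s) ^+ 2 <= e * nsq s.
Proof.
move=> hb hs hd he; set q := cabs _ ^+ 2.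
have q0 : 0 <= q by exact: sqr_ge0.
(* Test the hypothesis at the multiples [t * ip b s] with [t] real, which turn
   it into a quadratic inequality in [t]. *)
have key t : 2 * t * q <= e + t ^+ 2 * q * nsq s.
  have := hd (rc t * ip b s); rewrite nsqB //; last by apply: subZ.
  rewrite ipZr // nsqZ // rmorphM /= conj_rc -mulrA re_rcM.
  rewrite [_^* * _]mulrC re_mulC cabsM cabs_rc exprMn real_normK ?num_real // -/q.
  nra.
have s0 := nsq_ge0 hs.
have [s00|sN0] := eqVneq (nsq s) 0.
  rewrite s00 mulr0 leNgt; apply/negP => qgt0.
  have := key ((e + 1) / (2 * q)); rewrite s00 mulr0 addr0.
  have -> : 2 * ((e + 1) / (2 * q)) * q = e + 1 by field; rewrite gt_eqF.
  lra.
have sgt0 : 0 < nsq s by rewrite lt0r sN0.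
have := key (nsq s)^-1.
have -> : (nsq s)^-1 ^+ 2 * q * nsq s = q / nsq s by field.
rewrite -mulrA [_^-1 * q]mulrC => k1.
have : q / nsq s <= e by lra.
by rewrite ler_pdivrMr.
Qed.

Lemma cauchy_schwarz x y : L x -> L y ->
  cabs (ip x y) ^+ 2 <= nsq x * nsq y.
Proof.
move=> hx hy; apply: (@near_min 0) => //; last by rewrite add0r.
by move=> c; apply: nsq_ge0; apply: subB => //; apply: subZ.
Qed.

Lemma nm_ge0 x : 0 <= nm x. Proof. exact: sqrtr_ge0. Qed.
Lemma nm_sq x : L x -> nm x ^+ 2 = nsq x.
Proof. by move=> hx; rewrite sqr_sqrtr // nsq_ge0. Qed.
Lemma cauchy_schwarz_nm x y : L x -> L y -> cabs (ip x y) <= nm x * nm y.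
Proof.
move=> hx hy; rewrite -(@ler_pXn2r _ 2) ?nnegrE ?mulr_ge0 ?cabs_ge0 ?nm_ge0 //.
by rewrite exprMn !nm_sq // cauchy_schwarz.
Qed.
Lemma nmD x y : L x -> L y -> nm (x + y) <= nm x + nm y.
Proof.
move=> hx hy; have hxy := subD hL hx hy.
rewrite -(@ler_pXn2r _ 2) ?nnegrE ?addr_ge0 ?nm_ge0 //.
rewrite nm_sq // nsqD // sqrrD !nm_sq //.
have := cauchy_schwarz_nm hx hy; have := re_le_cabs (ip x y); lra.
Qed.
Lemma nmZ a x : L x -> nm (a *: x) = cabs a * nm x.
Proof.
by move=> hx; rewrite /nm nsqZ // sqrtrM ?sqr_ge0 // sqrtr_sqr ger0_norm // cabs_ge0.
Qed.
Lemma nmN x : L x -> nm (- x) = nm x.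
Proof. by move=> hx; rewrite /nm nsqN. Qed.
Lemma nm_lt x (e : R) : L x -> 0 < e -> nsq x < e ^+ 2 -> nm x < e.
Proof.
move=> hx e0 hxe; rewrite -(@ltr_pXn2r _ 2) ?nnegrE ?nm_ge0 ?(ltW e0) //.
by rewrite nm_sq.
Qed.

Definition si_complete := forall u : nat -> V, (forall n, L (u n)) ->
  (forall e : R, 0 < e -> exists N, forall m n, (N <= m)%N -> (N <= n)%N ->
     nsq (u m - u n) < e) ->
  exists2 l, L l & forall e : R, 0 < e -> exists N, forall n, (N <= n)%N ->
     nsq (u n - l) < e.

Lemma exists_invn_lt (e : R) : 0 < e -> exists N, forall n, (N <= n)%N -> n.+1%:R^-1 < e.
Proof.
move=> e0; exists (Num.truncn e^-1) => n hn.
rewrite invf_plt ?posrE ?ltr0n //.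
have := truncnS_gt e^-1; move=> /lt_le_trans; apply.
by rewrite ler_nat ltnS.
Qed.

Lemma ex_near_inf (S : set V) x : S !=set0 -> (forall s, S s -> L (x - s)) ->
  exists2 d : R, (forall s, S s -> d <= nsq (x - s)) &
    forall e : R, 0 < e -> exists2 s, S s & nsq (x - s) < d + e.
Proof.
move=> S0 hS; pose A := [set nsq (x - s) | s in S].
have A0 : A !=set0 by case: S0 => s hs; exists (nsq (x - s)); exists s.
have hlA : has_lbound A.
  by exists 0 => _ [s hs <-]; apply: nsq_ge0; apply: hS.
exists (inf A).
  by move=> s hs; apply: ge_inf => //; exists s.
move=> e e0; have : has_inf A by split.
move/(inf_adherent e0) => [_ [s hs <-] hlt].
by exists s.
Qed.

(** A minimizing sequence is Cauchy by the parallelogram identity, and its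
    limit is orthogonal to [S] by [near_min]. *)
Lemma projection_theorem (S : set V) x : si_complete ->
  subspace S -> S `<=` L -> L x ->
  exists p, [/\ L p, forall e : R, 0 < e -> exists2 s, S s & nsq (p - s) < e &
    forall s, S s -> ip (x - p) s = 0].
Proof.
move=> hc hS hSL hx.
have [||d hd1 hd2] := @ex_near_inf S x.
- by exists 0; apply: sub0 hS.
- by move=> s /hSL hs; apply: subB.
have hn (n : nat) : 0 < n.+1%:R^-1 :> R by rewrite invr_gt0 ltr0n.
have /choice [u hu] : forall n, exists s, S s /\ nsq (x - s) < d + n.+1%:R^-1.
  by move=> n; have [s hs1 hs2] := hd2 _ (hn n); exists s.
have uL n : L (u n) by apply/hSL/(hu n).1.
have hm m n : nsq (u m - u n) < 2 * (m.+1%:R^-1 + n.+1%:R^-1).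
  have xm : L (x - u m) by apply: subB.
  have xn : L (x - u n) by apply: subB.
  have := parallelogram xn xm.
  have -> : (x - u n) - (x - u m) = u m - u n by rewrite opprB [X in X = _]addrC addrA subrK.
  have -> : (x - u n) + (x - u m) = 2 *: (x - 2^-1 *: (u n + u m)).
    rewrite scalerBr scalerA mulfV ?pnatr_eq0 // scale1r scaler_nat mulr2n.
    by rewrite addrACA -opprD.
  have hmid : S (2^-1 *: (u n + u m)).
    by apply: subZ => //; apply: subD => //; case: (hu m); case: (hu n).
  have h4 := hd1 _ hmid.
  rewrite nsqZ; last by apply: subB => //; apply: hSL.
  have -> : cabs (2 : C) = 2 by have := cabs_rc (2 : R); rewrite rmorph_nat normr_nat.
  move: (hu m).2 (hu n).2; move=> q1 q2 q3.
  move: q1 q2 q3 h4; move: (m.+1%:R^-1 : R) (n.+1%:R^-1 : R) => a b q1 q2 q3 h4.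
  rewrite expr2 in q3. lra.
have hcau (e : R) : 0 < e -> exists N, forall m n, (N <= m)%N -> (N <= n)%N ->
     nsq (u m - u n) < e.
  move=> e0; have e4 : 0 < e / 4 by rewrite divr_gt0.
  have [N hN] := exists_invn_lt e4.
  exists N => m n /hN h1 /hN h2; apply: lt_trans (hm _ _) _.
  by move: h1 h2; move: (m.+1%:R^-1 : R) (n.+1%:R^-1 : R) => a b h1 h2; lra.
have [p Lp hp] := hc u uL hcau.
exists p; split => //.
  move=> e e0; have [N hN] := hp e e0; exists (u N); first exact: (hu N).1.
  by rewrite -nsqN ?opprB; [apply: hN|apply: subB].
move=> s hs; have Ls := hSL _ hs; apply: cabs_eq0; apply/eqP.
rewrite eq_le cabs_ge0 andbT; apply/ler_addgt0Pr => e e0; rewrite add0r.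
pose M := nm s + 1.
have M0 : 0 < M by rewrite ltr_wpDl ?nm_ge0.
have e2 : 0 < e / (2 * M) by rewrite divr_gt0 // mulr_gt0.
have [N1 hN1] := exists_invn_lt (exprn_gt0 2 e2).
have [N2 hN2] := hp _ (exprn_gt0 2 e2).
pose n := maxn N1 N2.
have xu : L (x - u n) by apply: subB.
have up : L (u n - p) by apply: subB.
have -> : x - p = (x - u n) + (u n - p) by rewrite addrA subrK.
rewrite ipDl //; apply: le_trans (cabsD _ _) _.
have h1 : cabs (ip (x - u n) s) <= e / (2 * M) * nm s.
  rewrite -(@ler_pXn2r _ 2) ?nnegrE ?cabs_ge0 //; last first.
    by apply: mulr_ge0; [exact: ltW | exact: nm_ge0].
  rewrite exprMn nm_sq //.
  have h0 : n.+1%:R^-1 * nsq s <= (e / (2 * M)) ^+ 2 * nsq s.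
    apply: ler_wpM2r; first exact: nsq_ge0.
    by apply/ltW/hN1; rewrite leq_maxl.
  apply: le_trans h0; apply: (@near_min d) => //.
    move=> c; rewrite -addrA -opprD; apply: hd1.
    by apply: subD => //; [exact: (hu n).1 | apply: subZ].
  exact/ltW/(hu n).2.
have h2 : cabs (ip (u n - p) s) <= e / (2 * M) * nm s.
  apply: le_trans (cauchy_schwarz_nm _ _) _ => //.
  apply: ler_wpM2r; first exact: nm_ge0.
  by apply/ltW/nm_lt => //; apply: hN2; rewrite leq_maxr.
apply: le_trans (lerD h1 h2) _.
have -> : e / (2 * M) * nm s + e / (2 * M) * nm s = e * (nm s / M) by field; lra.
rewrite -[leRHS]mulr1 ler_wpM2l ?(ltW e0) // ler_pdivrMr // mul1r /M; lra.
Qed.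

End Theory.
End SemiInner.

(** * Hilbert space basics *)

Section HilbertBasics.
Context {R : realType} {H : hilbertType R}.
Local Notation C := (cplx R).
Implicit Types (a b h k : H).

Lemma inner_semi : semi_inner [set: H] (@inner R H).
Proof.
split.
- by split.
- by move=> a x y z _ _ _; rewrite linearPl.
- by move=> x y _ _; rewrite hermC expr0 mul1r.
- by move=> x _; rewrite inner_norm exprn_ge0.
Qed.

Definition nh h : R := nm inner h.

Lemma nhE h : `|h| = rc (nh h).
Proof.
have hh : 0 <= `|h| by exact: normr_ge0.
have -> : nh h = re `|h|.
  rewrite /nh /nm /nsq inner_norm (ge0_rc hh) -rmorphXn /= !re_rc sqrtr_sqr.
  by rewrite ger0_norm // re_ge0.
exact: ge0_rc.
Qed.

Lemma nh_ge0 h : 0 <= nh h. Proof. exact: nm_ge0. Qed.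
Lemma nh_sq h : nh h ^+ 2 = nsq inner h. Proof. by apply: (nm_sq inner_semi). Qed.
Lemma nhD h k : nh (h + k) <= nh h + nh k. Proof. by apply: (nmD inner_semi). Qed.
Lemma nhZ (c : C) h : nh (c *: h) = cabs c * nh h. Proof. by apply: (nmZ inner_semi). Qed.
Lemma nhN h : nh (- h) = nh h. Proof. by apply: (nmN inner_semi). Qed.
Lemma nh0 : nh 0 = 0.
Proof. by rewrite -[0](scale0r (0 : H)) nhZ cabs0 mul0r. Qed.
Lemma nh_eq0 h : nh h = 0 -> h = 0.
Proof. by move=> e; apply/eqP; rewrite -normr_eq0 nhE e. Qed.
Lemma inner_le h k : cabs (inner h k) <= nh h * nh k.
Proof. by apply: (cauchy_schwarz_nm inner_semi). Qed.
Lemma innerDl h k a : inner (h + k) a = inner h a + inner k a.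
Proof. by apply: (ipDl inner_semi). Qed.
Lemma innerBl h k a : inner (h - k) a = inner h a - inner k a.
Proof. by apply: (ipBl inner_semi). Qed.
Lemma innerZl c h a : inner (c *: h) a = c * inner h a.
Proof. by apply: (ipZl inner_semi). Qed.
Lemma innerDr h k a : inner a (h + k) = inner a h + inner a k.
Proof. by apply: (ipDr inner_semi). Qed.
Lemma innerBr h k a : inner a (h - k) = inner a h - inner a k.
Proof. by apply: (ipBr inner_semi). Qed.
Lemma innerZr c h a : inner a (c *: h) = c^* * inner a h.
Proof. by apply: (ipZr inner_semi). Qed.
Lemma innerC h k : inner k h = (inner h k)^*.
Proof. by apply: (si_conj inner_semi). Qed.
Lemma inner_inj h k : (forall a, inner a h = inner a k) -> h = k.
Proof.
move=> e; apply/eqP; rewrite -subr_eq0; apply/eqP/nh_eq0/eqP.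
rewrite -sqrf_eq0 nh_sq /nsq innerBr e subrr; exact/eqP.
Qed.
Lemma inner_injl h k : (forall a, inner h a = inner k a) -> h = k.
Proof. by move=> e; apply: inner_inj => a; rewrite innerC e -innerC. Qed.

Lemma nh_lim_uniq (u : nat -> H) l l' :
  (forall e : R, 0 < e -> exists N, forall n, (N <= n)%N -> nh (u n - l) < e) ->
  (forall e : R, 0 < e -> exists N, forall n, (N <= n)%N -> nh (u n - l') < e) ->
  l = l'.
Proof.
move=> h1 h2; apply/eqP; rewrite -subr_eq0; apply/eqP/nh_eq0/eqP.
rewrite eq_le nh_ge0 andbT; apply/ler_addgt0Pr => e e0; rewrite add0r.
have e2 : 0 < e / 2 by rewrite divr_gt0.
have [N1 hN1] := h1 _ e2; have [N2 hN2] := h2 _ e2.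
pose n := maxn N1 N2.
have a1 := hN1 n (leq_maxl _ _); have a2 := hN2 n (leq_maxr _ _).
have -> : l - l' = (u n - l') - (u n - l) by rewrite opprB [RHS]addrC addrA subrK.
apply: le_trans (nhD _ _) _; rewrite nhN; lra.
Qed.

Lemma hilbert_complete (u : nat -> H) :
  (forall e : R, 0 < e -> exists N, forall m n, (N <= m)%N -> (N <= n)%N ->
     nh (u m - u n) < e) ->
  exists l, forall e : R, 0 < e -> exists N, forall n, (N <= n)%N -> nh (u n - l) < e.
Proof.
move=> hu.
have /cauchy_cvgP/cvg_ex [l hl] : cauchy (u @ \oo).
  apply: cauchy_exP => e e0.
  have er : e = rc (re e) by apply: ge0_rc; exact: ltW.
  have re0 : 0 < re e by rewrite -ltr_rc -er.
  have [N hN] := hu _ re0.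
  exists (u N); exists N => // n /= hn.
  by rewrite -ball_normE /= nhE er ltr_rc; apply: hN.
exists l => e e0.
move/cvgrPdist_lt : hl => /(_ (rc e)); rewrite ltr_rc => /(_ e0) [N _ hN].
exists N => n hn; have := hN n hn; by rewrite /= nhE ltr_rc -nhN opprB.
Qed.

Lemma inner_complete : si_complete [set: H] (@inner R H).
Proof.
move=> u _ hu.
have [|l hl] := @hilbert_complete u.
  move=> e e0; have [N hN] := hu _ (exprn_gt0 2 e0); exists N => m n hm hn.
  by apply: (nm_lt inner_semi) => //; apply: hN.
exists l => // e e0; have s0 : 0 < Num.sqrt e by rewrite sqrtr_gt0.
have [N hN] := hl _ s0; exists N => n hn.
have := hN n hn; rewrite -nh_sq => hlt.
by rewrite -[ltRHS]sqr_sqrtr ?(ltW e0) // ltr_pXn2r // nnegrE ?nh_ge0 ?sqrtr_ge0.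
Qed.

Definition op_bound (T : H -> H) (c : R) := 0 <= c /\ forall h, nh (T h) <= c * nh h.

Lemma bounded_opP (T : H -> H) :
  bounded_op T <-> linear T /\ exists c, op_bound T c.
Proof.
split=> [[lT cT]|[lT [c [c0 hc]]]]; split => //.
  pose f := HB.pack_for {linear H -> H} T (GRing.isLinear.Build C H H *:%R T lT).
  have /linear_bounded_continuous/linear_boundedP : continuous f by [].
  move=> [M [Mr hM]]; pose c := `|re M| + 1.
  exists c; split; first by rewrite addr_ge0.
  move=> h; have Mc : M < rc c.
    have -> : M = rc (re M) by rewrite /rc /re [RHS](RRe_real Mr).
    by rewrite ltr_rc /c; have := ler_norm (re M); lra.
  by have := hM _ Mc h; rewrite /= !nhE -rmorphM /= ler_rc.
pose f := HB.pack_for {linear H -> H} T (GRing.isLinear.Build C H H *:%R T lT).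
suff : continuous f by [].
apply/linear_bounded_continuous/linear_boundedP.
exists (rc c); split; first by rewrite realE rc_ge0 c0.
move=> r hr h; rewrite /= !nhE; have r0 : 0 <= r.
  by apply: ltW; apply: le_lt_trans hr; rewrite rc_ge0.
move: hr; rewrite (ge0_rc r0) ltr_rc -rmorphM /= ler_rc => hr.
by apply: le_trans (hc h) _; rewrite ler_wpM2r ?nh_ge0 // ltW.
Qed.

End HilbertBasics.

(** * Bounded operators and adjoints *)

Section Adjoints.
Context {R : realType} {H : hilbertType R}.
Local Notation C := (cplx R).
Local Notation op := (H -> H).
Implicit Types (h k l : H) (x y T S : op).

Lemma riesz (f : H -> C) (c : R) :
  (forall a h k, f (a *: h + k) = a * f h + f k) ->
  (forall h, cabs (f h) <= c * nh h) ->
  exists k, forall h, f h = inner h k.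
Proof.
move=> lf bf.
have f0 : f 0 = 0.
  by apply: cabs_eq0; apply/eqP; rewrite eq_le cabs_ge0 andbT; have := bf 0; rewrite nh0 mulr0.
have fD h k : f (h + k) = f h + f k by rewrite -{1}[h]scale1r lf mul1r.
have fZ a h : f (a *: h) = a * f h by rewrite -[a *: h]addr0 lf f0 addr0.
have fB h k : f (h - k) = f h - f k by rewrite fD -scaleN1r fZ mulN1r.
have [fz|/existsNP [x fx]] := pselect (forall h, f h = 0).
  by exists 0 => h; rewrite fz (ip0r inner_semi).
pose S : set H := [set h | f h = 0].
have hS : subspace S.
  by split=> // a h k hh hk; rewrite /S /= lf hh hk mulr0 addr0.
have [p [_ hp1 hp2]] := projection_theorem inner_semi inner_complete hS
  (fun _ _ => I) (I : [set: H] x).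
have fp : f p = 0.
  apply: cabs_eq0; apply/eqP; rewrite eq_le cabs_ge0 andbT.
  apply/ler_addgt0Pr => e e0; rewrite add0r.
  have c0 : 0 < `|c| + 1 by rewrite ltr_wpDl.
  have d0 : 0 < e / (`|c| + 1) by rewrite divr_gt0.
  have [s fs hs] := hp1 _ (exprn_gt0 2 d0).
  have -> : f p = f (p - s) by rewrite fB fs subr0.
  apply: le_trans (bf _) _.
  have := nm_lt inner_semi (I : [set: H] (p - s)) d0 hs; rewrite -/(nh _) => hlt.
  have := ler_norm c; have := nh_ge0 (p - s) => n0 cc.
  apply: (@le_trans _ _ ((`|c| + 1) * nh (p - s))); first by nra.
  by rewrite mulrC -ler_pdivlMr // ltW.
pose y := x - p.
have fy : f y = f x by rewrite fB fp subr0.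
have y0 : inner y y != 0.
  apply/eqP => yy; apply: fx; rewrite -fy; suff -> : y = 0 by rewrite f0.
  apply: nh_eq0; apply/eqP; rewrite -sqrf_eq0 nh_sq /nsq yy; exact/eqP.
exists (((f y)^* / (inner y y)) *: y) => h.
have fy0 : f y != 0 by rewrite fy; apply/eqP.
have : inner y (h - (f h / f y) *: y) = 0.
  by apply: hp2; rewrite /S /= fB fZ divfK // subrr.
rewrite innerBr innerZr => /eqP; rewrite subr_eq0 => /eqP e.
rewrite innerZr [inner h y]innerC e !rmorphM /= !conjCK.
have N0 : (inner y y)^* != 0 by rewrite conjC_eq0.
by rewrite fmorphV; field; rewrite N0 fy0.
Qed.

(** Bounded sesquilinear forms are operators.  This yields the existence of
    adjoints, and later of limits of operators along an ultrafilter. *)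
Lemma bounded_form_op (B : H -> H -> C) (c : R) : 0 <= c ->
  (forall a h k l, B (a *: h + k) l = a * B h l + B k l) ->
  (forall a h k l, B l (a *: h + k) = a^* * B l h + B l k) ->
  (forall h k, cabs (B h k) <= c * nh h * nh k) ->
  exists Z : op, [/\ linear Z, op_bound Z c & forall h k, inner (Z h) k = B h k].
Proof.
move=> c0 hl hr hb.
have /choice [Z hZ] : forall h, exists z, forall k, inner z k = B h k.
  move=> h; have [||z hz] := @riesz (fun k => (B h k)^*) (c * nh h).
  - by move=> a k l; rewrite hr rmorphD rmorphM /= conjCK.
  - by move=> k; rewrite cabsC.
  by exists z => k; rewrite innerC -hz conjCK.
exists Z; split => //.
- by move=> a h k; apply: inner_injl => l; rewrite innerDl innerZl !hZ hl.
- split=> // h; have [z0|zN] := eqVneq (nh (Z h)) 0.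
    by rewrite z0 mulr_ge0 ?nh_ge0.
  have zp : 0 < nh (Z h) by rewrite lt0r zN nh_ge0.
  rewrite -(ler_pM2r zp) -expr2 nh_sq; apply: le_trans (hb _ _).
  by rewrite -hZ re_le_cabs.
Qed.

Lemma bnd_lin T : bounded_op T -> linear T. Proof. by case/bounded_opP. Qed.
Lemma opL T (a : C) h k : bounded_op T -> T (a *: h + k) = a *: T h + T k.
Proof. by move/bnd_lin => l; apply: l. Qed.
Lemma bnd_bound T : bounded_op T -> exists c, op_bound T c.
Proof. by case/bounded_opP. Qed.
Lemma opD T h k : bounded_op T -> T (h + k) = T h + T k.
Proof. by move/bnd_lin => l; rewrite -{1}[h]scale1r l scale1r. Qed.
Lemma op0 T : bounded_op T -> T 0 = 0.
Proof.
move=> hT; have := opD 0 0 hT.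
by rewrite addr0 => /eqP; rewrite -subr_eq0 opprD addNKr oppr_eq0 => /eqP.
Qed.
Lemma opZ T c h : bounded_op T -> T (c *: h) = c *: T h.
Proof. by move=> hT; rewrite -[c *: h]addr0 (bnd_lin hT) op0 // addr0. Qed.
Lemma opN T h : bounded_op T -> T (- h) = - T h.
Proof. by move=> hT; rewrite -scaleN1r opZ // scaleN1r. Qed.
Lemma opB T h k : bounded_op T -> T (h - k) = T h - T k.
Proof. by move=> hT; rewrite opD // opN. Qed.

Lemma fctL (I : Type) (a : C) (x y : I -> H) i : (a *: x + y) i = a *: x i + y i.
Proof. by []. Qed.

Lemma op_bound_lin x y a c d : op_bound x c -> op_bound y d ->
  op_bound (a *: x + y) (cabs a * c + d).
Proof.
move=> [c0 hc] [d0 hd]; split; first by rewrite addr_ge0 ?mulr_ge0 ?cabs_ge0.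
move=> h; rewrite fctL mulrDl; apply: le_trans (nhD _ _) _; rewrite nhZ -mulrA.
by apply: lerD; [apply: ler_wpM2l; [exact: cabs_ge0|] |].
Qed.
Lemma op_boundZ x a c : op_bound x c -> op_bound (a *: x) (cabs a * c).
Proof.
move=> [c0 hc]; split; first by rewrite mulr_ge0 ?cabs_ge0.
by move=> h; rewrite nhZ -mulrA; apply: ler_wpM2l; [exact: cabs_ge0|].
Qed.
Lemma op_boundD x y c d : op_bound x c -> op_bound y d -> op_bound (x + y) (c + d).
Proof.
move=> [c0 hc] [d0 hd]; split; first exact: addr_ge0.
by move=> h; rewrite mulrDl; apply: le_trans (nhD _ _) _; apply: lerD.
Qed.
Lemma op_boundN x c : op_bound x c -> op_bound (- x) c.
Proof. by move=> [c0 hc]; split=> // h; rewrite nhN. Qed.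
Lemma op_bound_comp x y c d : op_bound x c -> op_bound y d ->
  op_bound (x \o y) (c * d).
Proof.
move=> [c0 hc] [d0 hd]; split; first by rewrite mulr_ge0.
by move=> h; rewrite /= -mulrA; apply: le_trans (hc _) _; apply: ler_wpM2l.
Qed.

Lemma bnd_id : bounded_op (idfun : op).
Proof. by apply/bounded_opP; split=> //; exists 1; split=> // h; rewrite mul1r. Qed.
Lemma bnd_comp x y : bounded_op x -> bounded_op y -> bounded_op (x \o y).
Proof.
move=> hx hy; apply/bounded_opP; split.
  by move=> a h k; rewrite /= (opL _ _ _ hy); apply: opL.
have [c hc] := bnd_bound hx; have [d hd] := bnd_bound hy.
by exists (c * d); apply: op_bound_comp.
Qed.
Lemma bnd_subspace : subspace (@bounded_op R H).
Proof.
split.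
  apply/bounded_opP; split.
    by move=> a h k; rewrite /= scaler0 addr0.
  by exists 0; split=> // h; rewrite /= nh0 mul0r.
move=> a x y hx hy; apply/bounded_opP; split.
  move=> b h k; rewrite !fctL.
  rewrite (opL b h k hx) (opL b h k hy).
  by rewrite !scalerDr !scalerA mulrC addrACA.
have [c hc] := bnd_bound hx; have [d hd] := bnd_bound hy.
by exists (cabs a * c + d); apply: op_bound_lin.
Qed.

Lemma adjointP T a b : bounded_op T -> inner (adjoint T a) b = inner a (T b).
Proof.
move=> hT; have [c [c0 hc]] := bnd_bound hT.
have : exists S : op, forall a b, inner (S a) b = inner a (T b).
  have [||||Z [_ _ hZ]] := @bounded_form_op (fun a b => inner a (T b)) c.
  - by [].
  - by move=> s h k l; rewrite innerDl innerZl.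
  - by move=> s h k l; rewrite (opL _ _ _ hT) innerDr innerZr.
  - move=> h k; apply: le_trans (inner_le _ _) _.
    rewrite [c * _]mulrC -mulrA; apply: ler_wpM2l => //; exact: nh_ge0.
  by exists Z.
by move/getPex; apply.
Qed.
Lemma adjointPr T a b : bounded_op T -> inner a (adjoint T b) = inner (T a) b.
Proof. by move=> hT; rewrite innerC adjointP // -innerC. Qed.
Lemma adjoint_eq S T : bounded_op T ->
  (forall a b, inner (S a) b = inner a (T b)) -> adjoint T = S.
Proof.
by move=> hT hS; apply/funext => a; apply: inner_injl => b; rewrite adjointP.
Qed.
Lemma op_bound_adj T c : bounded_op T -> op_bound T c -> op_bound (adjoint T) c.
Proof.
move=> hT [c0 hc]; split=> // h; have [z0|zN] := eqVneq (nh (adjoint T h)) 0.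
  by rewrite z0 mulr_ge0 ?nh_ge0.
have zp : 0 < nh (adjoint T h) by rewrite lt0r zN nh_ge0.
rewrite -(ler_pM2r zp) -expr2 nh_sq /nsq adjointP //.
apply: le_trans (re_le_cabs _) _; apply: le_trans (inner_le _ _) _.
rewrite [c * _]mulrC -mulrA; apply: ler_wpM2l => //; exact: nh_ge0.
Qed.
Lemma bnd_adj T : bounded_op T -> bounded_op (adjoint T).
Proof.
move=> hT; apply/bounded_opP; split.
  move=> a h k; apply: inner_injl => l.
  by rewrite innerDl innerZl !adjointP // innerDl innerZl.
by have [c hc] := bnd_bound hT; exists c; apply: op_bound_adj.
Qed.
Lemma adjK T : bounded_op T -> adjoint (adjoint T) = T.
Proof.
move=> hT; apply: adjoint_eq; first exact: bnd_adj.
by move=> a b; rewrite adjointPr.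
Qed.
Lemma adj_comp x y : bounded_op x -> bounded_op y ->
  adjoint (x \o y) = adjoint y \o adjoint x.
Proof.
move=> hx hy; apply: adjoint_eq; first exact: bnd_comp.
by move=> a b; rewrite /= !adjointP.
Qed.
Lemma adj_lin a x y : bounded_op x -> bounded_op y ->
  adjoint (a *: x + y) = a^* *: adjoint x + adjoint y.
Proof.
move=> hx hy; apply: adjoint_eq; first exact: bnd_subspace.2.
by move=> h k; rewrite !fctL innerDl innerZl innerDr innerZr !adjointP.
Qed.
Lemma adjD x y : bounded_op x -> bounded_op y ->
  adjoint (x + y) = adjoint x + adjoint y.
Proof. by move=> hx hy; rewrite -{1}[x]scale1r adj_lin // rmorph1 scale1r. Qed.
Lemma adj_id : adjoint idfun = idfun :> op.
Proof. by apply: adjoint_eq => //; apply: bnd_id. Qed.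
Lemma adjZ a x : bounded_op x -> adjoint (a *: x) = a^* *: adjoint x.
Proof.
move=> hx; apply: adjoint_eq; first by apply: subZ => //; apply: bnd_subspace.
by move=> h k; rewrite [LHS]innerZl innerZr adjointP.
Qed.
Lemma adjN x : bounded_op x -> adjoint (- x) = - adjoint x.
Proof. by move=> hx; rewrite -scaleN1r adjZ // rmorphN1 scaleN1r. Qed.
Lemma adjB x y : bounded_op x -> bounded_op y ->
  adjoint (x - y) = adjoint x - adjoint y.
Proof.
by move=> hx hy; rewrite adjD ?adjN //; apply: subN => //; apply: bnd_subspace.
Qed.

Lemma comp_linr a x y z : bounded_op z ->
  z \o (a *: x + y) = a *: (z \o x) + (z \o y).
Proof. by move=> hz; apply/funext => h; exact: (opL _ _ _ hz). Qed.
Lemma comp_linl (a : C) x y z : (a *: x + y) \o z = (a *: (x \o z) : op) + (y \o z).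
Proof. by []. Qed.
Lemma compDr x y z : bounded_op z -> z \o (x + y) = (z \o x) + (z \o y).
Proof. by move=> hz; apply/funext => h; exact: opD. Qed.
Lemma compBr x y z : bounded_op z -> z \o (x - y) = (z \o x) - (z \o y).
Proof. by move=> hz; apply/funext => h; exact: opB. Qed.
Lemma compZr a x z : bounded_op z -> z \o (a *: x) = a *: (z \o x).
Proof. by move=> hz; apply/funext => h; exact: opZ. Qed.
Lemma comp0r x : bounded_op x -> x \o (0 : op) = 0.
Proof. by move=> hx; apply/funext => h; exact: op0. Qed.

End Adjoints.

(** * Square summable sequences of vectors *)

Section ComplexSeries.
Context {R : realType}.
Local Notation C := (cplx R).

Lemma cvgC_P (u : nat -> C) (l : C) : u @ \oo --> l <->
  forall e : R, 0 < e -> exists N, forall n, (N <= n)%N -> cabs (u n - l) < e.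
Proof.
split=> [/cvgrPdist_lt hu e e0|hu].
  have := hu (rc e); rewrite ltr_rc => /(_ e0) [N _ hN].
  by exists N => n hn; have := hN n hn; rewrite /= normE ltr_rc -cabsN opprB.
apply/cvgrPdist_lt => e e0.
have er : e = rc (re e) by apply: ge0_rc; exact: ltW.
have re0 : 0 < re e by rewrite -ltr_rc -er.
have [N hN] := hu _ re0; exists N => // n /= hn.
by rewrite er normE ltr_rc -cabsN opprB; apply: hN.
Qed.

Lemma cvg_rc (u : nat -> R) l : u @ \oo --> l -> (rc \o u) @ \oo --> rc l.
Proof.
move=> /cvgrPdist_lt hu; apply/cvgC_P => e e0; have [N _ hN] := hu e e0.
by exists N => n hn; have := hN n hn; rewrite /= -rmorphB cabs_rc distrC.
Qed.

Lemma cvg_re (u : nat -> C) l : u @ \oo --> l -> (re \o u) @ \oo --> re l.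
Proof.
move=> /cvgC_P hu; apply/cvgrPdist_lt => e e0; have [N hN] := hu e e0.
exists N => // n hn; apply: le_lt_trans (hN n hn).
by rewrite /= distrC -raddfB cabs_re.
Qed.

Lemma cvg_conj (u : nat -> C) (l : C) : u @ \oo --> l -> (fun n => (u n)^*) @ \oo --> l^*.
Proof.
move=> /cvgC_P hu; apply/cvgC_P => e e0; have [N hN] := hu e e0.
by exists N => n hn; rewrite -rmorphB cabsC; apply: hN.
Qed.

Lemma abs_series_cvg (u : nat -> C) (K : R) :
  (forall n, \sum_(i < n) cabs (u i) <= K) -> cvgn (series u).
Proof.
move=> hK.
have real_cvg (v : nat -> R) : (forall i, `|v i| <= cabs (u i)) -> cvgn (series v).
  move=> hv; apply: normed_cvg; apply: nondecreasing_is_cvgn.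
    by apply: nondecreasing_series => i _ _; exact: normr_ge0.
  exists K => _ [n _ <-]; apply: le_trans (hK n).
  by rewrite /= /series /= big_mkord; apply: ler_sum.
have /cvg_ex [a ha] := real_cvg (re \o u) (fun i => cabs_re (u i)).
have /cvg_ex [b hb] : cvgn (series (fun i => re (ic * u i))).
  by apply: real_cvg => i; apply: le_trans (cabs_re _) _; rewrite cabsM cabs_ic mul1r.
apply/cvg_ex; exists (rc a - ic * rc b).
have -> : series u = (rc \o series (re \o u)) -
    (fun n => ic * (rc \o series (fun i => re (ic * u i))) n).
  apply/funext => n.
  transitivity (rc (series (re \o u) n) - ic * rc (series (fun i => re (ic * u i)) n)) => //.
  rewrite /series /= !rmorph_sum mulr_sumr -sumrB.
  by apply: eq_bigr => i _; exact: reim.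
apply: cvgB; first exact: cvg_rc.
by apply: cvgMr; apply: cvg_rc.
Qed.

End ComplexSeries.

Section EllTwo.
Context {R : realType} {H : hilbertType R}.
Local Notation C := (cplx R).
Implicit Types (f g : nat -> H).

Definition L2 : set (nat -> H) :=
  [set f : nat -> H | exists K : R, forall n, \sum_(i < n) nh (f i) ^+ 2 <= K].

Definition ip2 f g : C := limn (series (fun n => inner (f n) (g n))).

Lemma nh_sqD (h k : H) : nh (h + k) ^+ 2 <= 2 * nh h ^+ 2 + 2 * nh k ^+ 2.
Proof. by rewrite !nh_sq; apply: (nsqD_le inner_semi). Qed.

Lemma L2_subspace : subspace L2.
Proof.
split.
  by exists 0 => n; rewrite big1 // => i _; rewrite nh0 expr0n.
move=> a f g [K hK] [K' hK']; exists (2 * cabs a ^+ 2 * K + 2 * K') => n.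
have : \sum_(i < n) (2 * cabs a ^+ 2 * nh (f i) ^+ 2 + 2 * nh (g i) ^+ 2) <=
   2 * cabs a ^+ 2 * K + 2 * K'.
  rewrite big_split /= -!mulr_sumr; apply: lerD; apply: ler_wpM2l => //.
      by rewrite mulr_ge0 // sqr_ge0.
    exact: hK.
  exact: hK'.
move=> hs; apply: le_trans hs; apply: ler_sum => i _; rewrite fctL -mulrA -exprMn -nhZ.
exact: nh_sqD.
Qed.

Lemma L2_op (T : H -> H) (c : R) f : op_bound T c -> L2 f -> L2 (T \o f).
Proof.
move=> [c0 hc] [K hK]; exists (c ^+ 2 * K) => n.
apply: le_trans (_ : c ^+ 2 * \sum_(i < n) nh (f i) ^+ 2 <= _).
  rewrite mulr_sumr; apply: ler_sum => i _; rewrite -exprMn.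
  by rewrite ler_pXn2r ?nnegrE ?nh_ge0 ?mulr_ge0 ?nh_ge0 ?c0 ?hc.
by apply: ler_wpM2l => //; exact: sqr_ge0.
Qed.

Lemma ip2_cvg f g : L2 f -> L2 g ->
  series (fun n => inner (f n) (g n)) @ \oo --> ip2 f g.
Proof.
move=> [K hK] [K' hK']; apply: (@abs_series_cvg _ _ (K + K')) => n.
apply: le_trans (lerD (hK n) (hK' n)); rewrite -big_split /=.
apply: ler_sum => i _; apply: le_trans (inner_le _ _) _.
have := nh_ge0 (f i); have := nh_ge0 (g i); nra.
Qed.

Lemma ip2_eq f g z :
  series (fun n => inner (f n) (g n)) @ \oo --> (z : C) -> ip2 f g = z.
Proof. by move=> hz; apply: cvg_lim hz. Qed.

Lemma ip2_semi : semi_inner L2 ip2.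
Proof.
split; first exact: L2_subspace.
- move=> a x y z hx hy hz; apply: ip2_eq.
  have -> : series (fun n => inner ((a *: x + y) n) (z n)) =
    (fun n => a * series (fun n => inner (x n) (z n)) n) +
    series (fun n => inner (y n) (z n)).
    apply/funext => n.
    transitivity (a * series (fun n => inner (x n) (z n)) n +
      series (fun n => inner (y n) (z n)) n) => //.
    rewrite /series /= mulr_sumr -big_split /=.
    by apply: eq_bigr => i _; rewrite fctL innerDl innerZl.
  by apply: cvgD; [apply: cvgMr; apply: ip2_cvg | apply: ip2_cvg].
- move=> x y hx hy; apply: ip2_eq.
  have -> : series (fun n => inner (y n) (x n)) =
     (fun n => (series (fun n => inner (x n) (y n)) n)^*).
    apply/funext => n; rewrite /series /= rmorph_sum.
    by apply: eq_bigr => i _; rewrite innerC.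
  by apply: cvg_conj; apply: ip2_cvg.
- move=> x hx; have h := cvg_re (ip2_cvg hx hx).
  have e : series (fun n => inner (x n) (x n)) =
     rc \o (re \o series (fun n => inner (x n) (x n))).
    apply/funext => n; rewrite /= -ge0_rc // /series /= sumr_ge0 // => i _.
  have := cvg_rc h; rewrite -e => /ip2_eq ->; rewrite rc_ge0.
  apply: cvgr_to_ge h _; near=> n.
  rewrite /= /series /= re_ge0 // sumr_ge0 // => i _; exact: (si_ge0 inner_semi).
Unshelve. all: end_near. Qed.

Lemma nsq2_cvg f : L2 f ->
  (fun n => \sum_(i < n) nh (f i) ^+ 2) @ \oo --> nsq ip2 f.
Proof.
move=> hf; have := cvg_re (ip2_cvg hf hf).
rewrite (_ : re \o _ = (fun n => \sum_(i < n) nh (f i) ^+ 2)) //.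
apply/funext => n; rewrite /= /series /= raddf_sum big_mkord.
by apply: eq_bigr => i _; rewrite nh_sq.
Qed.

Lemma nsq2_le f (K : R) : (forall n, \sum_(i < n) nh (f i) ^+ 2 <= K) ->
  nsq ip2 f <= K.
Proof.
move=> hK; have hf : L2 f by exists K.
by apply: cvgr_to_le (nsq2_cvg hf) _; near=> n; apply: hK.
Unshelve. all: end_near. Qed.

Lemma nsq2_ge f n : L2 f -> \sum_(i < n) nh (f i) ^+ 2 <= nsq ip2 f.
Proof.
move=> hf; apply: cvgr_to_ge (nsq2_cvg hf) _; near=> m.
have hnm : (n <= m)%N by near: m; exact: nbhs_infty_ge.
rewrite -(subnKC hnm) big_split_ord /= lerDl.
by apply: sumr_ge0 => i _; exact: sqr_ge0.
Unshelve. all: end_near. Qed.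

Lemma nsq2_ge1 f n : L2 f -> nh (f n) ^+ 2 <= nsq ip2 f.
Proof.
move=> hf; apply: le_trans (nsq2_ge n.+1 hf).
by rewrite big_ord_recr /= lerDr; apply: sumr_ge0 => i _; exact: sqr_ge0.
Qed.

(** Cauchy sequences converge entrywise; the bounds on the finite partial sums
    pass to the entrywise limit. *)
Lemma ell2_complete : si_complete L2 ip2.
Proof.
move=> u hu hc.
have uB m n : L2 (u m - u n) by apply: (subB L2_subspace).
have /choice [l hl] : forall i, exists l, forall e : R, 0 < e ->
    exists N, forall n, (N <= n)%N -> nh (u n i - l) < e.
  move=> i; apply: (@hilbert_complete _ _ (fun n => u n i)) => e e0.
  have [N hN] := hc _ (exprn_gt0 2 e0); exists N => m n hm hn.
  rewrite -(@ltr_pXn2r _ 2) ?nnegrE ?nh_ge0 ?(ltW e0) //.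
  by apply: le_lt_trans (hN m n hm hn); apply: (@nsq2_ge1 (u m - u n) i).
have lim m n (K : R) N : (forall m', (N <= m')%N -> nsq ip2 (u m - u m') <= K) ->
    \sum_(i < n) nh (u m i - l i) ^+ 2 <= K.
  move=> hK.
  have hcv : (fun k => \sum_(i < n) nh (u m i - u k i) ^+ 2) @ \oo -->
      \sum_(i < n) nh (u m i - l i) ^+ 2.
    elim: n => [|n ihn].
      by rewrite big_ord0; under eq_cvg do rewrite big_ord0; exact: cvg_cst.
    rewrite big_ord_recr /=; under eq_cvg do rewrite big_ord_recr /=.
    apply: cvgD => //.
    have c1 : (fun k => nh (u m n - u k n)) @ \oo --> nh (u m n - l n).
      apply/cvgrPdist_lt => e e0; have [N' hN'] := hl n e e0.
      exists N' => // k hk; apply: le_lt_trans (hN' k hk).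
      have t1 := nhD (u m n - l n) (l n - u k n).
      have t2 := nhD (u m n - u k n) (u k n - l n).
      rewrite addrA subrK in t1; rewrite addrA subrK in t2.
      rewrite -[in nh (l n - _)]opprB nhN in t1.
      by rewrite ler_norml; apply/andP; split; lra.
    by under eq_cvg do rewrite expr2; rewrite expr2; apply: cvgM.
  apply: cvgr_to_le hcv _; near=> k.
  have hk : (N <= k)%N by near: k; exact: nbhs_infty_ge.
  by apply: le_trans (hK k hk); apply: (@nsq2_ge (u m - u k)).
have lL2 : L2 l.
  have [N hN] := hc 1 ltr01.
  have h1 : L2 (u N - l).
    exists 1 => n; apply: (lim _ _ _ N) => m' hm'; apply/ltW/hN => //.
  have -> : l = u N - (u N - l) by rewrite opprB addrC subrK.
  exact: (subB L2_subspace).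
exists l => // e e0; have e2 : 0 < e / 2 by rewrite divr_gt0.
have [N hN] := hc _ e2; exists N => n hn.
apply: (@le_lt_trans _ _ (e / 2)); last by lra.
apply: nsq2_le => k; apply: (lim _ _ _ N) => m' hm'.
by apply/ltW/hN.
Unshelve. all: end_near. Qed.

(** Interleaving realizes the orthogonal sum of two square summable sequences,
    so that a sum of two functionals [x |-> <x f, g>] is again of this form. *)
Definition interleave (f g : nat -> H) : nat -> H :=
  fun n => if odd n then g n./2 else f n./2.

Lemma sum_interleave (V : nmodType) (F : nat -> V) (f g : nat -> V) n :
  (forall i, F i.*2 = f i) -> (forall i, F i.*2.+1 = g i) ->
  \sum_(i < n.*2) F i = \sum_(i < n) f i + \sum_(i < n) g i.
Proof.
move=> hf hg; elim: n => [|n ihn]; first by rewrite !big_ord0 addr0.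
by rewrite doubleS !big_ord_recr /= ihn hf hg -addrA addrACA.
Qed.

Lemma interleave_even f g i : interleave f g i.*2 = f i.
Proof. by rewrite /interleave odd_double doubleK. Qed.
Lemma interleave_odd f g i : interleave f g i.*2.+1 = g i.
Proof. by rewrite /interleave /= odd_double uphalf_double. Qed.

Lemma L2_interleave f g : L2 f -> L2 g -> L2 (interleave f g).
Proof.
move=> [K hK] [K' hK']; exists (K + K') => n.
apply: (@le_trans _ _ (\sum_(i < n.*2) nh (interleave f g i) ^+ 2)).
  rewrite -addnn big_split_ord /= lerDl.
  by apply: sumr_ge0 => i _; exact: sqr_ge0.
rewrite (@sum_interleave _ (fun i => nh (interleave f g i) ^+ 2)
  (fun i => nh (f i) ^+ 2) (fun i => nh (g i) ^+ 2)).
- exact: lerD.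
- by move=> i; rewrite interleave_even.
- by move=> i; rewrite interleave_odd.
Qed.

Lemma ip2_interleave f g f' g' : L2 f -> L2 g -> L2 f' -> L2 g' ->
  ip2 (interleave f g) (interleave f' g') = ip2 f f' + ip2 g g'.
Proof.
move=> hf hg hf' hg'.
have /cvgC_P h1 := ip2_cvg (L2_interleave hf hg) (L2_interleave hf' hg').
have h2 : (fun n => series (fun n => inner (interleave f g n) (interleave f' g' n)) n.*2)
    @ \oo --> ip2 (interleave f g) (interleave f' g').
  apply/cvgC_P => e e0; have [N hN] := h1 e e0; exists N => n hn; apply: hN.
  by rewrite -addnn; apply: leq_trans hn (leq_addr _ _).
have h3 := cvgD (ip2_cvg hf hf') (ip2_cvg hg hg').
have e : (fun n => series (fun n => inner (interleave f g n) (interleave f' g' n)) n.*2) =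
    series (fun n => inner (f n) (f' n)) + series (fun n => inner (g n) (g' n)).
  apply/funext => n.
  transitivity (series (fun n => inner (f n) (f' n)) n +
    series (fun n => inner (g n) (g' n)) n) => //.
  rewrite /series /= !big_mkord.
  by apply: (@sum_interleave _ (fun i => inner (interleave f g i) (interleave f' g' i))
    (fun i => inner (f i) (f' i)) (fun i => inner (g i) (g' i)) n) => i;
    rewrite ?interleave_even ?interleave_odd.
rewrite e in h2.
by rewrite -(cvg_lim (@norm_hausdorff _ _) h2); exact: (cvg_lim (@norm_hausdorff _ _) (h3 _)).
Qed.

Definition single (h : H) : nat -> H := fun n => if n is 0 then h else 0.

Lemma L2_single h : L2 (single h).
Proof.
exists (nh h ^+ 2) => -[|n]; first by rewrite big_ord0 sqr_ge0.
by rewrite big_ord_recl big1 ?addr0 // => i _; rewrite /= nh0 expr0n.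
Qed.

Lemma ip2_single h g : ip2 (single h) g = inner h (g 0%N).
Proof.
apply: ip2_eq; apply/cvgC_P => e e0; exists 1%N => -[//|n] _.
rewrite /series /= big_mkord big_ord_recl big1 ?addr0 ?subrr ?cabs0 // => i _.
exact: (ip0l inner_semi).
Qed.

End EllTwo.

(** * Normal functionals *)

Section Predual.
Context {R : realType} {H : hilbertType R}.
Local Notation C := (cplx R).
Local Notation op := (H -> H).
Implicit Types (h k l : H) (x y T : op) (f g : nat -> H) (phi psi : op -> C).

Lemma L2P f : cvgn (series (fun n => `|f n| ^+ 2 : C)) <-> L2 f.
Proof.
have e n : series (fun n => `|f n| ^+ 2 : C) n = rc (\sum_(i < n) nh (f i) ^+ 2).
  rewrite /series /= big_mkord rmorph_sum; apply: eq_bigr => i _.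
  by rewrite nhE -rmorphXn.
split=> [/cvg_ex[l /cvgC_P hl]|[K hK]].
  have [N hN] := hl 1 ltr01; exists (cabs l + 1) => n.
  apply: (@le_trans _ _ (\sum_(i < n + N) nh (f i) ^+ 2)).
    by rewrite big_split_ord /= lerDl; apply: sumr_ge0 => i _; exact: sqr_ge0.
  have := hN (n + N)%N (leq_addl _ _); rewrite e => h1.
  have h2 := cabsD (rc (\sum_(i < n + N) nh (f i) ^+ 2) - l) l.
  rewrite subrK cabs_rc in h2.
  by have := ler_norm (\sum_(i < n + N) nh (f i) ^+ 2); lra.
apply: (@abs_series_cvg _ _ K) => n; apply: le_trans (hK n).
by apply: ler_sum => i _; rewrite nhE -rmorphXn /= cabs_rc ger0_norm ?sqr_ge0.
Qed.

Lemma predualP (M : set op) phi : M `<=` bounded_op ->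
  predual M phi <->
  exists f g, [/\ L2 f, L2 g & forall x, M x -> phi x = ip2 (x \o f) g].
Proof.
move=> hM; split=> [[f [g [hf hg hp]]]|[f [g [hf hg hp]]]].
  exists f, g; split; try exact/L2P.
  by move=> x hx; apply/esym/ip2_eq/hp.
exists f, g; split; try exact/L2P.
move=> x hx; rewrite hp //; have [c hc] := bnd_bound (hM _ hx).
by apply: (@ip2_cvg _ _ (x \o f)) => //; apply: L2_op hc _.
Qed.

Lemma ip2_ext f g f' g' : (forall n, inner (f n) (g n) = inner (f' n) (g' n)) ->
  ip2 f g = ip2 f' g'.
Proof. by move=> e; rewrite /ip2; congr (limn (series _)); apply/funext. Qed.

Lemma ip2_adj T f g : bounded_op T -> ip2 (adjoint T \o f) g = ip2 f (T \o g).
Proof. by move=> hT; apply: ip2_ext => n; rewrite /= adjointP. Qed.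

Lemma L2_bnd T f : bounded_op T -> L2 f -> L2 (T \o f).
Proof. by move=> /bnd_bound[c hc]; apply: L2_op hc. Qed.

Lemma nsq2_op T f (c : R) : op_bound T c -> L2 f ->
  nsq ip2 (T \o f) <= c ^+ 2 * nsq ip2 f.
Proof.
move=> [c0 hc] hf; apply: nsq2_le => n.
apply: le_trans (_ : c ^+ 2 * \sum_(i < n) nh (f i) ^+ 2 <= _); last first.
  by apply: ler_wpM2l; [exact: sqr_ge0 | exact: nsq2_ge].
rewrite mulr_sumr; apply: ler_sum => i _; rewrite -exprMn.
by rewrite ler_pXn2r ?nnegrE ?nh_ge0 ?mulr_ge0 ?nh_ge0 ?c0 ?hc.
Qed.

Lemma comp_fctL (T : op) (a : C) f g : bounded_op T ->
  T \o (a *: f + g) = a *: (T \o f) + (T \o g).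
Proof. by move=> hT; apply/funext => n; apply: (opL a (f n) (g n) hT). Qed.

Section Fixed.
Variable M : set op.
Hypothesis hM : von_neumann_algebra M.

Let Mb := vna_bounded hM.
Let Ms := vna_subspace hM.
Hint Resolve Ms : core.

Lemma pd_lin phi (a : C) x y : predual M phi -> M x -> M y ->
  phi (a *: x + y) = a * phi x + phi y.
Proof.
move=> /(predualP _ Mb)[f [g [hf hg hp]]] hx hy.
rewrite !hp //; last exact: Ms.2.
have -> : (a *: x + y) \o f = a *: (x \o f) + (y \o f) by [].
by apply: (si_lin ip2_semi) => //; apply: L2_bnd => //; apply: Mb.
Qed.
Lemma pdD phi x y : predual M phi -> M x -> M y -> phi (x + y) = phi x + phi y.
Proof. by move=> hp hx hy; rewrite -{1}[x]scale1r pd_lin // mul1r. Qed.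
Lemma pd0 phi : predual M phi -> phi 0 = 0.
Proof.
move=> hp; have M0 : M 0 := sub0 Ms; have := pdD hp M0 M0.
by rewrite addr0 => /eqP; rewrite -subr_eq0 opprD addNKr oppr_eq0 => /eqP.
Qed.
Lemma pdZ phi (a : C) x : predual M phi -> M x -> phi (a *: x) = a * phi x.
Proof.
by move=> hp hx; rewrite -[a *: x]addr0 pd_lin // ?pd0 ?addr0 //; apply: sub0.
Qed.
Lemma pdB phi x y : predual M phi -> M x -> M y -> phi (x - y) = phi x - phi y.
Proof.
move=> hp hx hy; rewrite pdD //; last by apply: subN.
by rewrite -scaleN1r pdZ // mulN1r.
Qed.
Lemma pd_ext phi psi : predual M phi -> (forall x, M x -> phi x = psi x) -> predual M psi.
Proof.
move=> /(predualP _ Mb)[f [g [hf hg hp]]] e; apply/(predualP _ Mb).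
by exists f, g; split=> // x hx; rewrite -e // hp.
Qed.
Lemma pd_add phi psi : predual M phi -> predual M psi ->
  predual M (fun x => phi x + psi x).
Proof.
move=> /(predualP _ Mb)[f [g [hf hg hp]]] /(predualP _ Mb)[f' [g' [hf' hg' hp']]].
apply/(predualP _ Mb); exists (interleave f f'), (interleave g g').
split; try exact: L2_interleave.
move=> x hx; rewrite hp // hp' // -ip2_interleave //; try exact: L2_bnd (Mb hx) _.
by congr ip2; apply/funext => n; rewrite /interleave /=; case: ifP.
Qed.
Lemma pd_scale (a : C) phi : predual M phi -> predual M (fun x => a * phi x).
Proof.
move=> /(predualP _ Mb)[f [g [hf hg hp]]]; apply/(predualP _ Mb).
exists f, (a^* *: g); split=> //; first exact: (subZ L2_subspace).
by move=> x hx; rewrite hp // (ipZr ip2_semi) ?conjCK //; apply: L2_bnd (Mb hx) _.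
Qed.
Lemma pd_mul phi a b : predual M phi -> M a -> M b ->
  predual M (fun x => phi (a \o x \o b)).
Proof.
move=> /(predualP _ Mb)[f [g [hf hg hp]]] ha hb; apply/(predualP _ Mb).
exists (b \o f), (adjoint a \o g); split.
- exact: L2_bnd (Mb hb) _.
- exact: L2_bnd (bnd_adj (Mb ha)) _.
move=> x hx; rewrite hp; last by apply: (vna_comp hM) => //; apply: (vna_comp hM).
by apply: ip2_ext => n; rewrite /= adjointPr //; apply: Mb.
Qed.
Lemma pd_mull phi a : predual M phi -> M a -> predual M (fun x => phi (a \o x)).
Proof. by move=> hp ha; apply: (pd_mul hp ha (vna_id hM)). Qed.
Lemma pd_vec2 f g : L2 f -> L2 g -> predual M (fun x => ip2 (x \o f) g).
Proof. by move=> hf hg; apply/(predualP _ Mb); exists f, g. Qed.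
Lemma pd_vec h k : predual M (fun x => inner (x h) k).
Proof.
apply: (pd_ext (pd_vec2 (L2_single h) (L2_single k))) => x hx.
rewrite -(ip2_single (x h) (single k)); apply: ip2_ext => -[|n] //=.
by rewrite op0 //; apply: Mb.
Qed.

(** Polarization: a normal functional is a combination of four functionals of
    the form [x |-> <x f, f>], which are positive.  It takes the place of the
    Jordan decomposition. *)
Lemma pd_polar f g x : L2 f -> L2 g -> M x ->
  4 * ip2 (x \o f) g =
  ip2 (x \o (1 *: g + f)) (1 *: g + f) - ip2 (x \o ((-1) *: g + f)) ((-1) *: g + f)
  + ic * ip2 (x \o (ic *: g + f)) (ic *: g + f)
  - ic * ip2 (x \o ((- ic) *: g + f)) ((- ic) *: g + f).
Proof.
move=> hf hg hx; have bx := Mb hx.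
have xf := L2_bnd bx hf; have xg := L2_bnd bx hg.
have key (a : C) : ip2 (x \o (a *: g + f)) (a *: g + f) =
    a * a^* * ip2 (x \o g) g + a * ip2 (x \o g) f + a^* * ip2 (x \o f) g + ip2 (x \o f) f.
  rewrite comp_fctL //; set xag := a *: _ + _.
  have hxag : L2 xag by apply: L2_subspace.2.
  rewrite (ipDr ip2_semi) //; last exact: (subZ L2_subspace).
  rewrite (ipZr ip2_semi) // /xag !(si_lin ip2_semi) //; ring.
have c1 : (-1 : C)^* = -1 by rewrite rmorphN1.
have c2 : (- ic : C)^* = ic by rewrite rmorphN /= conj_ic opprK.
rewrite !key c1 c2 conj_ic rmorph1.
move: (ip2 (x \o g) g) (ip2 (x \o g) f) (ip2 (x \o f) g) (ip2 (x \o f) f) => P Q S T.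
have e : 1 + ic * ic = 0 :> C by rewrite ic2 subrr.
apply/eqP; rewrite -subr_eq0 -[X in _ == X](mulr0 (2 * (S - Q))) -e.
by apply/eqP; ring.
Qed.

(** Finite-dimensional separation.  If one of the functionals takes the value
    1 at some [s1] in [S], pass to its kernel in [S] and to
    [x - phi x *: s1]; the hypothesis on annihilators is inherited. *)
Lemma fin_sep (fs : seq (op -> C)) (S : set op) x :
  subspace S -> S `<=` M -> M x ->
  (forall phi, predual M phi -> (forall s, S s -> phi s = 0) -> phi x = 0) ->
  (forall n, (n < size fs)%N -> predual M (nth (fun=> 0) fs n)) ->
  exists2 s, S s & forall n, (n < size fs)%N ->
    nth (fun=> 0) fs n s = nth (fun=> 0) fs n x.
Proof.
elim: fs S x => [|phi fs ih] S x hS hSM hx sep hfs.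
  by exists 0 => //; apply: sub0 hS.
have hphi : predual M phi := hfs 0%N isT.
have hfs' n : (n < size fs)%N -> predual M (nth (fun=> 0) fs n) by move=> hn; apply: (hfs n.+1).
have [z|/existsNP [s0 /not_implyP [Ss0 /eqP p0]]] := pselect (forall s, S s -> phi s = 0).
  have [s hs1 hs2] := ih S x hS hSM hx sep hfs'.
  by exists s => // -[|n] hn /=; [rewrite z // sep | apply: hs2].
pose s1 := (phi s0)^-1 *: s0.
have Ss1 : S s1 by apply: (subZ hS).
have p1 : phi s1 = 1 by rewrite /s1 pdZ ?mulVf //; apply: hSM.
pose S' : set op := [set s | S s /\ phi s = 0].
have hS' : subspace S'.
  split; first by split; [exact: sub0 hS | exact: pd0].
  move=> a u v [hu pu] [hv pv]; split; first exact: hS.2.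
  by rewrite pd_lin ?pu ?pv ?mulr0 ?addr0 //; apply: hSM.
pose x' := x - phi x *: s1.
have Mx1 : M (phi x *: s1) by apply: (subZ Ms); apply: hSM.
have Mx' : M x' by apply: (subB Ms).
have [|s [hs1 ps] hs2] := ih S' x' hS' (fun s hs => hSM _ hs.1) Mx' _ hfs'.
  move=> psi hpsi zpsi; rewrite pdB // pdZ //; last exact: hSM.
  have hz s : S s -> psi s + - psi s1 * phi s = 0.
    move=> hs; have Ss2 : S (phi s *: s1) by apply: (subZ hS).
    have : psi (s - phi s *: s1) = 0.
      apply: zpsi; split; first exact: (subB hS).
      by rewrite (pdB hphi (hSM _ hs) (hSM _ Ss2)) (pdZ _ hphi (hSM _ Ss1)) p1 mulr1 subrr.
    rewrite pdB //; try exact: hSM.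
    by rewrite pdZ //; [rewrite mulNr mulrC | exact: hSM].
  by have := sep _ (pd_add hpsi (pd_scale (- psi s1) hphi)) hz; rewrite mulNr mulrC.
have Ms2 : M (phi x *: s1 + s) by apply: (subD Ms) => //; apply: hSM.
exists (phi x *: s1 + s); first by apply: hS.2.
move=> [|n] hn /=.
  by rewrite pd_lin ?ps ?p1 ?mulr1 ?addr0 //; apply: hSM.
have hn' : (n < size fs)%N by [].
rewrite (pdD (hfs' n hn') Mx1 (hSM _ hs1)) (hs2 n hn') (pdB (hfs' n hn') hx Mx1).
by rewrite addrC subrK.
Qed.

(** The bipolar theorem for subspaces: weak-* closures are determined by the
    normal functionals that vanish on the subspace. *)
Lemma weak_star_closureP (S : set op) x : subspace S -> S `<=` M ->
  weak_star_closure M S x <->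
  M x /\ forall phi, predual M phi -> (forall s, S s -> phi s = 0) -> phi x = 0.
Proof.
move=> hS hSM; split=> [[hx hcl]|[hx sep]]; split=> //.
  move=> phi hphi z; apply: cabs_eq0; apply/eqP; rewrite eq_le cabs_ge0 andbT.
  apply/ler_addgt0Pr => e e0; rewrite add0r.
  have [||y [hy My] hlt] := hcl 1%N (fun=> fun x => `|phi x|) (rc e).
  - by move=> _; exists phi.
  - by rewrite ltr_rc.
  move: (hlt ord0); rewrite pdB // z // sub0r normrN normE ltr_rc; exact: ltW.
move=> n p e hp e0.
have /choice [phi hphi] : forall i, exists phi, predual M phi /\ p i = (fun x => `|phi x|).
  by move=> i; have [phi h1 h2] := hp i; exists phi.
pose fs := [seq phi i | i <- enum 'I_n].
have sz : size fs = n by rewrite size_map size_enum_ord.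
have nthE (i : 'I_n) : nth (fun=> 0) fs i = phi i.
  by rewrite (nth_map i) ?size_enum_ord // nth_ord_enum.
have [|s hs1 hs2] := @fin_sep fs S x hS hSM hx sep.
  by move=> i; rewrite sz => hi; rewrite (nthE (Ordinal hi)); case: (hphi (Ordinal hi)).
exists s; first by split=> //; apply: hSM.
move=> i; have [h1 ->] := hphi i.
have := hs2 i; rewrite sz ltn_ord nthE => /(_ isT) e1.
by rewrite pdB ?e1 ?subrr ?normr0 //; apply: hSM.
Qed.

End Fixed.
End Predual.

(** * Weak-* closed subspaces *)

Section WeakStar.
Context {R : realType} {H : hilbertType R}.
Local Notation C := (cplx R).
Local Notation op := (H -> H).
Implicit Types (x y T : op) (S : set op).
Variable M : set op.
Hypothesis hM : von_neumann_algebra M.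
Let Mb := vna_bounded hM.
Let Ms := vna_subspace hM.

Lemma weak_star_closed_sep S x : subspace S -> S `<=` M -> weak_star_closed M S ->
  M x -> (forall phi, predual M phi -> (forall s, S s -> phi s = 0) -> phi x = 0) ->
  S x.
Proof.
move=> hS hSM e hx sep; have : weak_star_closure M S x.
  by apply/(weak_star_closureP hM _ hS hSM).
by rewrite e.
Qed.

Lemma sub_weak_star_closure S : S `<=` M -> S `<=` weak_star_closure M S.
Proof.
move=> hSM x hx; split; first exact: hSM.
move=> n p e hp e0; exists x; first by split=> //; apply: hSM.
move=> i; have [phi hphi ->] := hp i.
by rewrite subrr (pd0 hM) // normr0.
Qed.

Lemma weak_star_closure_sub S : weak_star_closure M S `<=` M.
Proof. by move=> x []. Qed.

Lemma weak_star_closure_mono S S' : S `<=` S' ->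
  weak_star_closure M S `<=` weak_star_closure M S'.
Proof.
move=> hSS x [hx hcl]; split=> // n p e hp e0.
by have [y [hy1 hy2] hlt] := hcl n p e hp e0; exists y => //; split=> //; apply: hSS.
Qed.

Lemma weak_star_closure_subspace S : subspace S -> S `<=` M ->
  subspace (weak_star_closure M S).
Proof.
move=> hS hSM; split; first by apply: sub_weak_star_closure => //; exact: sub0 hS.
move=> a x y /(weak_star_closureP hM _ hS hSM)[hx sx] /(weak_star_closureP hM _ hS hSM)[hy sy].
apply/(weak_star_closureP hM _ hS hSM); split; first exact: Ms.2.
by move=> phi hphi z; rewrite (pd_lin hM) // sx // sy // mulr0 addr0.
Qed.

Lemma weak_star_closureK S : subspace S -> S `<=` M ->
  weak_star_closed M (weak_star_closure M S).
Proof.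
move=> hS hSM; apply/seteqP; split; last first.
  by apply: sub_weak_star_closure; apply: weak_star_closure_sub.
have hW := weak_star_closure_subspace hS hSM.
move=> x /(weak_star_closureP hM _ hW (@weak_star_closure_sub S))[hx sx].
apply/(weak_star_closureP hM _ hS hSM); split=> // phi hphi z.
by apply: sx => // s /(weak_star_closureP hM _ hS hSM)[_]; apply.
Qed.

(** Weak and norm closures agree for subspaces of a Hilbert space.  If [p] is
    the projection of [x f] on the closure of [S f], the normal functional
    [z |-> <z f, x f - p>] vanishes on [S], hence at [x], so that [x f = p]. *)
Lemma mazur S x (f : nat -> H) (e : R) : subspace S -> S `<=` M ->
  weak_star_closure M S x -> L2 f -> 0 < e ->
  exists2 y, S y & nsq ip2 ((x - y) \o f) < e.
Proof.
move=> hS hSM /(weak_star_closureP hM _ hS hSM)[hx sx] hf e0.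
pose Sf : set (nat -> H) := [set y \o f | y in S].
have hSf : subspace Sf.
  split; first by exists 0 => //; apply: sub0.
  move=> a _ _ [u hu <-] [v hv <-]; exists (a *: u + v) => //.
  exact: hS.2.
have hSfL : Sf `<=` L2.
  by move=> _ [u hu <-]; apply: L2_bnd => //; apply/Mb/hSM.
have hxf : L2 (x \o f) by apply: L2_bnd => //; apply: Mb.
have [p [Lp hp1 hp2]] := projection_theorem ip2_semi ell2_complete hSf hSfL hxf.
pose t := x \o f - p.
have Lt : L2 t by apply: (subB L2_subspace).
have xt : ip2 (x \o f) t = 0.
  apply: (sx _ (pd_vec2 hM hf Lt)) => s hs.
  have Ls : L2 (s \o f) by apply: hSfL; exists s.
  rewrite (si_conj ip2_semi Lt Ls) hp2 ?rmorph0 //; by exists s.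
have pt : ip2 p t = 0.
  apply: cabs_eq0; apply/eqP; rewrite eq_le cabs_ge0 andbT.
  apply/ler_addgt0Pr => d d0; rewrite add0r.
  have n1 : 0 < nm ip2 t + 1 by rewrite ltr_wpDl ?nm_ge0.
  have d1 : 0 < d / (nm ip2 t + 1) by rewrite divr_gt0.
  have [s Ss hs] := hp1 _ (exprn_gt0 2 d1).
  have Ls := hSfL _ Ss; have Lps : L2 (p - s) by apply: (subB L2_subspace).
  have -> : ip2 p t = ip2 (p - s) t.
    by rewrite (ipBl ip2_semi) // (si_conj ip2_semi Lt Ls) hp2 // rmorph0 subr0.
  apply: le_trans (cauchy_schwarz_nm ip2_semi Lps Lt) _.
  have /ltW hlt := nm_lt ip2_semi Lps d1 hs.
  apply: (@le_trans _ _ (d / (nm ip2 t + 1) * nm ip2 t)).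
    by rewrite ler_wpM2r ?nm_ge0.
  rewrite mulrAC ler_pdivrMr // ler_wpM2l ?(ltW d0) //; lra.
have t0 : nsq ip2 t = 0 by rewrite /nsq {1}/t (ipBl ip2_semi) // xt pt subrr.
have e4 : 0 < e / 4 by rewrite divr_gt0.
have [_ [y Sy <-] hy] := hp1 _ e4.
exists y => //; have -> : (x - y) \o f = t + (p - (y \o f)).
  by rewrite /t addrA subrK.
have Ly : L2 (y \o f) by apply: hSfL; exists y.
apply: le_lt_trans (nsqD_le ip2_semi Lt _) _; first exact: (subB L2_subspace).
rewrite t0; lra.
Qed.

End WeakStar.

(** * Square roots and unitaries in von Neumann algebras *)

Section VNA.
Context {R : realType} {H : hilbertType R}.
Local Notation C := (cplx R).
Local Notation op := (H -> H).
Implicit Types (x y T S : op) (h k : H).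

Lemma scale2 (V : lmodType C) (v : V) : v + v = (2 : C) *: v.
Proof. by rewrite scaler_nat mulr2n. Qed.

Definition unitary (u : op) := adjoint u \o u = idfun /\ u \o adjoint u = idfun.

Lemma positive_semi_inner T : bounded_op T -> positive_op T ->
  semi_inner [set: H] (fun h k => inner (T h) k).
Proof.
move=> bT pT; apply: semi_inner_of_positive => //.
- by move=> a x y z _ _ _; rewrite (opL _ _ _ bT) innerDl innerZl.
- by move=> a x y z _ _ _; rewrite innerDr innerZr.
Qed.

Lemma pos_selfadj T : bounded_op T -> positive_op T -> adjoint T = T.
Proof.
move=> bT pT; apply: adjoint_eq => // h k.
rewrite [RHS]innerC; exact: (si_conj (positive_semi_inner bT pT)).
Qed.

(** Cauchy-Schwarz for the form [<T h, k>] with [k = T h]. *)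
Lemma pos_le_bound T : bounded_op T -> positive_op T ->
  (forall h, re (inner (T h) h) <= nh h ^+ 2) -> op_bound T 1.
Proof.
move=> hT hp hle; split=> // h; rewrite mul1r.
have si := positive_semi_inner hT hp.
have := cauchy_schwarz si (I : [set: H] h) (I : [set: H] (T h)).
rewrite /nsq => hcs.
have h1 := hle h; have h2 := hle (T h).
have h3 : 0 <= re (inner (T h) h) by apply/re_ge0/hp.
have h4 : 0 <= re (inner (T (T h)) (T h)) by apply/re_ge0/hp.
rewrite (ip_nsq inner_semi) // -nh_sq cabs_rc ger0_norm ?sqr_ge0 // in hcs.
have n0 := nh_ge0 h; have n1 := nh_ge0 (T h).
have [z|zN] := eqVneq (nh (T h)) 0; first by rewrite z.
have zp : 0 < nh (T h) ^+ 2 by rewrite exprn_gt0 // lt0r zN.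
rewrite -(@ler_pXn2r _ 2) ?nnegrE // -(ler_pM2r zp) -expr2.
by apply: le_trans hcs _; apply: ler_pM.
Qed.

Lemma cvg_inner (u : nat -> H) l k :
  (forall e : R, 0 < e -> exists N, forall n, (N <= n)%N -> nh (u n - l) < e) ->
  (fun n => inner (u n) k) @ \oo --> inner l k.
Proof.
move=> hu; apply/cvgC_P => e e0.
have n1 : 0 < nh k + 1 by rewrite ltr_wpDl ?nh_ge0.
have d1 : 0 < e / (nh k + 1) by rewrite divr_gt0.
have [N hN] := hu _ d1; exists N => n hn; rewrite -innerBl.
apply: le_lt_trans (inner_le _ _) _.
have := hN n hn; rewrite ltr_pdivlMr // => hlt.
by apply: le_lt_trans hlt; rewrite ler_wpM2l ?nh_ge0 // lerDl.
Qed.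

(** The square root of [1 - a], for [0 <= a <= 1], is [1 - r] where [r] is the
    limit of the iteration [r_(n+1) = (a + r_n^2) / 2] from [r_0 = 0].  The
    scalar iteration with [a = 1] is increasing and bounded by 1, and its
    increments bound those of the operators. *)
Section SquareRoot.
Variable a : op.
Hypothesis ba : bounded_op a.
Hypothesis a1 : op_bound a 1.

Fixpoint sq_iter n : op :=
  if n is m.+1 then (2^-1 : C) *: (a + (sq_iter m \o sq_iter m)) else 0.
Fixpoint sq_scal n : R := if n is m.+1 then (1 + sq_scal m ^+ 2) / 2 else 0.

Lemma sq_scal_bound n : 0 <= sq_scal n <= 1.
Proof. by elim: n => [|n /andP[h1 h2]] /=; rewrite ?lexx ?ler01 //; nra. Qed.
Lemma sq_scal_incr n : sq_scal n <= sq_scal n.+1.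
Proof. by have := sq_scal_bound n => /= /andP[h1 h2]; nra. Qed.

Lemma sq_iter_bnd n : bounded_op (sq_iter n).
Proof.
elim: n => [|n ih]; first exact: sub0 bnd_subspace.
by apply: (subZ bnd_subspace); apply: (subD bnd_subspace) => //; apply: bnd_comp.
Qed.
Lemma sq_iter_comm T n : bounded_op T -> T \o a = a \o T ->
  T \o sq_iter n = sq_iter n \o T.
Proof.
move=> hT hc; elim: n => [|n ih]; first by rewrite /= comp0r.
rewrite /= compZr // compDr // hc; apply/funext => h /=.
have e k : T (sq_iter n k) = sq_iter n (T k) by rewrite -[LHS]/((T \o sq_iter n) k) ih.
by rewrite /GRing.scale /= /Algebra.add /= !e.
Qed.
Lemma sq_iter_op_bound n : op_bound (sq_iter n) (sq_scal n).
Proof.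
elim: n => [|n ih] /=; first by split=> // h; rewrite nh0 mul0r.
have := op_boundZ (2^-1) (op_boundD a1 (op_bound_comp ih ih)).
by rewrite cabs_half -expr2 mulrC.
Qed.
Lemma sq_iter_commute m n : sq_iter m \o sq_iter n = sq_iter n \o sq_iter m.
Proof.
apply: sq_iter_comm; first exact: sq_iter_bnd.
by apply/esym/sq_iter_comm.
Qed.
Lemma sq_iter_step n :
  op_bound (sq_iter n.+1 - sq_iter n) (sq_scal n.+1 - sq_scal n).
Proof.
elim: n => [|n ih].
  have -> : sq_iter 1 - sq_iter 0 = (2^-1 : C) *: a.
    by apply/funext => h; rewrite /= subr0 -[LHS]/(2^-1 *: (a h + 0)) addr0.
  have := op_boundZ (2^-1) a1; rewrite cabs_half /=.
  by rewrite expr0n /= addr0 subr0 mulr1 mul1r.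
have -> : sq_iter n.+2 - sq_iter n.+1 =
   (2^-1 : C) *: ((sq_iter n.+1 - sq_iter n) \o (sq_iter n.+1 + sq_iter n)).
  have b1 := sq_iter_bnd n.+1; have b0 := sq_iter_bnd n.
  rewrite compDr; last by apply: (subB bnd_subspace).
  have e : sq_iter n.+1 \o sq_iter n = sq_iter n \o sq_iter n.+1 := sq_iter_commute _ _.
  rewrite -[sq_iter n.+2]/((2^-1 : C) *: (a + (sq_iter n.+1 \o sq_iter n.+1))).
  rewrite -[X in _ - X]/((2^-1 : C) *: (a + (sq_iter n \o sq_iter n))) -scalerBr.
  congr (_ *: _); apply/funext => h.
  have eh : sq_iter n.+1 (sq_iter n h) = sq_iter n (sq_iter n.+1 h).
    by rewrite -[LHS]/((sq_iter n.+1 \o sq_iter n) h) e.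
  rewrite -[RHS]/(sq_iter n.+1 (sq_iter n.+1 h) - sq_iter n (sq_iter n.+1 h) +
     (sq_iter n.+1 (sq_iter n h) - sq_iter n (sq_iter n h))) eh subrKA.
  rewrite -[LHS]/(a h + sq_iter n.+1 (sq_iter n.+1 h) - (a h + sq_iter n (sq_iter n h))).
  by rewrite opprD addrACA subrr add0r.
have := op_boundZ (2^-1) (op_bound_comp ih
  (op_boundD (sq_iter_op_bound n.+1) (sq_iter_op_bound n))).
rewrite cabs_half.
suff -> : sq_scal n.+2 - sq_scal n.+1 =
  2^-1 * ((sq_scal n.+1 - sq_scal n) * (sq_scal n.+1 + sq_scal n)) by [].
by rewrite -[sq_scal n.+2]/((1 + sq_scal n.+1 ^+ 2) / 2)
  -[X in _ - X]/((1 + sq_scal n ^+ 2) / 2); field.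
Qed.
Lemma sq_iter_diff m n : (n <= m)%N ->
  op_bound (sq_iter m - sq_iter n) (sq_scal m - sq_scal n).
Proof.
move=> /subnK <-; elim: (m - n)%N => [|k ih].
  by rewrite add0n !subrr; split=> // h; rewrite nh0 mul0r.
rewrite addSn -(subrKA (sq_iter (k + n))) -(subrKA (sq_scal (k + n))).
by apply: op_boundD => //; apply: sq_iter_step.
Qed.

Lemma sq_scal_cauchy (e : R) : 0 < e -> exists N, forall m n, (N <= n)%N -> (n <= m)%N ->
  sq_scal m - sq_scal n < e.
Proof.
move=> e0.
have incr : {homo sq_scal : n m / (n <= m)%N >-> n <= m}.
  by apply: homo_leq => //; [exact: le_trans | exact: sq_scal_incr].
have /cvg_ex [l hl] : cvgn sq_scal.
  apply: nondecreasing_is_cvgn => //.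
  by exists 1 => _ [n _ <-]; case/andP: (sq_scal_bound n).
have lel n : sq_scal n <= l.
  by have := nondecreasing_cvgn_le incr (cvgP _ hl) n; rewrite (cvg_lim (@norm_hausdorff _ _) hl).
move/cvgrPdist_lt : hl => /(_ e e0) [N _ hN]; exists N => m n hn hmn.
have := hN n hn => /=; have := lel n; have := lel m => h1 h2.
by rewrite ger0_norm ?subr_ge0 //; lra.
Qed.

Lemma sq_lim : exists r : op, [/\ bounded_op r,
  forall h (e : R), 0 < e -> exists N, forall n, (N <= n)%N -> nh (sq_iter n h - r h) < e &
  r \o r = (2 : C) *: r - a].
Proof.
have /choice [r hr] : forall h, exists l, forall e : R, 0 < e ->
    exists N, forall n, (N <= n)%N -> nh (sq_iter n h - l) < e.
  move=> h; apply: (@hilbert_complete _ _ (fun n => sq_iter n h)) => e e0.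
  have n1 : 0 < nh h + 1 by rewrite ltr_wpDl ?nh_ge0.
  have d1 : 0 < e / (nh h + 1) by rewrite divr_gt0.
  have [N hN] := sq_scal_cauchy d1.
  have key m n : (N <= n)%N -> (n <= m)%N -> nh (sq_iter m h - sq_iter n h) < e.
    move=> hn hmn; have := hN m n hn hmn; rewrite ltr_pdivlMr // => hlt.
    have [s0 hs] := sq_iter_diff hmn.
    apply: le_lt_trans hlt; apply: le_trans (hs h) _.
    by rewrite ler_wpM2l // lerDl.
  exists N => m n hm hn; case: (leqP n m) => hmn; first exact: key.
  by rewrite -nhN opprB; apply: key => //; exact: ltnW.
have lin : linear r.
  move=> c h k; apply: inner_injl => l.
  have h1 := cvg_inner (k := l) (hr (c *: h + k)).
  have h2 : (fun n => inner (sq_iter n (c *: h + k)) l) @ \oo --> c * inner (r h) l + inner (r k) l.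
    under eq_cvg do rewrite (opL _ _ _ (sq_iter_bnd _)) innerDl innerZl.
    by apply: cvgD; [apply: cvgMr|]; apply: cvg_inner; apply: hr.
  rewrite innerDl innerZl.
  by rewrite -(cvg_lim (@norm_hausdorff _ _) h1) -(cvg_lim (@norm_hausdorff _ _) h2).
have r1 : op_bound r 1.
  split=> // h; rewrite mul1r; apply/ler_addgt0Pr => e e0.
  have [N hN] := hr h e e0.
  have -> : r h = sq_iter N h - (sq_iter N h - r h) by rewrite opprB addrC subrK.
  apply: le_trans (nhD _ _) _; rewrite nhN; apply: lerD; last by apply/ltW/hN.
  have [_ hb] := sq_iter_op_bound N; apply: le_trans (hb h) _.
  by rewrite ler_piMl ?nh_ge0 //; case/andP: (sq_scal_bound N).
have br : bounded_op r by apply/bounded_opP; split=> //; exists 1.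
exists r; split => //.
apply/funext => h; apply: (@nh_lim_uniq _ _ (fun n => sq_iter n (sq_iter n h))) => e e0.
  have e2 : 0 < e / 2 by rewrite divr_gt0.
  have [N1 hN1] := hr h _ e2; have [N2 hN2] := hr (r h) _ e2.
  exists (maxn N1 N2) => n; rewrite geq_max => /andP[hn1 hn2].
  have -> : sq_iter n (sq_iter n h) - (r \o r) h =
     sq_iter n (sq_iter n h - r h) + (sq_iter n (r h) - r (r h)).
    by rewrite (opB _ _ (sq_iter_bnd n)) subrKA.
  apply: le_lt_trans (nhD _ _) _.
  have [_ hb] := sq_iter_op_bound n; have hb1 := hb (sq_iter n h - r h).
  have /andP[_ s1] := sq_scal_bound n.
  have h1 := hN1 n hn1; have h2 := hN2 n hn2; have h3 := nh_ge0 (sq_iter n h - r h).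
  nra.
have e2 : 0 < e / 2 by rewrite divr_gt0.
have [N hN] := hr h _ e2; exists N => n hn.
have -> : sq_iter n (sq_iter n h) - ((2 : C) *: r - a) h = (2 : C) *: (sq_iter n.+1 h - r h).
  rewrite scalerBr -[sq_iter n.+1 h]/((2^-1 : C) *: (a h + sq_iter n (sq_iter n h))).
  rewrite scalerA mulfV ?pnatr_eq0 // scale1r.
  rewrite -[((2 : C) *: r - a) h]/((2 : C) *: r h - a h) opprB addrA.
  by rewrite [sq_iter n _ + _]addrC.
rewrite nhZ (_ : cabs 2 = 2); last first.
  by have := cabs_rc (2 : R); rewrite rmorph_nat normr_nat.
by have := hN n.+1 (leqW hn); lra.
Qed.

Lemma sq_iter_selfadj n : adjoint a = a -> adjoint (sq_iter n) = sq_iter n.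
Proof.
move=> sa; elim: n => [|n ih].
  apply: adjoint_eq; first exact: sub0 bnd_subspace.
  by move=> h k; rewrite (ip0l inner_semi) // (ip0r inner_semi).
have b := sq_iter_bnd n; have bb := bnd_comp b b.
rewrite /= adjZ; last exact: (subD bnd_subspace).
by rewrite adjD // adj_comp // sa ih half_rc conj_rc.
Qed.
End SquareRoot.

(** The square root commutes with every bounded operator that commutes with
    [T], which is what places it in each von Neumann algebra containing [T]. *)
Lemma pos_sqrt T : bounded_op T -> positive_op T ->
  exists y, [/\ bounded_op y, adjoint y = y, y \o y = T &
    forall S, bounded_op S -> S \o T = T \o S -> S \o y = y \o S].
Proof.
move=> bT pT; have [c [c0 hc]] := bnd_bound bT.
have sT := pos_selfadj bT pT.
(* Rescale so that [0 <= T / d <= 1]. *)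
pose d := c + 1; have d0 : 0 < d by rewrite ltr_wpDl.
pose a : op := idfun - rc d^-1 *: T.
have bdT : bounded_op (rc d^-1 *: T) := subZ bnd_subspace _ bT.
have ba : bounded_op a by apply: (subB bnd_subspace) => //; exact: bnd_id.
have aE h : inner (a h) h = rc (nh h ^+ 2 - d^-1 * re (inner (T h) h)).
  rewrite -[a h]/(h - rc d^-1 *: T h) innerBl innerZl (ge0_rc (pT h)) re_rc.
  by rewrite (ip_nsq inner_semi) // -nh_sq rmorphB /= [X in _ = _ - X](rmorphM _ d^-1).
have Tle h : d^-1 * re (inner (T h) h) <= nh h ^+ 2.
  rewrite ler_pdivrMl //; apply: le_trans (re_le_cabs _) _.
  apply: le_trans (inner_le _ _) _.
  have := hc h; have := nh_ge0 h; rewrite /d => n0 hh.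
  by rewrite expr2 mulrA ler_wpM2r //; lra.
have Tge h : 0 <= d^-1 * re (inner (T h) h).
  by rewrite mulr_ge0 ?invr_ge0 ?(ltW d0) // re_ge0.
have pa : positive_op a by move=> h; rewrite aE rc_ge0 subr_ge0.
have a1 : op_bound a 1.
  by apply: pos_le_bound => // h; rewrite aE re_rc gerBl.
have sa := pos_selfadj ba pa.
have [r [br hr rr]] := sq_lim ba a1.
have sr : adjoint r = r.
  apply: adjoint_eq => // h k.
  have h1 := cvg_inner (k := k) (hr h).
  have h2 := cvg_conj (cvg_inner (k := h) (hr k)).
  rewrite -innerC in h2.
  rewrite -(cvg_lim (@norm_hausdorff _ _) h1) -(cvg_lim (@norm_hausdorff _ _) h2).
  congr (lim (_ @ \oo)); apply/funext => n.
  by rewrite -innerC -adjointP ?sq_iter_selfadj //; exact: sq_iter_bnd.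
have cr S : bounded_op S -> S \o a = a \o S -> S \o r = r \o S.
  move=> bS hS; apply/funext => h.
  apply: (@nh_lim_uniq _ _ (fun n => S (sq_iter a n h))) => e e0; last first.
    have [N hN] := hr (S h) e e0; exists N => n hn.
    have -> : S (sq_iter a n h) = sq_iter a n (S h).
      by rewrite -[LHS]/((S \o sq_iter a n) h) sq_iter_comm.
    exact: hN.
  have [s [s0 hs]] := bnd_bound bS.
  have s1 : 0 < s + 1 by rewrite ltr_wpDl.
  have e1 : 0 < e / (s + 1) by rewrite divr_gt0.
  have [N hN] := hr h _ e1; exists N => n hn.
  rewrite -[(S \o r) h]/(S (r h)) -opB //; apply: le_lt_trans (hs _) _.
  have := hN n hn; rewrite ltr_pdivlMr // => hlt; apply: le_lt_trans hlt.
  by rewrite mulrC ler_wpM2l ?nh_ge0 // lerDl.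
pose q := Num.sqrt d.
pose y : op := rc q *: (idfun - r).
have bid : bounded_op (idfun - r) by apply: (subB bnd_subspace) => //; exact: bnd_id.
exists y; split.
- exact: (subZ bnd_subspace).
- by rewrite adjZ // conj_rc adjB ?adj_id ?sr //; exact: bnd_id.
- apply/funext => h.
  have e1 : r (r h) = (2 : C) *: r h - a h by rewrite -[LHS]/((r \o r) h) rr.
  rewrite -[LHS]/(rc q *: (rc q *: (h - r h) - r (rc q *: (h - r h)))).
  rewrite opZ // -scalerBr scalerA -rmorphM -expr2 sqr_sqrtr ?(ltW d0) // opB // e1.
  have -> : h - r h - (r h - ((2 : C) *: r h - a h)) = rc d^-1 *: T h.
    rewrite -[a h]/(h - rc d^-1 *: T h) scaler_nat mulr2n.
    move: (rc d^-1 *: T h) (r h) => v u.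
    have -> : u - (u + u - (h - v)) = (h - v) - u.
      by rewrite [LHS]addrC opprB opprD addrA subrK.
    by rewrite opprB subrKA opprB addrC subrK.
  by rewrite scalerA -rmorphM mulfV ?gt_eqF // scale1r.
- move=> S bS hS; have hSa : S \o a = a \o S.
    apply/funext => h.
    rewrite -[LHS]/(S (h - rc d^-1 *: T h)) -[RHS]/(S h - rc d^-1 *: T (S h)).
    by rewrite opB // opZ // -[S (T h)]/((S \o T) h) hS.
  apply/funext => h.
  rewrite -[LHS]/(S (rc q *: (h - r h))) -[RHS]/(rc q *: (S h - r (S h))).
  by rewrite opZ // opB // -[S (r h)]/((S \o r) h) cr.
Qed.

Section InVNA.
Variable M : set op.
Hypothesis hM : von_neumann_algebra M.
Let Mb := vna_bounded hM.
Let Ms := vna_subspace hM.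

Lemma vna_commP T : bounded_op T ->
  (forall S, bounded_op S -> (forall x, M x -> S \o x = x \o S) -> S \o T = T \o S) -> M T.
Proof.
move=> bT hT; rewrite -(vna_bicommutant hM); split=> // S [bS hS].
by apply/esym/hT => // x hx; apply: hS.
Qed.

Lemma vna_sqrt T : M T -> positive_op T ->
  exists y, [/\ M y, adjoint y = y, y \o y = T &
    forall S, bounded_op S -> S \o T = T \o S -> S \o y = y \o S].
Proof.
move=> hT pT; have [y [by_ sy yy cy]] := pos_sqrt (Mb hT) pT.
exists y; split=> //; apply: vna_commP => // S bS hS.
by apply: cy => //; apply: hS.
Qed.

(** A self-adjoint contraction [b] is the mean of the unitaries
    [b + i y] and [b - i y] with [y] the square root of [1 - b^2]. *)
Lemma selfadj_unitary_sum (P : set op) a : subspace P ->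
  (forall u, M u -> unitary u -> P u) -> M a -> adjoint a = a -> P a.
Proof.
move=> hP hu ha sa; have ba := Mb ha.
have [c [c0 hc]] := bnd_bound ba.
pose d := c + 1; have d0 : 0 < d by rewrite ltr_wpDl.
pose b : op := rc d^-1 *: a.
have Mb' : M b by apply: (subZ Ms).
have bb := Mb Mb'.
have sb : adjoint b = b by rewrite adjZ // conj_rc sa.
have b1 h : nh (b h) <= nh h.
  rewrite nhZ cabs_rc ger0_norm ?invr_ge0 ?(ltW d0) // ler_pdivrMl //.
  by apply: le_trans (hc h) _; rewrite ler_wpM2r ?nh_ge0 // lerDl.
have Mbb : M (b \o b) by apply: (vna_comp hM).
have Mn : M (idfun - (b \o b)) by apply: (subB Ms) => //; exact: (vna_id hM).
have pn : positive_op (idfun - (b \o b)).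
  move=> h; rewrite -[X in inner X]/(h - b (b h)) innerBl -{1}sb adjointP //.
  rewrite !(ip_nsq inner_semi) // -!nh_sq -rmorphB rc_ge0 subr_ge0.
  by rewrite ler_pXn2r ?nnegrE ?nh_ge0.
have [y [My sy yy cy]] := vna_sqrt Mn pn.
have byo := Mb My.
have cb : b \o y = y \o b.
  apply: cy => //; rewrite compBr //.
have eb h : b (y h) = y (b h) by rewrite -[LHS]/((b \o y) h) cb.
have ey h : y (y h) = h - b (b h) by rewrite -[LHS]/((y \o y) h) yy.
pose u (s : C) : op := s *: y + b.
have Mu s : M (u s) by apply: Ms.2.
have uu (s : C) : s * s = -1 -> s^* = - s -> unitary (u s).
  move=> s2 sc.
  have su : adjoint (u s) = - s *: y + b by rewrite adj_lin // sy sb sc.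
  have e t w h : t + w = 0 -> t * w = 1 -> t *: y (w *: y h + b h) + b (w *: y h + b h) = h.
    move=> tw0 tw1; rewrite (opL w (y h) (b h) byo) (opL w (y h) (b h) bb).
    rewrite scalerDr scalerA tw1 scale1r ey eb [X in _ + X]addrC addrACA subrK.
    by rewrite -scalerDl tw0 scale0r addr0.
  rewrite /unitary su; split; apply/funext => h; apply: e.
  - by rewrite addNr.
  - by rewrite mulNr s2 opprK.
  - by rewrite subrr.
  - by rewrite mulrN s2 opprK.
have P1 := hu _ (Mu ic) (uu _ ic2 conj_ic).
have P2 : P (u (- ic)).
  apply: hu => //; apply: uu; first by rewrite mulrNN ic2.
  by rewrite rmorphN /= conj_ic.
have -> : a = (rc d * 2^-1) *: (u ic + u (- ic)).
  apply/funext => h; rewrite -[RHS]/((rc d * 2^-1) *: ((ic *: y h + b h) + (- ic *: y h + b h))).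
  rewrite addrACA -scalerDl subrr scale0r add0r scale2 scalerA.
  by rewrite divfK ?pnatr_eq0 // scalerA -rmorphM mulfV ?gt_eqF // scale1r.
by apply: (subZ hP); apply: (subD hP).
Qed.

(** Stated as an induction principle: what holds on unitaries and is stable
    under linear combinations holds on the whole algebra. *)
Lemma vna_unitary_span (P : set op) : subspace P ->
  (forall u, M u -> unitary u -> P u) -> M `<=` P.
Proof.
move=> hP hu x hx; have bx := Mb hx.
have Mx := vna_adjoint hM hx; have bx' := Mb Mx.
have P1 : P (x + adjoint x).
  apply: selfadj_unitary_sum => //; first exact: (subD Ms).
  by rewrite adjD // adjK // addrC.
have P2 : P (ic *: (x - adjoint x)).
  apply: selfadj_unitary_sum => //; first by apply: (subZ Ms); apply: (subB Ms).
  rewrite adjZ; last exact: (subB bnd_subspace).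
  by rewrite conj_ic adjB // adjK // scaleNr -scalerN opprB.
have -> : x = (2^-1 : C) *: ((x + adjoint x) - ic *: (ic *: (x - adjoint x))).
  rewrite scalerA ic2 scaleN1r opprK addrACA subrr addr0 scale2 scalerA.
  by rewrite mulVf ?pnatr_eq0 // scale1r.
by apply: (subZ hP); apply: (subB hP) => //; apply: (subZ hP).
Qed.

End InVNA.
End VNA.

(** * Limits of operators along ultrafilters *)

Section UltraLimits.
Context {R : realType} {H : hilbertType R}.
Local Notation C := (cplx R).
Local Notation op := (H -> H).
Implicit Types (h k : H).

Lemma cvg_filterC_P {T : Type} (F : set_system T) {FF : Filter F} (u : T -> C) (l : C) :
  u @ F --> l <-> forall e : R, 0 < e -> F [set t | cabs (u t - l) < e].
Proof.
split=> [/cvgrPdist_lt hu e e0|hu].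
  have := hu (rc e); rewrite ltr_rc => /(_ e0); apply: filterS => t /=.
  by rewrite normE ltr_rc -cabsN opprB.
apply/cvgrPdist_lt => e e0.
have er : e = rc (re e) by apply: ge0_rc; exact: ltW.
have re0 : 0 < re e by rewrite -ltr_rc -er.
apply: filterS (hu _ re0) => t /= ht.
by rewrite er normE ltr_rc -cabsN opprB.
Qed.

Lemma ultra_cvgR {T : Type} (G : set_system T) {GU : UltraFilter G} (f : T -> R) (K : R) :
  G [set t | `|f t| <= K] -> exists l : R, forall e, 0 < e -> G [set t | `|f t - l| < e].
Proof.
move=> hG; have GF : ProperFilter G by exact: ultra_proper.
have [|l [_ hl]] := @segment_compact R (- K) K (f @ G).
  have hs : [set t | `|f t| <= K] `<=` f @^-1` `[- K, K]%classic.
    by move=> t /=; rewrite in_itv /= -ler_norml.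
  exact: filterS hs hG.
exists l => e e0.
have [//|hc] := in_ultra_setVsetC [set t | `|f t - l| < e] GU.
have [|x [hx1 hx2]] := hl (~` [set r | `|r - l| < e]) [set r | `|r - l| < e] hc.
  by apply/nbhs_ballP; exists e => // x /=; rewrite /ball /= distrC.
by case: hx1.
Qed.

Lemma ultra_cvgC {T : Type} (G : set_system T) {GU : UltraFilter G} (f : T -> C) (K : R) :
  G [set t | cabs (f t) <= K] -> exists l : C, f @ G --> l.
Proof.
move=> hG; have GF : ProperFilter G by exact: ultra_proper.
have [|a ha] := @ultra_cvgR _ G GU (re \o f) K.
  by apply: filterS hG => t /=; apply: le_trans; exact: cabs_re.
have [|b hb] := @ultra_cvgR _ G GU (fun t => re (ic * f t)) K.
  apply: filterS hG => t /=; apply: le_trans.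
  by apply: le_trans (cabs_re _) _; rewrite cabsM cabs_ic mul1r.
exists (rc a - ic * rc b); apply/cvg_filterC_P => e e0.
have e2 : 0 < e / 2 by rewrite divr_gt0.
apply: filterS2 (ha _ e2) (hb _ e2) => t /= h1 h2.
rewrite [X in X - _](reim (f t)).
have -> : rc (re (f t)) - ic * rc (re (ic * f t)) - (rc a - ic * rc b) =
  rc (re (f t) - a) - ic * rc (re (ic * f t) - b) by rewrite !rmorphB /=; ring.
apply: le_lt_trans (cabsD _ _) _; rewrite cabsN cabsM cabs_ic mul1r !cabs_rc; lra.
Qed.

Definition trunc n (g : nat -> H) : nat -> H := fun i => if (i < n)%N then g i else 0.

Lemma L2_trunc n g : L2 g -> L2 (trunc n g).
Proof.
move=> [K hK]; exists K => m; apply: le_trans (hK m); apply: ler_sum => i _.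
by rewrite /trunc; case: ifP => // _; rewrite nh0 expr0n sqr_ge0.
Qed.

Lemma ip2_trunc n f g : L2 f -> L2 g ->
  ip2 f (trunc n g) = \sum_(i < n) inner (f i) (g i).
Proof.
move=> hf hg; apply: ip2_eq; apply/cvgC_P => e e0; exists n => m hm.
rewrite /series /= big_mkord -(subnKC hm) big_split_ord /=.
rewrite [X in _ + X - _]big1; last first.
  by move=> i _; rewrite /trunc ltnNge leq_addr (ip0r inner_semi).
rewrite addr0 (eq_bigr (fun i : 'I_n => inner (f i) (g i))); last first.
  by move=> i _; rewrite /trunc ltn_ord.
by rewrite subrr cabs0.
Qed.

Lemma trunc_approx g (e : R) : L2 g -> 0 < e -> exists n, nsq ip2 (g - trunc n g) < e.
Proof.
move=> hg e0; have e2 : 0 < e / 2 by rewrite divr_gt0.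
have /cvgrPdist_lt /(_ _ e2) [n _ hn] := nsq2_cvg hg.
exists n; apply: (@le_lt_trans _ _ (e / 2)); last lra.
apply: nsq2_le => m.
have h1 := nsq2_ge (n + m) hg; rewrite big_split_ord /= in h1.
have h2 := hn n (leqnn n); rewrite /= ger0_norm ?subr_ge0 ?nsq2_ge // in h2.
have h3 : \sum_(i < m) nh ((g - trunc n g) i) ^+ 2 <=
   \sum_(i < m) nh (g (n + i)%N) ^+ 2.
  apply: (@le_trans _ _ (\sum_(i < n + m) nh ((g - trunc n g) i) ^+ 2)).
    by rewrite addnC big_split_ord /= lerDl; apply: sumr_ge0 => i _; exact: sqr_ge0.
  rewrite big_split_ord /= big1 ?add0r.
    apply: ler_sum => i _; rewrite -[(g - trunc n g) _]/(g (n + i)%N - trunc n g (n + i)%N).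
    by rewrite /trunc ltnNge leq_addr subr0.
  move=> i _; rewrite -[(g - trunc n g) _]/(g i - trunc n g i).
  by rewrite /trunc ltn_ord subrr nh0 expr0n.
lra.
Qed.

(** Weak-* compactness of bounded sets of operators: the limits of the matrix
    coefficients form a bounded sesquilinear form, hence an operator, and the
    uniform bound extends convergence from vectors to square summable
    sequences. *)
Lemma ultra_limit (G : set_system op) {GU : UltraFilter G} (c : R) :
  0 <= c -> G [set z | linear z /\ op_bound z c] ->
  exists Z : op, [/\ bounded_op Z, op_bound Z c &
    forall f g : nat -> H, L2 f -> L2 g -> (fun z : op => ip2 (z \o f) g) @ G --> ip2 (Z \o f) g].
Proof.
move=> c0 hG; have GF : ProperFilter G by exact: ultra_proper.
have /choice [B0 hB0] : forall p : H * H, exists l : C, (fun z : op => inner (z p.1) p.2) @ G --> l.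
  move=> [h k]; apply: (@ultra_cvgC _ G GU _ (c * nh h * nh k)).
  apply: filterS hG => z [lz [_ hz]] /=; apply: le_trans (inner_le _ _) _.
  by apply: ler_wpM2r (hz h); exact: nh_ge0.
pose B h k := B0 (h, k).
have hB h k : (fun z : op => inner (z h) k) @ G --> B h k := hB0 (h, k).
have uniq (u : op -> C) (l l' : C) : u @ G --> l -> u @ G --> l' -> l = l'.
  move=> h1 h2; rewrite -(cvg_lim (@norm_hausdorff _ _) h1).
  by rewrite -(cvg_lim (@norm_hausdorff _ _) h2).
have bnd (u : op -> C) (l : C) K : u @ G --> l -> G [set z | cabs (u z) <= K] -> cabs l <= K.
  move=> /cvg_filterC_P hu hK; apply/ler_addgt0Pr => e e0.
  have [z [/= h1 h2]] := filter_ex (filterI hK (hu e e0)).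
  have -> : l = u z - (u z - l) by rewrite opprB addrC subrK.
  by apply: le_trans (cabsD _ _) _; rewrite cabsN; apply: lerD => //; exact: ltW.
have Bbound h k : cabs (B h k) <= c * nh h * nh k.
  apply: bnd (hB h k) _.
  apply: filterS hG => z [lz [_ hz]] /=; apply: le_trans (inner_le _ _) _.
  by apply: ler_wpM2r (hz h); exact: nh_ge0.
have [|||Z [lZ bZ hZ]] := @bounded_form_op _ _ B c c0.
- move=> a h k l; apply: uniq (hB _ _) _; apply/cvg_filterC_P => e e0.
  have /cvg_filterC_P/(_ _ e0) : (fun z : op => a * inner (z h) l + inner (z k) l) @ G -->
      a * B h l + B k l.
    by apply: cvgD; [apply: cvgMr|]; apply: hB.
  move=> hc; apply: filterS2 hG hc => z [lz _] /=.
  have bz : z (a *: h + k) = a *: z h + z k by apply: lz.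
  by rewrite bz innerDl innerZl.
- move=> a h k l; apply: uniq (hB _ _) _.
  under eq_cvg do rewrite innerDr innerZr.
  by apply: cvgD; [apply: cvgMr|]; apply: hB.
- exact: Bbound.
have bbZ : bounded_op Z by apply/bounded_opP; split=> //; exists c.
exists Z; split=> // f g hf hg; apply/cvg_filterC_P => e e0.
have n1 : 0 < c * nm ip2 f + 1 by rewrite ltr_wpDl ?mulr_ge0 ?nm_ge0.
have d1 : 0 < e / 4 / (c * nm ip2 f + 1) by rewrite divr_gt0 // divr_gt0.
have [n hn] := trunc_approx hg (exprn_gt0 2 d1).
have Lt := L2_trunc n hg; have Lr : L2 (g - trunc n g) by apply: (subB L2_subspace).
have tail z : linear z -> op_bound z c -> cabs (ip2 (z \o f) (g - trunc n g)) <= e / 4.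
  move=> lz bz; have Lz := L2_op bz hf.
  apply: le_trans (cauchy_schwarz_nm ip2_semi Lz Lr) _.
  have h1 : nm ip2 (z \o f) <= c * nm ip2 f.
    rewrite -(@ler_pXn2r _ 2) ?nnegrE ?mulr_ge0 ?nm_ge0 // exprMn !(nm_sq ip2_semi) //.
    exact: nsq2_op.
  have /ltW h2 := nm_lt ip2_semi Lr d1 hn.
  apply: le_trans (ler_pM (nm_ge0 _ _) (nm_ge0 _ _) h1 h2) _.
  rewrite mulrA ler_pdivrMr // [leLHS]mulrC ler_wpM2l ?lerDl //.
  by rewrite ltW // divr_gt0.
have split z : linear z -> op_bound z c ->
    ip2 (z \o f) g = ip2 (z \o f) (trunc n g) + ip2 (z \o f) (g - trunc n g).
  move=> lz bz; rewrite -(ipDr ip2_semi) //; first by rewrite addrC subrK.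
  exact: L2_op bz hf.
have fin : (fun z : op => \sum_(i < n) inner (z (f i)) (g i)) @ G -->
    \sum_(i < n) inner (Z (f i)) (g i).
  clear -hB hZ GF; elim: n => [|n ihn].
    by rewrite big_ord0; under eq_cvg do rewrite big_ord0; exact: cvg_cst.
  rewrite big_ord_recr /=; under eq_cvg do rewrite big_ord_recr /=.
  have hn : (fun z : op => inner (z (f n)) (g n)) @ G --> inner (Z (f n)) (g n).
    by rewrite hZ; apply: hB.
  exact: (cvgD ihn hn).
have e4 : 0 < e / 4 by rewrite divr_gt0.
move/cvg_filterC_P : fin => /(_ _ e4) fin; apply: filterS2 hG fin => z [lz bz] /= hz.
rewrite (split z) // (split Z) // !ip2_trunc //; last first.
- exact: L2_op bz hf.
- exact: L2_op bZ hf.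
have t1 := tail z lz bz; have t2 := tail Z lZ bZ.
rewrite opprD addrACA; apply: le_lt_trans (cabsD _ _) _.
have := cabsD (ip2 (z \o f) (g - trunc n g)) (- ip2 (Z \o f) (g - trunc n g)).
rewrite cabsN /= in hz *; lra.
Qed.

End UltraLimits.

(** * The forms defined by a conditional expectation, and Bures closures *)

Section Expectation.
Context {R : realType} {H : hilbertType R}.
Local Notation C := (cplx R).
Local Notation op := (H -> H).
Implicit Types (x y z n u v : op) (h k : H) (rho phi : op -> C) (S A : set op).

Variables (M N : set op) (E : op -> op).
Hypothesis hM : von_neumann_algebra M.
Hypothesis hN : von_neumann_algebra N.
Hypothesis NM : N `<=` M.
Hypothesis hE : faithful_normal_ce M N E.
Let Mb := vna_bounded hM.
Let Ms := vna_subspace hM.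
Let Nb := vna_bounded hN.
Let Ns := vna_subspace hN.
Let ce : conditional_expectation M N E. Proof. by case: hE. Qed.

(** The square of the Bures seminorm of [x] given by [rho] is
    [wip rho x x]. *)
Definition wip rho x y : C := rho (E (adjoint y \o x)).

Lemma M_adjcomp x y : M x -> M y -> M (adjoint y \o x).
Proof. by move=> hx hy; apply: (vna_comp hM) => //; apply: (vna_adjoint hM). Qed.

(** Positivity of [rho] is a condition on the elements [x^* x] of [N]; square
    roots extend it to all positive operators of [N]. *)
Lemma pd_pos_ge0 rho n : predual_pos N rho -> N n -> positive_op n -> 0 <= rho n.
Proof.
move=> [_ hp] hn pn; have [y [Ny sy yy _]] := vna_sqrt hN hn pn.
by have := hp y Ny; rewrite sy yy.
Qed.

Lemma wip_semi rho : predual_pos N rho -> semi_inner M (wip rho).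
Proof.
move=> hp; have [hr _] := hp.
have lin a x y z : M x -> M y -> M z ->
    wip rho (a *: x + y) z = a * wip rho x z + wip rho y z.
  move=> hx hy hz; rewrite /wip (comp_linr _ _ _ (bnd_adj (Mb hz))).
  rewrite (ce_linear ce); try exact: M_adjcomp.
  by rewrite (pd_lin hN) //; apply: (ce_range ce); exact: M_adjcomp.
have pos x : M x -> 0 <= wip rho x x.
  move=> hx; have Mxx := M_adjcomp hx hx.
  exact: (pd_pos_ge0 hp (ce_range ce Mxx) (ce_positive ce hx)).
apply: semi_inner_of_positive => // a x y z hx hy hz.
rewrite /wip adj_lin; try exact: Mb.
have -> : (a^* *: adjoint x + adjoint y) \o z = a^* *: (adjoint x \o z) + (adjoint y \o z) by [].
rewrite (ce_linear ce); try exact: M_adjcomp.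
by rewrite (pd_lin hN) //; apply: (ce_range ce); exact: M_adjcomp.
Qed.

(** If [rho \o E] is [z |-> <z f, g>], then [rho (E (x^* x)) = <x f, x g>],
    which is at most the square norm of [x (f + g)].  So the Bures topology is
    weaker than the topology of the seminorms [x |-> |x f|], for which [mazur]
    controls the closures of subspaces. *)
Lemma wip_dominated rho : predual_pos N rho ->
  exists2 f : nat -> H, L2 f & forall x, M x -> nsq (wip rho) x <= nsq ip2 (x \o f).
Proof.
move=> [hr hp]; have [_ _ nE] := hE.
have /(predualP _ Mb)[f [g [hf hg e]]] := nE _ hr.
exists (f + g); first exact: (subD L2_subspace).
move=> x hx; have bx := Mb hx.
have xf := L2_bnd bx hf; have xg := L2_bnd bx hg.
have e1 : wip rho x x = ip2 (x \o f) (x \o g).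
  rewrite /wip -[LHS]/((rho \o E) (adjoint x \o x)) e; last exact: M_adjcomp.
  exact: (@ip2_adj _ _ x (x \o f) g bx).
rewrite /nsq e1.
have -> : x \o (f + g) = (x \o f) + (x \o g).
  by apply/funext => n; apply: (opD (f n) (g n) bx).
rewrite -/(nsq ip2 _).
have h1 := parallelogram ip2_semi xf xg; have h2 := nsqD ip2_semi xf xg.
have h3 := nsq_ge0 ip2_semi (subB L2_subspace xf xg).
have h4 := nsq_ge0 ip2_semi (subD L2_subspace xf xg).
lra.
Qed.

Lemma predual_pos_add rho rho' : predual_pos N rho -> predual_pos N rho' ->
  predual_pos N (fun x => rho x + rho' x).
Proof.
move=> [h1 h2] [h3 h4]; split; first exact: (pd_add hN).
by move=> x hx; rewrite addr_ge0 ?h2 ?h4.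
Qed.

Lemma sqrtC_rc (r : R) : 0 <= r -> sqrtC (rc r) = rc (Num.sqrt r).
Proof.
move=> r0; rewrite -{1}(sqr_sqrtr r0) rmorphXn /= sqrCK // rc_ge0; exact: sqrtr_ge0.
Qed.

Lemma bures_seminormE rho x : predual_pos N rho -> M x ->
  sqrtC (rho (E (adjoint x \o x))) = rc (nm (wip rho) x).
Proof.
move=> hp hx; have si := wip_semi hp.
by rewrite -/(wip rho x x) (ip_nsq si) // sqrtC_rc //; exact: nsq_ge0 si _ _.
Qed.

(** Finitely many functionals are dominated by their sum, so that one seminorm
    at a time is enough; its square is used throughout. *)
Lemma bures_closureP A x : A `<=` M ->
  bures_closure M N E A x <-> M x /\
  forall rho, predual_pos N rho -> forall e : R, 0 < e ->
    exists2 y, A y & nsq (wip rho) (y - x) < e.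
Proof.
move=> hA; split=> [[hx hcl]|[hx hcl]]; split=> //.
  move=> rho hp e e0; have se : 0 < Num.sqrt e by rewrite sqrtr_gt0.
  have [||y [hy My] hlt] := hcl 1%N
    (fun=> fun x => sqrtC (rho (E (adjoint x \o x)))) (rc (Num.sqrt e)).
  - by move=> _; exists rho.
  - by rewrite ltr_rc.
  have Myx : M (y - x) by apply: (subB Ms).
  exists y => //; move: (hlt ord0); rewrite bures_seminormE // ltr_rc => hlt1.
  rewrite -(nm_sq (wip_semi hp)) // -(sqr_sqrtr (ltW e0)).
  by rewrite ltr_pXn2r ?nnegrE ?nm_ge0 ?sqrtr_ge0.
move=> n p e hp e0.
have er : e = rc (re e) by apply: ge0_rc; exact: ltW.
have re0 : 0 < re e by rewrite -ltr_rc -er.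
have /choice [r hr] : forall i, exists rho, predual_pos N rho /\
    p i = (fun x => sqrtC (rho (E (adjoint x \o x)))).
  by move=> i; have [rho h1 h2] := hp i; exists rho.
have [rho [hrho dom]] : exists rho, predual_pos N rho /\
    forall i : 'I_n, i \in enum 'I_n -> forall z, M z -> nsq (wip (r i)) z <= nsq (wip rho) z.
  elim: (enum 'I_n) => [|i s [rho [h1 h2]]].
    exists (fun=> 0); split=> //; split=> //.
    apply: (pd_ext hN (pd_scale hN 0 (pd_vec hN 0 0))) => z _; exact: mul0r.
  have [ri _] := hr i.
  exists (fun x => r i x + rho x); split; first exact: predual_pos_add.
  move=> j; rewrite inE => /orP[/eqP->|hj] z hz.
    rewrite /nsq {2}/wip raddfD /= lerDl; apply: (nsq_ge0 (wip_semi h1)) => //.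
  apply: le_trans (h2 _ hj z hz) _.
  by rewrite /nsq {2}/wip raddfD /= lerDr; apply: (nsq_ge0 (wip_semi ri)).
have [y hy hlt] := hcl _ hrho _ (exprn_gt0 2 re0).
have Myx : M (y - x) by apply: (subB Ms) => //; apply: hA.
exists y; first by split=> //; apply: hA.
move=> i; have [ri ->] := hr i; rewrite bures_seminormE // er ltr_rc.
apply: (nm_lt (wip_semi ri)) => //; apply: le_lt_trans hlt.
by apply: dom => //; rewrite mem_enum.
Qed.

Lemma sub_bures_closure A : A `<=` M -> A `<=` bures_closure M N E A.
Proof.
move=> hA x hx; apply/(bures_closureP _ hA); split; first exact: hA.
move=> rho hp e e0; exists x => //.
by rewrite subrr /nsq (ip0l (wip_semi hp)) //; exact: sub0 Ms.
Qed.

Lemma bures_closure_sub A : bures_closure M N E A `<=` M.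
Proof. by move=> x []. Qed.

Lemma bures_closure_mono A A' : A `<=` A' ->
  bures_closure M N E A `<=` bures_closure M N E A'.
Proof.
move=> hA x [hx hcl]; split=> // n p e hp e0.
by have [y [hy1 hy2] hlt] := hcl n p e hp e0; exists y => //; split=> //; apply: hA.
Qed.

Lemma bures_closureK A : A `<=` M ->
  bures_closure M N E (bures_closure M N E A) `<=` bures_closure M N E A.
Proof.
move=> hA x /(bures_closureP _ (@bures_closure_sub A))[hx hcl].
apply/(bures_closureP _ hA); split=> // rho hp e e0.
have e4 : 0 < e / 4 by rewrite divr_gt0.
have [y /(bures_closureP _ hA)[My hy] hlt] := hcl _ hp _ e4.
have [z hz hlt2] := hy _ hp _ e4; exists z => //.
have Mz := hA _ hz.
have -> : z - x = (z - y) + (y - x) by rewrite subrKA.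
have h1 := nsqD_le (wip_semi hp) (subB Ms Mz My) (subB Ms My hx).
lra.
Qed.

Lemma bures_closure_subspace S : subspace S -> S `<=` M ->
  subspace (bures_closure M N E S).
Proof.
move=> hS hSM; split; first exact: sub_bures_closure (sub0 hS).
move=> a x y /(bures_closureP _ hSM)[hx hcx] /(bures_closureP _ hSM)[hy hcy].
apply/(bures_closureP _ hSM); split; first exact: Ms.2.
move=> rho hp e e0; have si := wip_semi hp.
pose k := 2 * cabs a ^+ 2 + 2; have k0 : 0 < k by rewrite /k ltr_wpDl // mulr_ge0 // sqr_ge0.
have ek : 0 < e / (2 * k) by rewrite divr_gt0 // mulr_gt0.
have [x' hx' lx] := hcx _ hp _ ek; have [y' hy' ly] := hcy _ hp _ ek.
have Mx := subB Ms (hSM _ hx') hx; have My := subB Ms (hSM _ hy') hy.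
exists (a *: x' + y'); first exact: hS.2.
have -> : a *: x' + y' - (a *: x + y) = a *: (x' - x) + (y' - y).
  by rewrite opprD addrACA scalerBr.
apply: le_lt_trans (nsqD_le si (subZ Ms a Mx) My) _.
rewrite (nsqZ si) //; have n1 := nsq_ge0 si Mx.
have ca := sqr_ge0 (cabs a).
have -> : e = (2 * cabs a ^+ 2) * (e / k) + 2 * (e / k).
  by rewrite -mulrDl -/k; field; rewrite gt_eqF.
have ek2 : e / (2 * k) = (e / k) / 2 by field; rewrite gt_eqF.
rewrite ek2 in lx ly; have e3 : 0 < e / k by rewrite divr_gt0.
by nra.
Qed.

Lemma weak_star_sub_bures S : subspace S -> S `<=` M ->
  weak_star_closure M S `<=` bures_closure M N E S.
Proof.
move=> hS hSM x hx; have Mx := weak_star_closure_sub hx.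
apply/(bures_closureP _ hSM); split=> // rho hp e e0.
have [f hf dom] := wip_dominated hp.
have [y hy hlt] := mazur hM hS hSM hx hf e0.
exists y => //; have My := hSM _ hy.
rewrite -opprB (nsqN (wip_semi hp)); last exact: (subB Ms).
by apply: le_lt_trans hlt; apply: dom; apply: (subB Ms).
Qed.

(** A weak-* limit point of the Bures closure is a Bures limit point of it. *)
Lemma bures_weak_star_closed S : subspace S -> S `<=` M ->
  weak_star_closed M (bures_closure M N E S).
Proof.
move=> hS hSM; have hT := bures_closure_subspace hS hSM.
apply/seteqP; split.
  move=> x hx; apply: bures_closureK => //.
  by apply: weak_star_sub_bures hx => //; apply: bures_closure_sub.
by apply: (sub_weak_star_closure hM); apply: bures_closure_sub.
Qed.

(** Elements of [GN M D] may be multiplied by unitaries of [N] but not by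
    arbitrary elements of [N]; since unitaries span [N], this invariance is
    what makes closed spans of normalizers into bimodules. *)
Definition unitary_invariant S := forall u x, N u -> unitary u -> S x ->
  S (u \o x) /\ S (x \o u).

Lemma unitary_invariant_bimodule S : subspace S -> S `<=` M ->
  unitary_invariant S -> bimodule M N S.
Proof.
move=> hS hSM hu.
have left n x : N n -> S x -> S (n \o x).
  move=> hn hx; suff : N `<=` [set n : op | S (n \o x)] by apply.
  apply: (vna_unitary_span hN).
    split; first exact: sub0 hS.
    by move=> a n1 n2 h1 h2; rewrite /= comp_linl; apply: hS.2.
  by move=> u Nu uu; case: (hu u x Nu uu hx).
have right n x : N n -> S x -> S (x \o n).
  move=> hn hx; suff : N `<=` [set n : op | S (x \o n)] by apply.
  apply: (vna_unitary_span hN).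
    have bx := Mb (hSM _ hx).
    split; first by rewrite /= comp0r //; exact: sub0 hS.
    by move=> a n1 n2 h1 h2; rewrite /= comp_linr //; apply: hS.2.
  by move=> u Nu uu; case: (hu u x Nu uu hx).
split=> // m n b hm hn hb; exact/right/left.
Qed.

Lemma weak_star_unitary_invariant S : subspace S -> S `<=` M ->
  unitary_invariant S -> unitary_invariant (weak_star_closure M S).
Proof.
move=> hS hSM hu u x Nu uu /(weak_star_closureP hM _ hS hSM)[hx sx].
have Mu := NM Nu; have M1 := vna_id hM.
split; apply/(weak_star_closureP hM _ hS hSM); split; try exact: (vna_comp hM).
- move=> phi hphi z; apply: (sx _ (pd_mul hM hphi Mu M1)) => s hs.
  by apply: z; case: (hu u s Nu uu hs).
- move=> phi hphi z; apply: (sx _ (pd_mul hM hphi M1 Mu)) => s hs.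
  by apply: z; case: (hu u s Nu uu hs).
Qed.

Lemma bures_unitary_invariant S : subspace S -> S `<=` M ->
  unitary_invariant S -> unitary_invariant (bures_closure M N E S).
Proof.
move=> hS hSM hu u x Nu [u1 u2] /(bures_closureP _ hSM)[hx hcx].
have Mu := NM Nu; have bu := Mb Mu.
have uu : unitary u by [].
split; apply/(bures_closureP _ hSM); split; try exact: (vna_comp hM).
- move=> rho hp e e0; have [y hy hlt] := hcx _ hp _ e0.
  exists (u \o y); first by case: (hu u y Nu uu hy).
  have Mz := subB Ms (hSM _ hy) hx; have bz := Mb Mz.
  rewrite -compBr // /nsq /wip adj_comp //.
  have -> : (adjoint (y - x) \o adjoint u) \o (u \o (y - x)) =
     adjoint (y - x) \o ((adjoint u \o u) \o (y - x)) by [].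
  by rewrite u1.
- move=> rho [hp1 hp2] e e0.
  pose rhou := fun n => rho (adjoint u \o n \o u).
  have Nua : N (adjoint u) := vna_adjoint hN Nu.
  have hpu : predual_pos N rhou.
    split; first exact: (pd_mul hN).
    move=> z hz; have := hp2 (z \o u) (vna_comp hN hz Nu).
    by rewrite adj_comp //; exact: Nb.
  have [y hy hlt] := hcx _ hpu _ e0.
  exists (y \o u); first by case: (hu u y Nu uu hy).
  have Mz := subB Ms (hSM _ hy) hx; have bz := Mb Mz.
  have -> : (y \o u) - (x \o u) = (y - x) \o u by [].
  rewrite /nsq /wip adj_comp //.
  have -> : (adjoint u \o adjoint (y - x)) \o ((y - x) \o u) =
     adjoint u \o (adjoint (y - x) \o (y - x)) \o u by [].
  by rewrite (ce_bimodule ce) //; exact: M_adjcomp.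
Qed.

End Expectation.

(** * Normalizers, and averaging over the unitaries of D *)

Section CartanBasics.
Context {R : realType} {H : hilbertType R}.
Local Notation C := (cplx R).
Local Notation op := (H -> H).
Implicit Types (x y z n u v w b : op) (h k : H) (rho phi : op -> C) (S A : set op).

Lemma sub_lin_span A : A `<=` lin_span A.
Proof.
move=> x hx; exists 1%N, (fun=> 1), (fun=> x); split=> //.
by rewrite big_ord_recl big_ord0 addr0 scale1r.
Qed.

Lemma lin_span_subspace A : subspace (lin_span A).
Proof.
split.
  by exists 0%N, (fun=> 0), (fun=> 0); split=> [[]//|]; rewrite big_ord0.
move=> a x y [n [c [v [hv ->]]]] [m [d [w [hw ->]]]].
exists (n + m)%N, (fun i => match fintype.split i with inl j => a * c j | inr j => d j end),
  (fun i => match fintype.split i with inl j => v j | inr j => w j end); split.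
  by move=> i; case: (fintype.split i).
rewrite big_split_ord scaler_sumr; congr (_ + _); apply: eq_bigr => i _.
  by rewrite (unsplitK (inl i : 'I_n + 'I_m)) scalerA.
by rewrite (unsplitK (inr i : 'I_n + 'I_m)).
Qed.

Lemma lin_span_min A S : subspace S -> A `<=` S -> lin_span A `<=` S.
Proof.
move=> hS hA x [n [c [v [hv ->]]]]; apply: (sub_sum hS) => i _.
by apply: (subZ hS); apply: hA.
Qed.

Variables (M N D : set op) (E : op -> op).
Hypothesis hT : cartan_triple M N D.
Hypothesis hE : faithful_normal_ce M N E.
Let hM : von_neumann_algebra M := ct_vnaM hT.
Let hN : von_neumann_algebra N. Proof. by case: (ct_vnaN hT). Qed.
Let NM : N `<=` M. Proof. by case: (ct_vnaN hT). Qed.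
Let hD : von_neumann_algebra D. Proof. by case: (ct_vnaD hT). Qed.
Let DM : D `<=` M. Proof. by case: (ct_vnaD hT). Qed.
Let Mb := vna_bounded hM.
Let Ms := vna_subspace hM.
Let Nb := vna_bounded hN.
Let Ns := vna_subspace hN.
Let Db := vna_bounded hD.
Let ce : conditional_expectation M N E. Proof. by case: hE. Qed.

Lemma N_commutes_D n d : N n -> D d -> n \o d = d \o n.
Proof. by rewrite (ct_commutant hT) => -[_ [_ h]] hd; exact: h. Qed.
Lemma N_commutes_Dh n d h : N n -> D d -> n (d h) = d (n h).
Proof. by move=> hn hd; rewrite -[LHS]/((n \o d) h) N_commutes_D. Qed.
Lemma N_of_commuting n : M n -> (forall d, D d -> n \o d = d \o n) -> N n.
Proof.
move=> hn hc; rewrite (ct_commutant hT); split=> //; split; first exact: Mb.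
exact: hc.
Qed.
Lemma D_sub_N : D `<=` N.
Proof.
move=> d hd; apply: N_of_commuting; first exact: DM.
by move=> d' hd'; apply: (ct_abelian hT).
Qed.

Section Normalizer.
Variable v : op.
Hypothesis hv : GN M D v.
Lemma GN_M : M v. Proof. by case: hv. Qed.
Let bv : bounded_op v := Mb GN_M.
Lemma GN_initial : D (adjoint v \o v).
Proof. by case: hv => _ _ /(_ idfun (vna_id hD))[]. Qed.
Lemma GN_final : D (v \o adjoint v).
Proof. by case: hv => _ _ /(_ idfun (vna_id hD))[]. Qed.
Lemma GN_conjl l : D l -> D (adjoint v \o l \o v).
Proof. by case: hv => _ _ hl /hl[]. Qed.
Lemma GN_conjr l : D l -> D (v \o l \o adjoint v).
Proof. by case: hv => _ _ hl /hl[]. Qed.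
Lemma GN_vvv : v \o (adjoint v \o v) = v.
Proof.
case: hv => _ [pp _] _; apply/funext => h.
have e k : adjoint v (v (adjoint v (v k))) = adjoint v (v k).
  by rewrite -[LHS]/(((adjoint v \o v) \o (adjoint v \o v)) k) pp.
pose a := adjoint v (v h) - h.
have ea : adjoint v (v a) = 0.
  by rewrite /a (opB _ _ bv) (opB _ _ (bnd_adj bv)) e subrr.
rewrite -[LHS]/(v (adjoint v (v h))); apply/eqP; rewrite -subr_eq0 -(opB _ _ bv) -/a.
apply/eqP/nh_eq0/eqP; rewrite -sqrf_eq0 nh_sq /nsq -adjointPr // ea.
by rewrite (ip0r inner_semi).
Qed.
Lemma GN_vvvh h : v (adjoint v (v h)) = v h.
Proof. by rewrite -[LHS]/((v \o (adjoint v \o v)) h) GN_vvv. Qed.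
Lemma GN_vvvah h : adjoint v (v (adjoint v h)) = adjoint v h.
Proof.
apply: inner_injl => k.
by rewrite adjointP // -[LHS]adjointPr // !adjointP // GN_vvvh.
Qed.

(** For [d] in [D], [d v = v (v^* d v)] and [v^* d v] is in [D], so that [d]
    can be moved across [m]. *)
Lemma GN_conj_N m : N m -> N (v \o m \o adjoint v).
Proof.
move=> hm; apply: N_of_commuting.
  apply: (vna_comp hM); last exact: (vna_adjoint hM GN_M).
  by apply: (vna_comp hM); [exact: GN_M | exact: NM].
move=> d hd; apply/funext => h /=.
have hvv := GN_final; have hvdv := GN_conjl hd.
have c1 k : d (v (adjoint v k)) = v (adjoint v (d k)).
  by rewrite -[LHS]/((d \o (v \o adjoint v)) k) (ct_abelian hT).
have c2 k : m (adjoint v (d (v k))) = adjoint v (d (v (m k))).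
  exact: (N_commutes_Dh k hm hvdv).
by rewrite -[in RHS]GN_vvvh c1 -c2 c1 GN_vvvah.
Qed.
End Normalizer.

(** Unitaries of [N] commute with [D], so they cancel in [u^* d u]. *)
Lemma GN_mul_unitary v u : GN M D v -> N u -> unitary u ->
  GN M D (u \o v) /\ GN M D (v \o u).
Proof.
move=> hv Nu [u1 u2]; have Mv := GN_M hv; have Mu := NM Nu.
have bv := Mb Mv; have bu := Mb Mu.
have [_ pv _] := hv.
have u1h h : adjoint u (u h) = h by rewrite -[LHS]/((adjoint u \o u) h) u1.
have u2h h : u (adjoint u h) = h by rewrite -[LHS]/((u \o adjoint u) h) u2.
have Nua := vna_adjoint hN Nu.
have cl d h : D d -> adjoint u (d (u h)) = d h.
  by move=> hd; rewrite -(N_commutes_Dh _ Nu hd) u1h.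
have cr d h : D d -> u (d (adjoint u h)) = d h.
  by move=> hd; rewrite (N_commutes_Dh _ Nu hd) u2h.
split; split; try exact: (vna_comp hM).
- rewrite /partial_isometry adj_comp //.
  suff -> : (adjoint v \o adjoint u) \o (u \o v) = adjoint v \o v by [].
  by apply/funext => h /=; rewrite u1h.
- move=> l hl; rewrite adj_comp //; split.
    suff -> : (adjoint v \o adjoint u) \o l \o (u \o v) = adjoint v \o l \o v.
      exact: GN_conjl.
    by apply/funext => h /=; rewrite cl.
  suff -> : (u \o v) \o l \o (adjoint v \o adjoint u) = v \o l \o adjoint v.
    exact: GN_conjr.
  by apply/funext => h; apply: (cr _ h (GN_conjr hv hl)).
- rewrite /partial_isometry adj_comp //.
  suff -> : (adjoint u \o adjoint v) \o (v \o u) = adjoint v \o v by [].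
  by apply/funext => h; apply: (cl _ h (GN_initial hv)).
- move=> l hl; rewrite adj_comp //; split.
    suff -> : (adjoint u \o adjoint v) \o l \o (v \o u) = adjoint v \o l \o v.
      exact: GN_conjl.
    by apply/funext => h; apply: (cl _ h (GN_conjl hv hl)).
  suff -> : (v \o u) \o l \o (adjoint u \o adjoint v) = v \o l \o adjoint v.
    exact: GN_conjr.
  by apply/funext => h /=; rewrite cr.
Qed.

Lemma unitary_bound u : bounded_op u -> unitary u -> op_bound u 1 /\ op_bound (adjoint u) 1.
Proof.
move=> bu [u1 u2].
have ub : op_bound u 1.
  split=> // h; rewrite mul1r -(@ler_pXn2r _ 2) ?nnegrE ?nh_ge0 // !nh_sq /nsq.
  by rewrite -adjointP // -[adjoint u (u h)]/((adjoint u \o u) h) u1.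
by split=> //; apply: op_bound_adj.
Qed.

Variable B : set op.
Hypothesis hB : weak_star_closed_bimodule M N B.
Let BM : B `<=` M. Proof. by case: hB => -[]. Qed.
Let Bs : subspace B. Proof. by case: hB => -[]. Qed.
Let Bact m n b : N m -> N n -> B b -> B (m \o b \o n).
Proof. by case: hB => -[_ _ h] _; apply: h. Qed.

Section Averaging.
Variables (u : op).
Hypotheses (Du : D u) (uu : unitary u).
Definition conjop z := u \o z \o adjoint u.

Definition average m z := rc m.+1%:R^-1 *: \sum_(i < m.+1) iter i conjop z.

(** Convexity of a set of operators is expressed by a family [P t] of its
    dilates by [t >= 0], additive in [t].  Then partial sums of the average lie
    in [P m.+1], and no convex combination needs to be handled. *)
Lemma average_cone (P : R -> op -> Prop) m z :
  (forall s t x y, P s x -> P t y -> P (s + t) (x + y)) ->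
  (forall s r x, 0 <= r -> P s x -> P (r * s) (rc r *: x)) ->
  (forall s x, P s x -> P s (conjop x)) ->
  P 1 z -> P 1 (average m z).
Proof.
move=> hD' hZ hC h1.
have it i : P 1 (iter i conjop z) by elim: i => //= i ih; apply: hC.
have : P m.+1%:R (\sum_(i < m.+1) iter i conjop z).
  elim: m => [|m ih]; first by rewrite big_ord1; apply: it.
  have -> : m.+2%:R = m.+1%:R + 1 :> R by rewrite -[m.+2]addn1 natrD.
  by rewrite big_ord_recr; apply: hD'; [exact: ih | exact: it].
have m0 : 0 <= m.+1%:R^-1 :> R by rewrite invr_ge0.
by move=> /(hZ _ _ _ m0); rewrite mulVf // pnatr_eq0.
Qed.

Lemma conjop_lin a x y : conjop (a *: x + y) = a *: conjop x + conjop y.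
Proof.
apply/funext => h; exact: (opL a (x (adjoint u h)) (y (adjoint u h)) (Db Du)).
Qed.

(** The commutator of [u] with the average telescopes. *)
Lemma average_commutes m z (c : R) : M z -> op_bound z c ->
  op_bound ((u \o average m z) - (average m z \o u)) (m.+1%:R^-1 * (c + c)).
Proof.
move=> hz hc; have [ub uab] := unitary_bound (Db Du) uu.
have it i : op_bound (iter i conjop z) c.
  elim: i => //= i ih.
  by have := op_bound_comp (op_bound_comp ub ih) uab; rewrite mul1r mulr1.
have [u1 u2] := uu.
have e : (u \o average m z) - (average m z \o u) =
   (rc m.+1%:R^-1 *: (iter m.+1 conjop z - z)) \o u.
  have e1 : u \o average m z = conjop (average m z) \o u.
    apply/funext => h; rewrite /conjop /=.
    by rewrite -[adjoint u (u h)]/((adjoint u \o u) h) u1.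
  have cD x y : conjop (x + y) = conjop x + conjop y.
    by have := conjop_lin 1 x y; rewrite !scale1r.
  have c0 : conjop 0 = 0.
    by apply/funext => h; rewrite /conjop /= op0 //; exact: Db.
  have cZ a x : conjop (a *: x) = a *: conjop x.
    by have := conjop_lin a x 0; rewrite c0 !addr0.
  have cS j : conjop (\sum_(i < j) iter i conjop z) = \sum_(i < j) iter i.+1 conjop z.
    by elim: j => [|j ih]; rewrite ?big_ord0 ?c0 // !big_ord_recr /= cD ih.
  have e2 : conjop (average m z) - average m z = rc m.+1%:R^-1 *: (iter m.+1 conjop z - z).
    rewrite /average cZ cS -scalerBr; congr (_ *: _).
    rewrite -sumrB -(big_mkord xpredT (fun i => iter i.+1 conjop z - iter i conjop z)).
    by rewrite telescope_sumr.
  by rewrite e1 -e2.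
rewrite e; have m0 : 0 <= m.+1%:R^-1 :> R by rewrite invr_ge0.
have := op_bound_comp (op_boundZ (rc m.+1%:R^-1) (op_boundD (it m.+1) (op_boundN hc))) ub.
by rewrite cabs_rc ger0_norm // mulr1.
Qed.

End Averaging.

Section Mean.
Variables (v b : op).
Hypotheses (hv : GN M D v) (hb : B b).
Let y := adjoint v \o b.
Let Mv := GN_M hv.
Let bv : bounded_op v := Mb Mv.
Let My : M y. Proof. by apply: (vna_comp hM); [exact: (vna_adjoint hM) | exact: BM]. Qed.

(** For [t = 1], with [y = v^* b] and [c] a bound of [y], this is a convex set
    which contains [y] and is stable under conjugation by the unitaries of [D].
    Its last two conditions survive in the limit of averages, where they give
    the conclusion. *)
Definition mean_cone (c : R) (t : R) z :=
  [/\ M z, op_bound z (t * c), B (v \o z) & E z = rc t *: E y].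

Lemma mean_coneD c s t x z : mean_cone c s x -> mean_cone c t z ->
  mean_cone c (s + t) (x + z).
Proof.
move=> [h1 h2 h3 h4] [k1 k2 k3 k4]; split.
- exact: (subD Ms).
- by rewrite mulrDl; apply: op_boundD.
- by rewrite compDr //; apply: (subD Bs).
- by rewrite -{1}[x]scale1r (ce_linear ce) // scale1r h4 k4 rmorphD scalerDl.
Qed.
Lemma mean_coneZ c s r x : 0 <= r -> mean_cone c s x -> mean_cone c (r * s) (rc r *: x).
Proof.
move=> r0 [h1 h2 h3 h4]; have E0 : E 0 = 0.
  by apply: (ce_id ce); exact: sub0 Ns.
split.
- exact: (subZ Ms).
- by have := op_boundZ (rc r) h2; rewrite cabs_rc ger0_norm // mulrA.
- by rewrite compZr //; apply: (subZ Bs).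
- rewrite -[_ *: x]addr0 (ce_linear ce) //; last exact: sub0 Ms.
  by rewrite E0 addr0 h4 scalerA -rmorphM.
Qed.
Lemma mean_cone_conj c s u x : D u -> unitary u ->
  mean_cone c s x -> mean_cone c s (conjop u x).
Proof.
move=> Du uu [h1 h2 h3 h4]; have [ub uab] := unitary_bound (Db Du) uu.
have Nu := D_sub_N Du; have Nua := vna_adjoint hN Nu.
split.
- by apply: (vna_comp hM); [apply: (vna_comp hM) => //|]; apply: NM.
- by have := op_bound_comp (op_bound_comp ub h2) uab; rewrite mul1r mulr1.
- have -> : v \o conjop u x = (v \o u \o adjoint v) \o (v \o x) \o adjoint u.
    apply/funext => h; rewrite /conjop /=.
    have e k : u (adjoint v (v k)) = adjoint v (v (u k)).
      exact: (N_commutes_Dh k Nu (GN_initial hv)).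
    by rewrite e GN_vvvh.
  by apply: Bact => //; apply: D_sub_N; apply: GN_conjr.
- rewrite (ce_bimodule ce) // h4; apply/funext => h.
  rewrite -[LHS]/(u ((rc s *: E y) (adjoint u h))) -[(rc s *: E y) _]/(rc s *: E y (adjoint u h)).
  rewrite opZ; last exact: Db.
  rewrite -(N_commutes_Dh _ (ce_range ce My) Du).
  by case: uu => _ u2; rewrite -[u (adjoint u h)]/((u \o adjoint u) h) u2.
Qed.

Definition comm_cone (e : R) w (t : R) z :=
  [/\ M z & op_bound ((w \o z) - (z \o w)) (t * e)].

Lemma comm_coneD e w s t x z : D w -> comm_cone e w s x -> comm_cone e w t z ->
  comm_cone e w (s + t) (x + z).
Proof.
move=> Dw [h1 h2] [k1 k2]; split; first exact: (subD Ms).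
have -> : (w \o (x + z)) - ((x + z) \o w) =
  ((w \o x) - (x \o w)) + ((w \o z) - (z \o w)).
  rewrite compDr; last exact: Db.
  by rewrite -[(x + z) \o w]/((x \o w) + (z \o w)) opprD addrACA.
by rewrite mulrDl; apply: op_boundD.
Qed.
Lemma comm_coneZ e w s r x : D w -> 0 <= r -> comm_cone e w s x ->
  comm_cone e w (r * s) (rc r *: x).
Proof.
move=> Dw r0 [h1 h2]; split; first exact: (subZ Ms).
have -> : (w \o (rc r *: x)) - ((rc r *: x) \o w) = rc r *: ((w \o x) - (x \o w)).
  rewrite compZr; last exact: Db.
  by rewrite -[(rc r *: x) \o w]/(rc r *: (x \o w)) scalerBr.
by have := op_boundZ (rc r) h2; rewrite cabs_rc ger0_norm // mulrA.
Qed.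
Lemma comm_cone_conj e w s u x : D w -> D u -> unitary u -> comm_cone e w s x ->
  comm_cone e w s (conjop u x).
Proof.
move=> Dw Du uu [h1 h2]; have [ub uab] := unitary_bound (Db Du) uu.
have Nu := D_sub_N Du; have Nua := vna_adjoint hN Nu; have Nw := D_sub_N Dw.
split.
  by apply: (vna_comp hM); [apply: (vna_comp hM) => //|]; apply: NM.
have -> : (w \o conjop u x) - (conjop u x \o w) = u \o ((w \o x) - (x \o w)) \o adjoint u.
  apply/funext => h.
  rewrite -[LHS]/(w (u (x (adjoint u h))) - u (x (adjoint u (w h)))).
  rewrite -[RHS]/(u (w (x (adjoint u h)) - x (w (adjoint u h)))).
  rewrite opB; last exact: Db.
  by rewrite (N_commutes_Dh _ Nw Du) (N_commutes_Dh _ Nua Dw).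
by have := op_bound_comp (op_bound_comp ub h2) uab; rewrite mul1r mulr1.
Qed.

Let c0 := xget (0 : R) [set c | op_bound y c].
Let hc0 : op_bound y c0.
Proof.
rewrite /c0; case: xgetP => [c -> //|hn]; have [c hc] := bnd_bound (Mb My).
by case: (hn c).
Qed.
Let K := mean_cone c0 1.

Let Ky : K y.
Proof.
split=> //; first by rewrite mul1r.
  have -> : v \o y = (v \o adjoint v) \o b \o idfun by [].
  by apply: Bact => //; [apply: D_sub_N; exact: GN_final | exact: vna_id hN].
by rewrite rmorph1 scale1r.
Qed.

(** Average successively over the unitaries in the list: as these commute, the
    later averages do not spoil the earlier estimates. *)
Lemma almost_commuting (l : seq op) (e : R) : 0 < e ->
  (forall w, w \in l -> D w /\ unitary w) ->
  exists2 z, K z & forall w, w \in l -> op_bound ((w \o z) - (z \o w)) e.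
Proof.
move=> e0; elim: l => [|u l ih] hl; first by exists y.
have [|z Kz hz] := ih; first by move=> w hw; apply: hl; rewrite inE hw orbT.
have [|Du uu] := hl u; first by rewrite inE eqxx.
have [c00 _] := hc0.
have c1 : 0 < e / (c0 + c0 + 1) by rewrite divr_gt0 // ltr_wpDl // addr_ge0.
have [m hm] := exists_invn_lt c1.
exists (average u m z).
  apply: average_cone => //.
  - by move=> s t x1 x2; apply: mean_coneD.
  - by move=> s r x; apply: mean_coneZ.
  - by move=> s x; apply: mean_cone_conj.
have [Mz bz _ _] := Kz; rewrite mul1r in bz.
move=> w; rewrite inE => /orP[/eqP->|hw].
  have [h1 h2] := average_commutes Du uu m Mz bz; split; first exact: ltW.
  move=> h; apply: le_trans (h2 h) _; apply: ler_wpM2r; first exact: nh_ge0.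
  have := hm m (leqnn m); rewrite ltr_pdivlMr; last by rewrite ltr_wpDl // addr_ge0.
  move=> hlt; apply/ltW/le_lt_trans/hlt; rewrite ler_wpM2l ?invr_ge0 //; lra.
have hw' : w \in u :: l by rewrite inE hw orbT.
have [Dw _] := hl w hw'.
have cc : comm_cone e w 1 (average u m z).
  apply: average_cone => //.
  - by move=> s t x1 x2; apply: comm_coneD.
  - by move=> s r x; apply: comm_coneZ.
  - by move=> s x; apply: comm_cone_conj.
  - by split=> //; rewrite mul1r; apply: hz.
by case: cc => _; rewrite mul1r.
Qed.

Let almost_commutant (l : seq op) (e : R) :=
  [set z | K z /\ forall w, w \in l -> op_bound ((w \o z) - (z \o w)) e].
Let F : set_system op := [set A | exists l (e : R),
  [/\ 0 < e, forall w, w \in l -> D w /\ unitary w & almost_commutant l e `<=` A]].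

Lemma almost_commuting_filter : ProperFilter F.
Proof.
split; last split.
- by move=> [l [e [e0 hl /(_ _)h]]]; have [z Kz hz] := almost_commuting e0 hl; apply: (h z).
- by exists [::], 1; split.
- move=> A A' [l [e [e0 hl hA]]] [l' [e' [e0' hl' hA']]].
  exists (l ++ l'), (Num.min e e'); split.
  + by rewrite lt_min e0 e0'.
  + by move=> w; rewrite mem_cat => /orP[/hl|/hl'].
  + have weaken (s t : R) x : 0 <= t -> s <= t -> op_bound x s -> op_bound x t.
      move=> t0 st [_ hs]; split=> // h; apply: le_trans (hs h) _.
      by rewrite ler_wpM2r ?nh_ge0.
    move=> z [Kz hz]; split.
      apply: hA; split=> // w hw; apply: weaken (hz w _); first exact: ltW.
        by rewrite ge_min lexx.
      by rewrite mem_cat hw.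
    apply: hA'; split=> // w hw; apply: weaken (hz w _); first exact: ltW.
      by rewrite ge_min lexx orbT.
    by rewrite mem_cat hw orbT.
- move=> A A' hAA [l [e [e0 hl hA]]]; exists l, e; split=> //.
  exact: subset_trans hA hAA.
Qed.

(** An ultrafilter limit [Z] of operators in the cone that commute more and
    more with each unitary of [D] lies in [M] and commutes with [D], hence
    lies in [N].  So [Z = E Z = E y], while [v Z] is in [B] as a weak-* limit. *)
Lemma mean_in_bimodule : B (v \o E y).
Proof.
have [G [GU FG]] := ultraFilterLemma almost_commuting_filter.
have GF : ProperFilter G by exact: ultra_proper.
have GK : G K by apply: FG; exists [::], 1; split=> // z [].
have Glin : G [set z | linear z /\ op_bound z c0].
  apply: filterS GK => z [Mz bz _ _]; rewrite mul1r in bz.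
  by split=> //; apply: bnd_lin; apply: Mb.
have [c00 _] := hc0.
have [Z [bZ _ hZ]] := ultra_limit c00 Glin.
have lim_eq (u1 u2 : op -> C) (l1 l2 : C) : u1 @ G --> l1 -> u2 @ G --> l2 ->
    (forall e : R, 0 < e -> G [set z | cabs (u1 z - u2 z) < e]) -> l1 = l2.
  move=> h1 h2 h12.
  have h3 : (fun z => u1 z - u2 z) @ G --> l1 - l2 := cvgB h1 h2.
  have h4 : (fun z => u1 z - u2 z) @ G --> (0 : C).
    by apply/cvg_filterC_P => e e0; apply: filterS (h12 e e0) => z /=; rewrite subr0.
  apply/eqP; rewrite -subr_eq0; apply/eqP.
  rewrite -(cvg_lim (@norm_hausdorff _ _) (h3 _)).
  by rewrite -(cvg_lim (@norm_hausdorff _ _) h4).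
have ip2r f k : ip2 f (single k) = inner (f 0%N) k.
  apply: ip2_eq; apply/cvgC_P => e e0; exists 1%N => -[//|i] _.
  rewrite /series /= big_mkord big_ord_recl big1 ?addr0 ?subrr ?cabs0 // => j _.
  exact: (ip0r inner_semi).
have hZ1 h k : (fun z : op => inner (z h) k) @ G --> inner (Z h) k.
  have := hZ _ _ (L2_single h) (L2_single k).
  rewrite (ip2r (Z \o single h)).
  by under eq_cvg do rewrite ip2r.
have MZ : M Z.
  apply: (vna_commP hM) => // S bS hS; apply/funext => h; apply: inner_injl => k.
  rewrite -[LHS]/(inner (S (Z h)) k) -[RHS]/(inner (Z (S h)) k) -[LHS]adjointPr //.
  apply: lim_eq (hZ1 _ _) (hZ1 _ _) _ => e e0; apply: filterS GK => z [Mz _ _ _] /=.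
  by rewrite adjointPr // -[S (z h)]/((S \o z) h) hS // subrr cabs0.
have cZ w : D w -> unitary w -> Z \o w = w \o Z.
  move=> Dw uw; have bw := Db Dw.
  apply/funext => h; apply: inner_injl => k.
  rewrite -[LHS]/(inner (Z (w h)) k) -[RHS]/(inner (w (Z h)) k) -[RHS]adjointPr //.
  apply: lim_eq (hZ1 _ _) (hZ1 _ _) _ => e e0.
  have p0 : 0 < nh h * nh k + 1 by rewrite ltr_wpDl // mulr_ge0 ?nh_ge0.
  have d0 : 0 < e / (nh h * nh k + 1) by rewrite divr_gt0.
  apply: FG; exists [:: w], (e / (nh h * nh k + 1)); split=> //.
    by move=> w'; rewrite inE => /eqP->.
  move=> z [_ /(_ w)]; rewrite inE eqxx => /(_ isT) [_ hb'] /=.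
  rewrite adjointPr // -innerBl -cabsN -[- inner _ _]mulN1r -innerZl scaleN1r opprB.
  apply: le_lt_trans (inner_le _ _) _.
  apply: le_lt_trans (_ : e / (nh h * nh k + 1) * nh h * nh k < _).
    by apply: ler_wpM2r (hb' h); exact: nh_ge0.
  rewrite -mulrA mulrAC ltr_pdivrMr // ltr_pM2l //; lra.
have NZ : N Z.
  apply: N_of_commuting => // d hd.
  suff : D `<=` [set d : op | Z \o d = d \o Z] by apply.
  apply: (vna_unitary_span hD).
    split; first by rewrite /= comp0r.
    by move=> a d1 d2 h1 h2; rewrite /= comp_linr // comp_linl h1 h2.
  by move=> w Dw uw; apply: cZ.
have EZ : E Z = E y.
  apply/funext => h; apply: inner_injl => k.
  have [_ _ nE] := hE.
  have /(predualP _ Mb)[f [g [hf hg e]]] := nE _ (pd_vec hN h k).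
  have e' z : M z -> inner (E z h) k = ip2 (z \o f) g by move=> /e <-.
  rewrite e' //; apply: lim_eq (hZ _ _ hf hg) (cvg_cst (inner (E y h) k)) _ => d d0.
  apply: filterS GK => z [Mz _ _ Ez] /=.
  by rewrite -e' // Ez rmorph1 scale1r subrr cabs0.
rewrite -EZ (ce_id ce) //.
case: hB => _ clB.
apply: (weak_star_closed_sep hM Bs BM clB); first exact: (vna_comp hM).
move=> phi hphi z0.
have /(predualP _ Mb)[f [g [hf hg e]]] := pd_mull hM hphi Mv.
rewrite e //; apply: lim_eq (hZ _ _ hf hg) (cvg_cst (0 : C)) _ => d d0.
apply: filterS GK => z [Mz _ Bz _] /=.
by rewrite -e // z0 // subrr cabs0.
Qed.

End Mean.
End CartanBasics.

(** * Two-sided ideals and their central supports *)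

Section CentralSupport.
Context {R : realType} {H : hilbertType R}.
Local Notation C := (cplx R).
Local Notation op := (H -> H).
Implicit Types (x y z n j q r T : op) (h k : H) (f g : nat -> H).

(** Orthogonal projection on a closed subspace, with the commutation property
    that puts it into von Neumann algebras. *)
Lemma kernel_projection (S : set H) : subspace S ->
  (forall h, (forall e : R, 0 < e -> exists2 s, S s & nh (h - s) < e) -> S h) ->
  exists r : op, [/\ bounded_op r, forall h, S (r h),
    forall h s, S s -> inner (h - r h) s = 0,
    forall h, S h -> r h = h &
    forall T, bounded_op T -> (forall h, S h -> S (T h)) ->
      (forall h, S h -> S (adjoint T h)) -> T \o r = r \o T].
Proof.
move=> hS hcl.
have /choice [r hr] : forall h, exists p, S p /\ forall s, S s -> inner (h - p) s = 0.
  move=> h; have [p [_ hp1 hp2]] := projection_theorem inner_semi inner_complete hS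
    (fun _ _ => I) (I : [set: H] h).
  exists p; split=> //; apply: hcl => e e0.
  have [s Ss hs] := hp1 _ (exprn_gt0 2 e0); exists s => //.
  exact: (nm_lt inner_semi).
have uniq h p : S p -> (forall s, S s -> inner (h - p) s = 0) -> r h = p.
  move=> Sp hp; have [Sr hr0] := hr h.
  have Sd : S (r h - p) by apply: (subB hS).
  apply/eqP; rewrite -subr_eq0; apply/eqP/nh_eq0/eqP; rewrite -sqrf_eq0 nh_sq /nsq.
  have e : r h - p = (h - p) - (h - r h) by rewrite opprB [RHS]addrC addrA subrK.
  by rewrite {1}e innerBl hp // hr0 // subrr.
have lin : linear r.
  move=> a h k; have [Sh h0] := hr h; have [Sk k0] := hr k.
  apply: uniq; first exact: hS.2.
  move=> s Ss; have -> : a *: h + k - (a *: r h + r k) = a *: (h - r h) + (k - r k).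
    by rewrite opprD addrACA scalerBr.
  by rewrite innerDl innerZl h0 // k0 // mulr0 addr0.
have bnd : op_bound r 1.
  split=> // h; have [Sh h0] := hr h; rewrite mul1r.
  rewrite -(@ler_pXn2r _ 2) ?nnegrE ?nh_ge0 // !nh_sq.
  have e : h = (h - r h) + r h by rewrite subrK.
  rewrite [in leRHS]e (nsqD inner_semi) // h0 // raddf0 mulr0 addr0 lerDr.
  exact: (nsq_ge0 inner_semi).
have br : bounded_op r by apply/bounded_opP; split=> //; exists 1.
exists r; split => //.
- by move=> h; case: (hr h).
- by move=> h; case: (hr h).
- by move=> h Sh; apply: uniq => // s Ss; rewrite subrr (ip0l inner_semi).
move=> T bT hT hTa; apply/funext => h; apply/esym/uniq.
  by apply: hT; case: (hr h).
move=> s Ss; rewrite -[(T \o r) h]/(T (r h)) -opB // -adjointPr //.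
by case: (hr h) => _; apply; apply: hTa.
Qed.

(** The projection [r] on the common kernel of [J] is invariant under [N] and
    under its commutant, so [q = 1 - r] is central in [N].  To approximate [q]
    by elements of [J] on [f], let [p] be the projection of [f] on the closure
    of [J f].  For [j] in [J], [j (f - p)] is orthogonal to itself because
    [j^* j] maps [f] and [p] into the closure of [J f]; hence [f - p] lies in
    the kernel of [J], and [q f = q p = p]. *)
Lemma central_support (N J : set op) : von_neumann_algebra N ->
  subspace J -> J `<=` N ->
  (forall j n, J j -> N n -> J (n \o j) /\ J (j \o n)) ->
  exists q, [/\ center N q, q \o q = q, adjoint q = q, forall j, J j -> j \o q = j &
    forall f, L2 f -> forall e : R, 0 < e ->
      exists2 j, J j & nsq ip2 ((q - j) \o f) < e].
Proof.
move=> hN hJ JN ideal.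
have Nb := vna_bounded hN.
pose S : set H := [set h | forall j, J j -> j h = 0].
have hS : subspace S.
  split; first by move=> j /JN/Nb bj; apply: op0.
  move=> a h k hh hk j Jj; rewrite opL ?hh ?hk ?scaler0 ?addr0 //.
  exact/Nb/JN.
have [|r [br Sr hr rS rT]] := kernel_projection hS.
  move=> h hcl j Jj; have bj := Nb _ (JN _ Jj); have [c [c0 hc]] := bnd_bound bj.
  apply: nh_eq0; apply/eqP; rewrite eq_le nh_ge0 andbT.
  apply/ler_addgt0Pr => e e0; rewrite add0r.
  have c1 : 0 < c + 1 by rewrite ltr_wpDl.
  have d0 : 0 < e / (c + 1) by rewrite divr_gt0.
  have [s Ss hs] := hcl _ d0.
  have -> : j h = j (h - s) by rewrite opB // (Ss j Jj) subr0.
  apply: le_trans (hc _) _; rewrite ltr_pdivlMr // in hs.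
  have := nh_ge0 (h - s); lra.
have S_N n h : N n -> S h -> S (n h).
  move=> Nn Sh j Jj; rewrite -[LHS]/((j \o n) h).
  by apply: Sh; case: (ideal j n Jj Nn).
have rN n : N n -> n \o r = r \o n.
  move=> Nn; apply: rT; first exact: Nb.
    by move=> h; apply: S_N.
  by move=> h; apply: S_N; apply: (vna_adjoint hN).
have Nr : N r.
  apply: (vna_commP hN) => // T bT hT; apply: rT => //.
    move=> h Sh j Jj; rewrite -[LHS]/((j \o T) h) -hT; last exact: JN.
    by rewrite /= Sh // op0.
  move=> h Sh j Jj; have Nj := JN _ Jj; have bj := Nb _ Nj.
  have Nja := vna_adjoint hN Nj.
  have e : adjoint T \o j = j \o adjoint T.
    have := congr1 adjoint (hT _ Nja).
    by rewrite (adj_comp bT (bnd_adj bj)) (adj_comp (bnd_adj bj) bT) (adjK bj) => ->.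
  rewrite -[LHS]/((j \o adjoint T) h) -e /= Sh // op0 //; exact: bnd_adj.
have bid := @bnd_id R H.
have rr h : r (r h) = r h by apply: rS.
have sr : adjoint r = r.
  apply: adjoint_eq => // h k.
  have e1 : inner (r h) k = inner (r h) (r k).
    apply/eqP; rewrite -subr_eq0 -innerBr innerC conjC_eq0; apply/eqP; exact: hr.
  have e2 : inner h (r k) = inner (r h) (r k).
    by apply/eqP; rewrite -subr_eq0 -innerBl; apply/eqP; exact: hr.
  by rewrite e1 e2.
pose q : op := idfun - r.
have qE h : q h = h - r h by [].
have bq : bounded_op q by apply: (subB bnd_subspace).
have Nq : N q by apply: (subB (vna_subspace hN)) => //; exact: vna_id hN.
have qN n : N n -> q \o n = n \o q.
  move=> Nn; apply/funext => h; rewrite /= !qE opB; last exact: Nb.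
  by rewrite -[n (r h)]/((n \o r) h) rN.
have jq j : J j -> j \o q = j.
  move=> Jj; have bj := Nb _ (JN _ Jj).
  by apply/funext => h; rewrite /= qE opB // (Sr h j Jj) subr0.
have qS h : S h -> q h = 0 by move=> Sh; rewrite qE rS // subrr.
have qq : q \o q = q.
  by apply/funext => h; rewrite -[LHS]/(q (q h)) !qE opB // rr subrr subr0.
have cq : center N q by split=> //; split=> // n Nn; rewrite qN.
have sq : adjoint q = q by rewrite adjB // adj_id sr.
exists q; split => //.
move=> f hf e e0.
pose Jf : set (nat -> H) := [set j \o f | j in J].
have hJf : subspace Jf.
  split; first by exists 0 => //; apply: sub0.
  move=> a _ _ [u hu <-] [v hv <-]; exists (a *: u + v) => //.
  exact: hJ.2.
have JfL : Jf `<=` L2.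
  by move=> _ [u hu <-]; apply: L2_bnd => //; apply/Nb/JN.
have [p [Lp hp1 hp2]] := projection_theorem ip2_semi ell2_complete hJf JfL hf.
pose t := f - p; have Lt : L2 t by apply: (subB L2_subspace).
have jt j : J j -> j \o t = 0.
  move=> Jj; have Nj := JN _ Jj; have bj := Nb _ Nj.
  pose m := adjoint j \o j.
  have Jm : J m by case: (ideal j (adjoint j) Jj (vna_adjoint hN Nj)).
  have Nm := JN _ Jm; have bm := Nb _ Nm.
  have Lmf : L2 (m \o f) by apply: L2_bnd.
  have Lmp : L2 (m \o p) by apply: L2_bnd.
  have Ljt : L2 (j \o t) by apply: L2_bnd.
  have e1 : ip2 t (m \o f) = 0 by apply: hp2; exists m.
  have e2 : ip2 t (m \o p) = 0.
    apply: cabs_eq0; apply/eqP; rewrite eq_le cabs_ge0 andbT.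
    apply/ler_addgt0Pr => d d0; rewrite add0r.
    have [c [c0 hc]] := bnd_bound bm.
    have n1 : 0 < nm ip2 t * c + 1 by rewrite ltr_wpDl ?mulr_ge0 ?nm_ge0.
    have d1 : 0 < d / (nm ip2 t * c + 1) by rewrite divr_gt0.
    have [_ [s Js <-] hs] := hp1 _ (exprn_gt0 2 d1).
    have Nms := JN _ Js; have bs := Nb _ Nms.
    have Lsf : L2 (s \o f) by apply: L2_bnd.
    have Lps : L2 (p - (s \o f)) by apply: (subB L2_subspace).
    have Lms : L2 (m \o (s \o f)) by apply: L2_bnd.
    have e3 : ip2 t (m \o (s \o f)) = 0.
      by apply: hp2; exists (m \o s) => //; case: (ideal s m Js Nm).
    have e4 : m \o (p - (s \o f)) = (m \o p) - (m \o (s \o f)).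
      by apply/funext => i; exact: (opB (p i) (s (f i)) bm).
    have -> : ip2 t (m \o p) = ip2 t (m \o (p - (s \o f))).
      by rewrite e4 (ipBr ip2_semi) // e3 subr0.
    have Lmps : L2 (m \o (p - (s \o f))) by apply: L2_bnd.
    apply: le_trans (cauchy_schwarz_nm ip2_semi Lt Lmps) _.
    have /ltW h1 := nm_lt ip2_semi Lps d1 hs.
    have h2 : nm ip2 (m \o (p - (s \o f))) <= c * nm ip2 (p - (s \o f)).
      rewrite -(@ler_pXn2r _ 2) ?nnegrE ?mulr_ge0 ?nm_ge0 // exprMn !(nm_sq ip2_semi) //.
      exact: nsq2_op.
    apply: (@le_trans _ _ (nm ip2 t * (c * (d / (nm ip2 t * c + 1))))).
      apply: ler_wpM2l; first exact: nm_ge0.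
      by apply: le_trans h2 _; apply: ler_wpM2l.
    rewrite !mulrA ler_pdivrMr // [leLHS]mulrC ler_wpM2l ?(ltW d0) //; lra.
  have e5 : m \o t = (m \o f) - (m \o p).
    by apply/funext => i; exact: (opB (f i) (p i) bm).
  have n0 : nsq ip2 (j \o t) = 0.
    rewrite /nsq -(ip2_adj (j \o t) t bj).
    rewrite -[adjoint j \o (j \o t)]/(m \o t) e5 (si_conj ip2_semi Lt); last first.
      exact: (subB L2_subspace).
    by rewrite (ipBr ip2_semi) // e1 e2 subrr rmorph0.
  apply/funext => i; apply: nh_eq0; apply/eqP; rewrite -sqrf_eq0 eq_le sqr_ge0 andbT.
  by rewrite -n0; apply: (@nsq2_ge1 _ _ (j \o t)).
have qt : q \o t = 0.
  apply/funext => i; apply: qS => j Jj.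
  by rewrite -[LHS]/((j \o t) i) jt.
have [c [c0 hc]] := bnd_bound bq.
have k0 : 0 < c ^+ 2 + 1 by rewrite ltr_wpDl // sqr_ge0.
have d0 : 0 < e / (c ^+ 2 + 1) by rewrite divr_gt0.
have [_ [j Jj <-] hj] := hp1 _ d0; exists j => //.
have Lps : L2 (p - (j \o f)) by apply: (subB L2_subspace) => //; apply: JfL; exists j.
have -> : (q - j) \o f = q \o (p - (j \o f)).
  apply/funext => i.
  rewrite -[LHS]/(q (f i) - j (f i)) -[RHS]/(q (p i - j (f i))) opB //.
  have e1 : q (j (f i)) = j (f i).
    by rewrite -[LHS]/((q \o j) (f i)) qN ?jq //; exact: JN.
  have e2 : q (f i) = q (p i).
    have : q (f i) - q (p i) = 0 by rewrite -opB // -[LHS]/((q \o t) i) qt.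
    by move/eqP; rewrite subr_eq0 => /eqP.
  by rewrite e1 e2.
apply: le_lt_trans (nsq2_op (conj c0 hc) Lps) _.
have n0 := nsq_ge0 ip2_semi Lps.
rewrite ltr_pdivlMr // in hj; nra.
Qed.
End CentralSupport.

(** * The three bimodules *)

Section Main.
Context {R : realType} {H : hilbertType R}.
Local Notation C := (cplx R).
Local Notation op := (H -> H).
Implicit Types (x y z n u v w b : op) (h k : H) (rho phi : op -> C) (S A : set op).
Variables (M N D : set op) (E : op -> op) (B : set op).
Hypothesis hT : cartan_triple M N D.
Hypothesis hE : faithful_normal_ce M N E.
Hypothesis hB : weak_star_closed_bimodule M N B.
Let hM : von_neumann_algebra M := ct_vnaM hT.
Let hN : von_neumann_algebra N. Proof. by case: (ct_vnaN hT). Qed.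
Let NM : N `<=` M. Proof. by case: (ct_vnaN hT). Qed.
Let hD : von_neumann_algebra D. Proof. by case: (ct_vnaD hT). Qed.
Let Mb := vna_bounded hM.
Let Ms := vna_subspace hM.
Let Nb := vna_bounded hN.
Let Ns := vna_subspace hN.
Let ce : conditional_expectation M N E. Proof. by case: hE. Qed.
Let BM : B `<=` M. Proof. by case: hB => -[]. Qed.
Let Bs : subspace B. Proof. by case: hB => -[]. Qed.
Let Bact m n b : N m -> N n -> B b -> B (m \o b \o n).
Proof. by case: hB => -[_ _ h] _; apply: h. Qed.
Let S0 := lin_span (GN M D `&` B).
Let hS0 : subspace S0 := lin_span_subspace _.
Let S0B : S0 `<=` B.
Proof. by apply: lin_span_min => // x []. Qed.
Let S0M : S0 `<=` M. Proof. exact: subset_trans S0B BM. Qed.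
Let B0 := weak_star_closure M S0.
Let B1 := bures_closure M N E S0.

Lemma S0_unitary_invariant : unitary_invariant N S0.
Proof.
move=> u x Nu uu [m [c [v [hv ->]]]].
have Nid := vna_id hN; have bu := Nb Nu.
have bv i : bounded_op (v i) by apply/Mb/BM; case: (hv i).
have gb i : (GN M D `&` B) (u \o v i) /\ (GN M D `&` B) (v i \o u).
  have [gv hb] := hv i; have [g1 g2] := GN_mul_unitary hT gv Nu uu.
  split; split=> //; first exact: (Bact Nu Nid hb).
  exact: (Bact Nid Nu hb).
split.
  have -> : u \o (\sum_(i < m) c i *: v i) = \sum_(i < m) c i *: (u \o v i).
    clear -bu bv; elim: m c v bv => [|m ih] c v bv.
      by rewrite !big_ord0 comp0r.
    by rewrite !big_ord_recr /= compDr // compZr // ih.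
  apply: (sub_sum hS0) => i _; apply: (subZ hS0).
  by apply: sub_lin_span; case: (gb i).
have -> : (\sum_(i < m) c i *: v i) \o u = \sum_(i < m) c i *: (v i \o u).
  clear; elim: m c v => [|m ih] c v; first by rewrite !big_ord0.
  by rewrite !big_ord_recr /= -ih.
apply: (sub_sum hS0) => i _; apply: (subZ hS0).
by apply: sub_lin_span; case: (gb i).
Qed.

Lemma B0_bimodule : weak_star_closed_bimodule M N B0.
Proof.
split; last exact: weak_star_closureK.
apply: (unitary_invariant_bimodule hM hN).
- exact: (weak_star_closure_subspace hM).
- exact: weak_star_closure_sub.
- by apply: (weak_star_unitary_invariant hM NM) => //; exact: S0_unitary_invariant.
Qed.

Lemma B1_bimodule : weak_star_closed_bimodule M N B1.
Proof.
split; last exact: (bures_weak_star_closed hM hN hE).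
apply: (unitary_invariant_bimodule hM hN).
- exact: (bures_closure_subspace hM hN hE).
- exact: bures_closure_sub.
- by apply: (bures_unitary_invariant hM hN NM hE) => //; exact: S0_unitary_invariant.
Qed.

Lemma B0_sub_B1 : B0 `<=` B1.
Proof. exact: (weak_star_sub_bures hM hN hE). Qed.

Lemma B0_sub_B : B0 `<=` B.
Proof.
case: hB => _ e; rewrite -[B in _ `<=` B]e; exact: weak_star_closure_mono.
Qed.

Lemma predual_pos_vec (f : nat -> H) : L2 f -> predual_pos N (fun x => ip2 (x \o f) f).
Proof.
move=> hf; split; first exact: (pd_vec2 hN).
move=> x Nx; have bx := Nb Nx.
rewrite (_ : (adjoint x \o x) \o f = adjoint x \o (x \o f)) // ip2_adj //.
by apply: (si_ge0 ip2_semi); exact: L2_bnd.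
Qed.

Lemma predual_nonneg_decomp phi : predual M phi ->
  exists (r : 'I_4 -> op -> C) (a : 'I_4 -> C),
    [/\ forall i, predual_pos N (r i), forall i, cabs (a i) = 1 &
       forall n, N n -> 4 * phi n = \sum_(i < 4) a i * r i n].
Proof.
move=> /(predualP _ Mb)[f [g [hf hg e]]].
pose s (i : 'I_4) : C := nth 0 [:: 1; -1; ic; - ic] i.
pose fi i := s i *: g + f.
exists (fun i x => ip2 (x \o fi i) (fi i)), s; split.
- by move=> i; apply: predual_pos_vec; apply: L2_subspace.2.
- have c1 : cabs 1 = 1 :> R by rewrite (cabs_rc (1 : R)) normr1.
  by move=> [[|[|[|[|//]]]] ?]; rewrite /s /= ?cabsN ?cabs_ic ?c1.
move=> n Nn; rewrite e; last exact: NM.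
rewrite (pd_polar hM hf hg (NM Nn)) !big_ord_recr big_ord0 /= /fi /s /=.
by rewrite add0r mul1r mulN1r mulNr.
Qed.

(** If [y] in the span of [GN M D `&` B] approaches [v] in the Bures topology,
    then [v E (v^* y)], which is in [B], approaches [v E (v^* v) = v] in the
    weak-* topology: for positive normal [rho], [rho (E (v^* (y - v)))] is
    bounded by the Bures seminorms of [y - v] and [v]. *)
Lemma GN_B1_sub_B v : GN M D v -> B1 v -> B v.
Proof.
move=> hv /(bures_closureP hM hN hE _ S0M)[Mv hcl].
case: hB => _ clB; apply: (weak_star_closed_sep hM Bs BM clB) => // phi hphi z0.
have hpsi := pd_mull hM hphi Mv; set psi := fun x => _ in hpsi.
have [r [a [hr ha hdec]]] := predual_nonneg_decomp hpsi.
have [rho [hrho dom]] : exists rho, predual_pos N rho /\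
    forall i z, M z -> nsq (wip E (r i) ) z <= nsq (wip E rho) z.
  exists (fun x => \sum_(i < 4) r i x).
  have hp m (t : 'I_m -> op -> C) : (forall i, predual_pos N (t i)) ->
      predual_pos N (fun x => \sum_(i < m) t i x).
    elim: m t => [|m ih] t ht.
      split; last by move=> x _; rewrite big_ord0.
      apply: (pd_ext hN (pd_scale hN 0 (pd_vec hN 0 0))) => z _.
      by rewrite big_ord0 mul0r.
    have := predual_pos_add hN
      (ih (fun i => t (widen_ord (leqnSn m) i)) (fun i => ht _)) (ht ord_max).
    have -> // : (fun x => \sum_(i < m) t (widen_ord (leqnSn m) i) x + t ord_max x) =
      (fun x => \sum_(i < m.+1) t i x).
    by apply/funext => x; rewrite big_ord_recr.
  split; first exact: hp.
  move=> i z Mz; rewrite /nsq [in leRHS]/wip (bigD1 i) //= raddfD lerDl raddf_sum.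
  apply: sumr_ge0 => j _; exact: (nsq_ge0 (wip_semi hM hN hE (hr j)) Mz).
have si := wip_semi hM hN hE hrho.
apply: cabs_eq0; apply/eqP; rewrite eq_le cabs_ge0 andbT.
apply/ler_addgt0Pr => e e0; rewrite add0r.
have n1 : 0 < nm (wip E rho) v + 1 by rewrite ltr_wpDl ?nm_ge0.
have d0 : 0 < e / (nm (wip E rho) v + 1) by rewrite divr_gt0.
have [y Sy hy] := hcl _ hrho _ (exprn_gt0 2 d0).
have By := S0B Sy; have My := BM By.
have Myv : M (y - v) by apply: (subB Ms).
have /ltW hlt := nm_lt si Myv d0 hy.
have Mvy := M_adjcomp hM My Mv; have Mvv := M_adjcomp hM Mv Mv.
have Mvd := M_adjcomp hM Myv Mv.
have e1 : psi (E (adjoint v \o y)) = 0 by apply: z0; exact: (mean_in_bimodule hT hE hB hv By).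
have e2 : psi (E (adjoint v \o v)) = phi v.
  rewrite (ce_id ce); last exact: (D_sub_N hT (GN_initial hT hv)).
  by rewrite /psi (GN_vvv hT hv).
have Nd := ce_range ce Mvd.
have e3 : - phi v = psi (E (adjoint v \o (y - v))).
  have bva := bnd_adj (Mb Mv).
  have -> : E (adjoint v \o (y - v)) = E (adjoint v \o y) - E (adjoint v \o v).
    rewrite compBr // addrC -scaleN1r (ce_linear ce) // scaleN1r addrC //.
  rewrite (pdB hM hpsi) ?e1 ?e2 ?sub0r //; apply: NM; exact: (ce_range ce).
have b1 : cabs (4 * psi (E (adjoint v \o (y - v)))) <=
    \sum_(i < 4) nm (wip E rho) (y - v) * nm (wip E rho) v.
  rewrite hdec //; apply: le_trans
    (_ : \sum_(i < 4) cabs (a i * r i (E (adjoint v \o (y - v)))) <= _).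
    elim/big_ind2 : _ => [|x1 x2 y1 y2 h1 h2|//]; first by rewrite cabs0.
    by apply: le_trans (cabsD _ _) _; apply: lerD.
  apply: ler_sum => i _; rewrite cabsM ha mul1r -/(wip E (r i) (y - v) v).
  have sii := wip_semi hM hN hE (hr i).
  apply: le_trans (cauchy_schwarz_nm sii Myv Mv) _.
  have mono z : M z -> nm (wip E (r i)) z <= nm (wip E rho) z.
    by move=> Mz; rewrite /nm ler_sqrt ?dom // (nsq_ge0 si).
  by apply: ler_pM; rewrite ?nm_ge0 ?mono.
have c4 : cabs 4 = 4 :> R by have := cabs_rc (4 : R); rewrite rmorph_nat normr_nat.
have s4 (t : R) : \sum_(i < 4) t = 4 * t by rewrite sumr_const card_ord mulr_natl.
rewrite s4 cabsM c4 ler_pM2l // in b1.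
rewrite -cabsN e3; apply: le_trans b1 _.
apply: le_trans (_ : e / (nm (wip E rho) v + 1) * nm (wip E rho) v <= _).
  by rewrite ler_wpM2r ?nm_ge0.
rewrite mulrAC ler_pdivrMr // ler_wpM2l ?(ltW e0) //; lra.
Qed.

Section Full.
Hypothesis full : D = center N.

(** The elements [m] of [N] with [v m] in [B] form a two-sided ideal; as [B] is
    weak-* closed, its central support [q] belongs to it.  In a full triple [q]
    is in [D], so [v q] is again a normalizer, and [v n = v q n]. *)
Lemma GN_N_in_B0 v n : GN M D v -> N n -> B (v \o n) -> B0 (v \o n).
Proof.
move=> hv Nn Bvn; have Mv := GN_M hv; have bv := Mb Mv.
have Nid := vna_id hN.
pose J : set op := [set m | N m /\ B (v \o m)].
have hJ : subspace J.
  split; first by split; [exact: sub0 Ns | rewrite comp0r //; exact: sub0 Bs].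
  move=> a x y [Nx Bx] [Ny By]; split; first exact: Ns.2.
  by rewrite comp_linr //; apply: Bs.2.
have JN : J `<=` N by move=> m [].
have ideal j m : J j -> N m -> J (m \o j) /\ J (j \o m).
  move=> [Nj Bj] Nm; split; split; try exact: (vna_comp hN).
    have -> : v \o (m \o j) = (v \o m \o adjoint v) \o (v \o j) \o idfun.
      apply/funext => h /=.
      have e k : m (adjoint v (v k)) = adjoint v (v (m k)).
        exact: (N_commutes_Dh hT k Nm (GN_initial hT hv)).
      by rewrite e (GN_vvvh hT hv).
    by apply: Bact => //; exact: (GN_conj_N hT hv).
  exact: (Bact Nid Nm Bj).
have [q [cq qq sq jq qap]] := central_support hN hJ JN ideal.
have Dq : D q by rewrite full.
have [Nq [_ qcomm]] := cq.
have Mq := NM Nq; have bq := Mb Mq.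
have Bvq : B (v \o q).
  case: hB => _ clB; apply: (weak_star_closed_sep hM Bs BM clB); first exact: (vna_comp hM).
  move=> phi hphi z0.
  have /(predualP _ Mb)[f [g [hf hg e]]] := pd_mull hM hphi Mv.
  rewrite e //; apply: cabs_eq0; apply/eqP; rewrite eq_le cabs_ge0 andbT.
  apply/ler_addgt0Pr => d d0; rewrite add0r.
  have n1 : 0 < nm ip2 g + 1 by rewrite ltr_wpDl ?nm_ge0.
  have d1 : 0 < d / (nm ip2 g + 1) by rewrite divr_gt0.
  have [j Jj hj] := qap f hf _ (exprn_gt0 2 d1).
  have Mj := NM (JN _ Jj).
  have Lq : L2 (q \o f) by apply: L2_bnd.
  have Lj : L2 (j \o f) by apply: L2_bnd => //; exact: Mb.
  have Lqj : L2 ((q - j) \o f) by apply: (subB L2_subspace Lq Lj).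
  have -> : ip2 (q \o f) g = ip2 ((q - j) \o f) g.
    have := ipBl ip2_semi Lq Lj hg; rewrite -(e j Mj) z0; last by case: Jj.
    by rewrite subr0 => <-.
  apply: le_trans (cauchy_schwarz_nm ip2_semi Lqj hg) _.
  have /ltW hlt := nm_lt ip2_semi Lqj d1 hj.
  apply: le_trans (_ : d / (nm ip2 g + 1) * nm ip2 g <= _).
    by rewrite ler_wpM2r ?nm_ge0.
  rewrite mulrAC ler_pdivrMr // ler_wpM2l ?(ltW d0) //; lra.
have qh h : q (q h) = q h by rewrite -[LHS]/((q \o q) h) qq.
have qc d h : N d -> q (d h) = d (q h).
  by move=> Nd; rewrite -[LHS]/((q \o d) h) qcomm.
have Gvq : GN M D (v \o q).
  have Di := GN_initial hT hv; have Ni := D_sub_N hT Di.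
  split; first exact: (vna_comp hM).
  - rewrite /partial_isometry adj_comp // sq.
    have -> : (q \o adjoint v) \o (v \o q) = (adjoint v \o v) \o q.
      by apply/funext => h; rewrite -[LHS]/(q ((adjoint v \o v) (q h))) qc // qh.
    have [_ [pp sp] _] := hv; split.
      apply/funext => h; rewrite -[LHS]/((adjoint v \o v) (q ((adjoint v \o v) (q h)))).
      by rewrite qc // qh -[LHS]/(((adjoint v \o v) \o (adjoint v \o v)) (q h)) pp.
    rewrite adj_comp //; last exact: Nb.
    by rewrite sq sp qcomm.
  - move=> l Dl; rewrite adj_comp // sq; split.
      have -> : (q \o adjoint v) \o l \o (v \o q) = q \o (adjoint v \o l \o v) \o q by [].
      apply: (vna_comp hD) => //; apply: (vna_comp hD) => //; exact: (GN_conjl hv).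
    have -> : (v \o q) \o l \o (q \o adjoint v) = v \o (q \o l \o q) \o adjoint v by [].
    apply: (GN_conjr hv); apply: (vna_comp hD) => //; exact: (vna_comp hD).
have S0vq : S0 (v \o q) by apply: sub_lin_span.
have -> : v \o n = idfun \o (v \o q) \o n.
  have Jn : J n by [].
  by rewrite -{1}(jq n Jn) -[RHS]/(v \o (q \o n)) qcomm.
case: B0_bimodule => -[_ _ act] _; apply: act => //.
exact: (sub_weak_star_closure hM).
Qed.

(** The constant depends on [g] but not on [b]: near orthogonality to
    normalizers extends to near orthogonality to a fixed element of their
    span. *)
Lemma span_GN_bound rho (good : R -> op -> Prop) (g : op) :
  predual_pos N rho ->
  (forall eta b, good eta b -> 0 < eta /\ M b) ->
  (forall eta b v, good eta b -> GN M D v ->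
     cabs (wip E rho b v) <= eta * nm (wip E rho) idfun) ->
  lin_span (GN M D) g ->
  exists2 c : R, 0 <= c & forall eta b, good eta b -> cabs (wip E rho b g) <= c * eta.
Proof.
move=> hrho hg1 hg2 [m [c [v [hv ->]]]].
have si := wip_semi hM hN hE hrho.
elim: m c v hv => [|m ih] c v hv.
  exists 0 => // eta b /hg1[_ Mb']; rewrite big_ord0 (ip0r si) // cabs0 mul0r //.
have [|c0 c00 hc0] := ih (fun i => c (widen_ord (leqnSn m) i))
  (fun i => v (widen_ord (leqnSn m) i)).
  by move=> i; apply: hv.
exists (c0 + cabs (c ord_max) * nm (wip E rho) idfun).
  by rewrite addr_ge0 // mulr_ge0 ?cabs_ge0 ?nm_ge0.
move=> eta b hgood; have [eta0 Mb'] := hg1 _ _ hgood.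
have Mv i : M (v i) by apply: GN_M (hv i).
rewrite big_ord_recr /= (ipDr si) //; last 2 first.
- by apply: (sub_sum Ms) => i _; apply: (subZ Ms).
- exact: (subZ Ms).
apply: le_trans (cabsD _ _) _; rewrite mulrDl; apply: lerD; first exact: hc0.
rewrite (ipZr si) // cabsM cabsC -mulrA; apply: ler_wpM2l; first exact: cabs_ge0.
by rewrite mulrC; apply: hg2.
Qed.

(** Let [s] in [B0] be nearly closest to [x] and [b = x - s].  As
    [v E (v^* b)] is in [B0] and its product with [b] is
    [rho (n^* n)] for [n = E (v^* b)], near orthogonality of [b] to [B0] makes
    [rho (n^* n)], and so the product of [b] with [v], small.  By regularity
    [x] is approximated by a span [g] of normalizers, so
    [<b, b> = <b, g> + <b, x - g> - <b, s>] is small. *)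
Lemma B_sub_B1 : B `<=` B1.
Proof.
move=> x Bx; have Mx := BM Bx.
have B0M : B0 `<=` M by exact: weak_star_closure_sub.
have hB0 : subspace B0 by exact: (weak_star_closure_subspace hM).
suff : bures_closure M N E B0 x.
  move=> h; apply: (bures_closureK hM hN hE S0M).
  exact: bures_closure_mono B0_sub_B1 _ h.
apply/(bures_closureP hM hN hE _ B0M); split=> // rho hrho e e0.
pose ip := wip E rho; have si : semi_inner M ip := wip_semi hM hN hE hrho.
have Mid := vna_id hM; have Nid := vna_id hN.
have [||d hd1 hd2] := ex_near_inf si (S := B0) (x := x).
- by exists 0; exact: sub0 hB0.
- by move=> s /B0M Ms'; apply: (subB Ms).
pose good eta b := [/\ 0 < eta, B b & forall s, B0 s -> cabs (ip b s) ^+ 2 <= eta ^+ 2 * nsq ip s].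
have good_GN eta b v : good eta b -> GN M D v -> cabs (ip b v) <= eta * nm ip idfun.
  move=> [eta0 Bb hb] hv; have Mv := GN_M hv; have bv := Mb Mv; have Mb' := BM Bb.
  have Mvb := M_adjcomp hM Mb' Mv.
  pose n := E (adjoint v \o b); have Nn : N n := ce_range ce Mvb.
  have Nna := vna_adjoint hN Nn; have bn := Nb Nn; have Mn := NM Nn.
  have Bvn : B (v \o n) := mean_in_bimodule hT hE hB hv Bb.
  have B0vn := GN_N_in_B0 hv Nn Bvn.
  have vn : (adjoint v \o v) \o n = n.
    have Ni := D_sub_N hT (GN_initial hT hv).
    rewrite /n -[LHS]/(((adjoint v \o v) \o E (adjoint v \o b)) \o idfun).
    rewrite -(ce_bimodule ce) //; congr (E _).
    by apply/funext => h; rewrite /= (GN_vvvah hT hv).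
  have e1 : ip b (v \o n) = rho (adjoint n \o n).
    rewrite /ip /wip adj_comp //.
    rewrite -[(adjoint n \o adjoint v) \o b]/(adjoint n \o (adjoint v \o b) \o idfun).
    by rewrite (ce_bimodule ce).
  have e2 : ip (v \o n) (v \o n) = rho (adjoint n \o n).
    rewrite /ip /wip adj_comp //.
    rewrite -[(adjoint n \o adjoint v) \o (v \o n)]/(adjoint n \o ((adjoint v \o v) \o n)) vn.
    by rewrite (ce_id ce) //; exact: (vna_comp hN).
  have e3 : ip n n = rho (adjoint n \o n).
    by rewrite /ip /wip (ce_id ce) //; exact: (vna_comp hN).
  have n0 := nsq_ge0 si Mn.
  have hle : nsq ip n <= eta ^+ 2.
    have := hb _ B0vn; rewrite e1 -e3 (ip_nsq si) // cabs_rc ger0_norm //.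
    rewrite [nsq ip (v \o n)]/nsq e2 -e3 (ip_nsq si) // re_rc.
    have [->|nN] := eqVneq (nsq ip n) 0; first by rewrite sqr_ge0.
    have np : 0 < nsq ip n by rewrite lt0r nN.
    by rewrite expr2 ler_pM2r.
  have e4 : ip b v = ip n idfun.
    rewrite /ip /wip adj_id -/n (_ : idfun \o n = n) //.
    by rewrite (ce_id ce).
  rewrite e4; apply: le_trans (cauchy_schwarz_nm si Mn Mid) _.
  apply: ler_wpM2r; first exact: nm_ge0.
  rewrite -(@ler_pXn2r _ 2) ?nnegrE ?nm_ge0 ?(ltW eta0) //.
  by rewrite (nm_sq si).
pose Q := nm ip x + 1; have Q0 : 0 < Q by rewrite ltr_wpDl ?nm_ge0.
have [f hf dom] := wip_dominated hM hE hrho.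
have gam0 : 0 < e / (4 * Q) by rewrite divr_gt0 // mulr_gt0.
have GNM : lin_span (GN M D) `<=` M.
  by apply: (lin_span_min Ms) => v hv; exact: GN_M hv.
have Mdense : weak_star_closure M (lin_span (GN M D)) x.
  by have := ct_regular hT; rewrite /regular_subalgebra /weak_star_dense => ->.
have [g hg hxg] := mazur hM (lin_span_subspace _) GNM Mdense hf (exprn_gt0 2 gam0).
have Mg := GNM _ hg; have Mxg : M (x - g) by apply: (subB Ms).
have /ltW pxg := nm_lt si Mxg gam0 (le_lt_trans (dom _ Mxg) hxg).
have [c c0 hc] := @span_GN_bound rho good g hrho
  (fun eta b hgd => let: And3 h1 h2 _ := hgd in conj h1 (BM h2)) good_GN hg.
(* The three terms of [<b, b>] are bounded by [c * eta], [e / 4] and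
   [2 * Q * eta]. *)
pose K := c + 2 * Q + e; have K0 : 0 < K by rewrite /K; lra.
pose eta := Num.min 1 (e / (4 * K)).
have eta0 : 0 < eta by rewrite /eta lt_min ltr01 divr_gt0 // mulr_gt0.
have eta1 : eta <= 1 by rewrite /eta ge_min lexx.
have eta2 : eta * (4 * K) <= e.
  by rewrite -ler_pdivlMr ?mulr_gt0 // /eta ge_min lexx orbT.
have [s B0s hs] := hd2 _ (exprn_gt0 2 eta0).
have Ms' := B0M _ B0s; pose b := x - s; have Mb' : M b by apply: (subB Ms).
have Bb : B b by apply: (subB Bs) => //; exact: B0_sub_B.
have gb : good eta b.
  split=> // t B0t; apply: (near_min si Mb' (B0M _ B0t) (d := d)); last exact: ltW.
  move=> a; rewrite /b -addrA -opprD; apply: hd1.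
  by apply: (subD hB0) => //; exact: (subZ hB0).
exists s => //; rewrite -/ip -opprB (nsqN si) // -/b.
have nx2 : nsq ip x = nm ip x ^+ 2 by rewrite (nm_sq si).
have bQ : nm ip b <= Q.
  rewrite -(@ler_pXn2r _ 2) ?nnegrE ?nm_ge0 ?(ltW Q0) // (nm_sq si) //.
  have h0 := hd1 0 (sub0 hB0); rewrite subr0 nx2 in h0.
  apply: le_trans (ltW hs) _; rewrite /Q.
  have := nm_ge0 ip x; nra.
have sQ : nm ip s <= 2 * Q.
  have -> : s = x - b by rewrite /b opprB addrC subrK.
  apply: le_trans (nmD si Mx (subN Ms Mb')) _; rewrite (nmN si) //.
  rewrite /Q in bQ *; lra.
have h1 : cabs (ip b g) <= c * eta := hc _ _ gb.
have h2 : cabs (ip b (x - g)) <= Q * (e / (4 * Q)).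
  apply: le_trans (cauchy_schwarz_nm si Mb' Mxg) _.
  by apply: ler_pM; rewrite ?nm_ge0.
have h3 : cabs (ip b s) <= eta * nm ip s.
  case: gb => _ _ /(_ _ B0s) h.
  rewrite -(@ler_pXn2r _ 2) ?nnegrE ?cabs_ge0 ?mulr_ge0 ?nm_ge0 ?(ltW eta0) //.
  by rewrite exprMn (nm_sq si).
have e1 : ip b b = ip b g + ip b (x - g) - ip b s.
  by rewrite -(ipDr si) // [g + _]addrC subrK -(ipBr si).
have h4 : nsq ip b <= cabs (ip b g) + cabs (ip b (x - g)) + cabs (ip b s).
  rewrite /nsq e1; apply: le_trans (re_le_cabs _) _.
  apply: le_trans (cabsD _ _) _; rewrite cabsN lerD2r; exact: cabsD.
have e2 : Q * (e / (4 * Q)) = e / 4 by field; rewrite gt_eqF.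
rewrite e2 in h2; apply: le_lt_trans h4 _.
have h5 : eta * nm ip s <= eta * (2 * Q) by rewrite ler_wpM2l // ltW.
have h6 : eta * c + eta * (2 * Q) <= eta * K by rewrite -mulrDr ler_wpM2l ?(ltW eta0) // /K; lra.
lra.
Qed.
End Full.
End Main.

Theorem proposition5p8 (R : realType) (H : hilbertType R)
    (M N D : set (H -> H)) (E : (H -> H) -> (H -> H)) (B : set (H -> H))
    (hMND : cartan_triple M N D) (hE : faithful_normal_ce M N E)
    (hB : weak_star_closed_bimodule M N B) :
  let B0 := weak_star_closure M (lin_span (GN M D `&` B)) in
  let B1 := bures_closure M N E (lin_span (GN M D `&` B)) in
  [/\ weak_star_closed_bimodule M N B0,
      weak_star_closed_bimodule M N B1,
      B0 `<=` B1,
      GN M D `&` B0 = GN M D `&` B /\ GN M D `&` B = GN M D `&` B1 &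
      full_cartan_triple M N D ->
        [/\ B0 `<=` B, B `<=` B1 & B1 = bures_closure M N E B]].
Proof.
move=> B0 B1.
have hM := ct_vnaM hMND; have [hN _] := ct_vnaN hMND.
have BM : B `<=` M by case: hB => -[].
have S0B : lin_span (GN M D `&` B) `<=` B.
  by apply: lin_span_min; [case: hB => -[] | move=> x []].
have S0M := subset_trans S0B BM.
have B01 := B0_sub_B1 hMND hE hB; have B0B := B0_sub_B (D := D) hB.
have GB0 : GN M D `&` B `<=` B0.
  by move=> v hv; apply: (sub_weak_star_closure hM) => //; apply: sub_lin_span.
split.
- exact: (B0_bimodule hMND hB).
- exact: (B1_bimodule hMND hE hB).
- exact: B01.
- split; apply/seteqP; split=> v [hv hb]; split=> //.
  + by apply: B0B.
  + by apply: GB0.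
  + by apply: B01; apply: GB0.
  + exact: (GN_B1_sub_B hMND hE hB).
- move=> [_ full]; have BB1 := B_sub_B1 hMND hE hB full; split=> //.
  apply/seteqP; split; first exact: bures_closure_mono.
  move=> x hx; apply: (bures_closureK hM hN hE S0M).
  exact: bures_closure_mono BB1 _ hx.
Qed.
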